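(* For every $\rho\in(0,1)$ there is a number $\alpha(\rho)\in[0.17,\alpha^*]$ such that, with $n=3m$ ranging over odd multiples of three and $d:=\sqrt m/\log m$, $$\lim_{n\to\infty}\Pr\Big[f(\mathbf x^{(ab)})=f(\mathbf x^{(bc)})=f(\mathbf x^{(ca)})\;\Big|\;\mathcal F_{\rho,d}\Big]=\alpha(\rho),$$ and moreover $\alpha(\rho)\to\alpha^*$ as $\rho\to0^+$. Here $\alpha^*\approx23.2\%$ is the absolute constant defined in the context.
   Context: There are three alternatives $a,b,c$ and $n=3m$ voters ($n$ odd). Each voter independently chooses one of the $3!$ rankings of the alternatives uniformly at random. For $(kk')\in\{(ab),(bc),(ca)\}$, $x_i^{(kk')}=1$ if voter $i$ prefers $k$ to $k'$ and $-1$ otherwise, and $\mathbf x^{(kk')}=(x^{(kk')}_1,\dots,x_n^{(kk')})$. The pairwise comparison function $f:\{-1,1\}^n\to\{-1,1\}$ is $$f(x_1,\dots,x_n)=\mathrm{sgn}\Big(\sum_{i=1}^m\mathrm{sgn}(x_{3i-2}+x_{3i-1}+x_{3i})\Big).$$ Noise operator: for $\mathbf x\in\{-1,1\}^n$, $N_\rho(\mathbf x)$ is the distribution of $\mathbf y\in\{-1,1\}^n$ with independent coordinates, $y_i=-x_i$ with probability $\frac{1-\rho}2$ and $y_i=x_i$ otherwise; $T_\rho f(\mathbf x)=\mathbb E_{\mathbf y\sim N_\rho(\mathbf x)}[f(\mathbf y)]$. The event $\mathcal F_{\rho,d}$ is $$\max\big(|T_\rho f(\mathbf x^{(ab)})|,|T_\rho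 f(\mathbf x^{(bc)})|,|T_\rho f(\mathbf x^{(ca)})|\big)\le\frac d{\sqrt m}.$$ The constant $\alpha^*\approx 0.232$ is the limit (which exists), as $n\to\infty$ over odd multiples of three, of $\Pr\big[f(\mathbf x^{(ab)})=f(\mathbf x^{(bc)})=f(\mathbf x^{(ca)})\mid\mathcal E_{d'}\big]$ with $d'=\sqrt n/\log n$, where $\mathcal E_{d'}$ is the event that $|\sum_{i=1}^nx_i^{(kk')}|\le d'$ for each $(kk')\in\{(ab),(bc),(ca)\}$. *)

(* Defs.v *)
From HB Require Import structures.
From mathcomp Require Import all_boot all_order all_algebra all_fingroup.
From mathcomp Require Import all_classical all_reals all_analysis.
Import Order.TTheory GRing.Theory Num.Theory.
Import numFieldNormedType.Exports.

Set Implicit Arguments.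
Unset Strict Implicit.
Unset Printing Implicit Defensive.

Local Open Scope classical_set_scope.
Local Open Scope ring_scope.

(** Uniform probability on a finite sample space; [cpr A B] is Pr[A | B],
    with value 0 when [B] is empty. *)
Definition pr (R : realType) (T : finType) (A : {set T}) : R :=
  #|A|%:R / #|T|%:R.

Definition cpr (R : realType) (T : finType) (A B : {set T}) : R :=
  pr R (A :&: B)%SET / pr R B.

(** The hypercube {-1,1}^n: [true] stands for 1 and [false] for -1. *)
Definition cube (n : nat) := {ffun 'I_n -> bool}.

Definition pm1 (R : realType) (b : bool) : R := if b then 1 else - 1.

(** With voters numbered from 0, the i-th triple consists of the voters
    3i, 3i+1, 3i+2, i.e. those [j] with [j %/ 3 = i].  For odd [m] neither sign
    is taken at 0, so the value is 1 or -1. *)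
Definition pairwise_cmp (R : realType) (m : nat) (x : cube (3 * m)) : R :=
  Num.sg (\sum_(i < m)
    Num.sg (\sum_(j < 3 * m | (j %/ 3 == i)%N) pm1 R (x j))).

(** Probability of [y] under N_rho(x). *)
Definition noise (R : realType) (n : nat) (rho : R) (x y : cube n) : R :=
  \prod_(i < n) (if y i == x i then 1 - (1 - rho) / 2 else (1 - rho) / 2).

Definition noise_op (R : realType) (n : nat) (rho : R) (g : cube n -> R)
    (x : cube n) : R :=
  \sum_(y : cube n) noise rho x y * g y.

Definition alt_a : 'I_3 := @Ordinal 3 0 isT.
Definition alt_b : 'I_3 := @Ordinal 3 1 isT.
Definition alt_c : 'I_3 := @Ordinal 3 2 isT.

(** A ranking sends each alternative to its position, 0 being the top.
    Independent uniform rankings amount to a uniform element of [profile n]. *)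
Definition ranking := {perm 'I_3}.
Definition profile (n : nat) := {ffun 'I_n -> ranking}.

Definition prefs (n : nat) (k k' : 'I_3) (w : profile n) : cube n :=
  [ffun i => (w i k < w i k')%N].

Definition xab (n : nat) (w : profile n) : cube n := prefs alt_a alt_b w.
Definition xbc (n : nat) (w : profile n) : cube n := prefs alt_b alt_c w.
Definition xca (n : nat) (w : profile n) : cube n := prefs alt_c alt_a w.

Definition ev_cycle (R : realType) (m : nat) : {set profile (3 * m)} :=
  [set w | (pairwise_cmp R (xab w) == pairwise_cmp R (xbc w)) &&
           (pairwise_cmp R (xbc w) == pairwise_cmp R (xca w))]%SET.

Definition ev_F (R : realType) (m : nat) (rho d : R) :
    {set profile (3 * m)} :=
  [set w | Num.max `|noise_op rho (@pairwise_cmp R m) (xab w)|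
             (Num.max `|noise_op rho (@pairwise_cmp R m) (xbc w)|
                      `|noise_op rho (@pairwise_cmp R m) (xca w)|)
           <= d / Num.sqrt m%:R]%SET.

Definition ev_E (R : realType) (n : nat) (d : R) : {set profile n} :=
  [set w | [&& `|\sum_(i < n) pm1 R (xab w i)| <= d,
               `|\sum_(i < n) pm1 R (xbc w i)| <= d &
               `|\sum_(i < n) pm1 R (xca w i)| <= d]]%SET.

Definition prob_F (R : realType) (rho : R) (m : nat) : R :=
  cpr R (ev_cycle R m) (ev_F m rho (Num.sqrt m%:R / ln m%:R)).

Definition prob_E (R : realType) (m : nat) : R :=
  cpr R (ev_cycle R m)
    (@ev_E R (3 * m) (Num.sqrt (3 * m)%:R / ln (3 * m)%:R)).

(** The odd multiples of three are the n = 3m with m = 2k+1. *)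
Definition alpha_star (R : realType) : R :=
  limn (fun k : nat => prob_E R k.*2.+1).

(* Main.v *)
Require Import Defs.
From HB Require Import structures.
From mathcomp Require Import all_boot all_order all_algebra all_fingroup.
From mathcomp Require Import ring lra zify.
From mathcomp Require Import all_classical all_reals all_analysis.
Import Order.TTheory GRing.Theory Num.Theory.
Import numFieldNormedType.Exports.

(** Let a block be the restriction of a pairwise comparison to one triple of
    voters, and let tau = rho^2.  A block has majority M = u + v, where u is half
    the sum and v is minus half the product of its three votes; u and v are
    uncorrelated, and T_rho M = rho (u + tau v) = rho B.  The local limit behaviour
    of a sum of independent signs makes the event F_(rho,d) coincide, up to events
    of negligible probability and arbitrarily small relative error, with a cube
    window { |sum of B_k| <= c sqrt m / log m for the three pairs k }; the event E
    is such a window for tau = 0.  Split M_k into a combination of the B_l and a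
    remainder R_k uncorrelated with all of them: on the window only the sums of
    the R_k matter, and the pair of signs attached to two pairs of alternatives
    behaves like the signs of two centred Gaussians of correlation
    r(tau) = - (27 + 175 tau^2) / (729 + 525 tau^2), so that their product has
    limiting mean 1 - 2 acos(r) / pi.  As the indicator that three signs agree is
    (1 + s1 s2 + s2 s3 + s3 s1) / 4, the limit is
    alpha(rho) = 1 - 3 acos(r(rho^2)) / (2 pi), and alpha^* is its value at tau = 0.

    No Gaussian measure is involved: Lindeberg's replacement argument, applied to
    smooth test functions, compares every sum with a linear image of simple lattice
    walks with increments b1 - b2 (b1, b2 fair bits), for which the window
    probabilities are computed from central binomial coefficients and the
    correlation of signs from the asymptotic rotation invariance of the
    two-dimensional walk.  The windows have width o(sqrt m), hence probability
    tending to 0 like nrm m; the Lindeberg error is of smaller order still. *)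

Set Implicit Arguments.
Unset Strict Implicit.
Unset Printing Implicit Defensive.

Local Open Scope classical_set_scope.
Local Open Scope ring_scope.

(** * Walks and Lindeberg replacement *)

(** Measured in window half-widths [sqrt m / log m], a statistic moves by steps of order
    [log m / sqrt m]. Replacing m of them to third order costs [(log m)^3 / sqrt m], against a
    window probability of order [(log m)^-3]; this margin also absorbs the Chebyshev bound for
    exceptional profiles. For the event F, the obstacle is that a noised block has one of two
    variances, depending on its votes. Equalising the variances one step at a time would cost
    [m (log m / sqrt m)^2], which does not vanish. Steps are therefore exchanged in groups of four,
    one unanimous block with three split ones, and only the deviation of their proportion from 1/4
    is paid at second order. Pairing k with -k then turns the mean sign of [b + S] into a window
    probability of S, asymptotically linear in b at this scale, so the level [1 / log m] for T_rho f
    becomes a window for b. The mass of a window is asymptotically proportional to the cube of its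
    half-width, so the half-width cancels in the conditional probability and the limit depends on
    rho through tau alone. Only products of two signs are averaged, hence five coordinates: three
    windows and two residuals. *)

Definition law (R : realType) (T : finType) (p : T -> R) :=
  (forall t, 0 <= p t) /\ \sum_t p t = 1.

Definition unif (R : realType) (T : finType) (t : T) : R := #|T|%:R^-1.

Lemma unif_law (R : realType) (T : finType) (t0 : T) : law (@unif R T).
Proof.
split=> [t|]; first by rewrite invr_ge0 ler0n.
rewrite sumr_const -[LHS]mulr_natr mulVf// pnatr_eq0 -lt0n.
by apply/card_gt0P; exists t0.
Qed.

Section Walk.
Context (R : realType) (V : zmodType).

(** Increments act as averaging operators on test functions: independence is composition of
    operators, and no product space appears before [walk_ffun]. *)
Definition conv (T : finType) (p : T -> R) (X : T -> V) (phi : V -> R) (z : V) : R :=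
  \sum_t p t * phi (z + X t).

Fixpoint walk (T : finType) (m : nat) (p : nat -> T -> R) (X : nat -> T -> V)
    (phi : V -> R) (z : V) : R :=
  if m is n.+1 then conv (p n) (X n) (walk n p X phi) z else phi z.

Lemma convC (T T' : finType) (p : T -> R) X (q : T' -> R) Y phi z :
  conv p X (conv q Y phi) z = conv q Y (conv p X phi) z.
Proof.
rewrite /conv.
under eq_bigr => t _ do rewrite mulr_sumr.
rewrite exchange_big /=; apply: eq_bigr => s _; rewrite mulr_sumr.
by apply: eq_bigr => t _; rewrite mulrCA addrAC.
Qed.

Lemma eq_conv (T : finType) (p : T -> R) X phi psi z :
  phi =1 psi -> conv p X phi z = conv p X psi z.
Proof. by move=> e; apply: eq_bigr => t _; rewrite e. Qed.

Lemma convB (T : finType) (p : T -> R) X phi psi z :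
  conv p X (fun x => phi x - psi x) z = conv p X phi z - conv p X psi z.
Proof. by rewrite /conv -sumrB; apply: eq_bigr => t _; rewrite mulrBr. Qed.

Lemma conv_norm (T : finType) (p : T -> R) X phi e z : law p ->
  (forall x, `|phi x| <= e) -> `|conv p X phi z| <= e.
Proof.
move=> [p0 p1] he; apply: (le_trans (ler_norm_sum _ _ _)).
rewrite -[leRHS]mul1r -p1 mulr_suml; apply: ler_sum => t _.
by rewrite normrM (ger0_norm (p0 t)) ler_wpM2l.
Qed.

Lemma walk_conv (T T' : finType) m p X (q : T' -> R) Y phi z :
  @walk T m p X (conv q Y phi) z = conv q Y (@walk T m p X phi) z.
Proof.
elim: m z => [//|m IH] z /=.
by rewrite (eq_conv _ _ _ (IH)) convC.
Qed.

Lemma eq_walk (T : finType) m p X phi psi z : phi =1 psi ->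
  @walk T m p X phi z = @walk T m p X psi z.
Proof. by move=> e; elim: m z => [//|m IH] z; apply: eq_conv. Qed.

Lemma walkB (T : finType) m p X phi psi z :
  @walk T m p X (fun x => phi x - psi x) z
  = @walk T m p X phi z - @walk T m p X psi z.
Proof. by elim: m z => [//|m IH] z /=; rewrite -convB; apply: eq_conv. Qed.

Lemma walk_norm (T : finType) m p X phi e z : (forall n, (n < m)%N -> law (p n)) ->
  (forall x, `|phi x| <= e) -> `|@walk T m p X phi z| <= e.
Proof.
move=> hp he; elim: m hp z => [//|m IH] hp z /=.
apply: conv_norm; first exact: hp.
by apply: IH => n nm; apply: hp; apply: ltnW.
Qed.

(* The increments commute under [conv], so each one is replaced in front of the
   others and only its effect on [phi] itself has to be estimated. *)
Lemma lindeberg (T T' : finType) m (p : nat -> T -> R) X (q : nat -> T' -> R) Y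
    phi (e : nat -> R) z :
  (forall n, (n < m)%N -> law (p n)) -> (forall n, (n < m)%N -> law (q n)) ->
  (forall n x, (n < m)%N ->
     `|conv (p n) (X n) phi x - conv (q n) (Y n) phi x| <= e n) ->
  `|walk m p X phi z - walk m q Y phi z| <= \sum_(n < m) e n.
Proof.
elim: m z => [|m IH] z hp hq he; first by rewrite /= subrr normr0 big_ord0.
rewrite big_ord_recr /=.
(* The hybrid inserted here takes its last increment from [X] and the others from [Y]; by
   commutation it can be read in either order. *)
have -> : conv (p m) (X m) (walk m p X phi) z - conv (q m) (Y m) (walk m q Y phi) z
  = conv (p m) (X m) (fun x => walk m p X phi x - walk m q Y phi x) z
    + walk m q Y (fun x => conv (p m) (X m) phi x - conv (q m) (Y m) phi x) z.
  by rewrite convB walkB !walk_conv addrA subrK.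
apply: (le_trans (ler_normD _ _)); apply: lerD.
  apply: conv_norm; first exact: hp.
  move=> x; apply: IH => [n nm|n nm|n y nm]; [apply: hp|apply: hq|apply: he]; exact: ltnW.
by apply: walk_norm => [n nm|x]; [apply: hq; exact: ltnW|apply: he].
Qed.

Lemma conv_mono (T : finType) (p : T -> R) X phi psi z : law p ->
  (forall x, phi x <= psi x) -> conv p X phi z <= conv p X psi z.
Proof. by move=> [p0 _] h; apply: ler_sum => t _; rewrite ler_wpM2l. Qed.

Definition ffun_ext (T : finType) m (w : {ffun 'I_m -> T}) (t : T) : {ffun 'I_m.+1 -> T} :=
  [ffun i => oapp w t (unlift ord_max i)].

Lemma big_ffun_ext (T : finType) m (F : {ffun 'I_m.+1 -> T} -> R) :
  \sum_w F w = \sum_t \sum_(w : {ffun 'I_m -> T}) F (ffun_ext w t).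
Proof.
rewrite pair_big /=.
rewrite (reindex (fun p : T * {ffun 'I_m -> T} => ffun_ext p.2 p.1)) //=.
exists (fun w => (w ord_max, [ffun i => w (lift ord_max i)])) => [[t w] _|w _] /=.
  congr pair; first by rewrite ffunE unlift_none.
  by apply/ffunP => i; rewrite !ffunE liftK.
apply/ffunP => i; rewrite !ffunE; case: unliftP => [j ->|->] //=.
by rewrite ffunE.
Qed.

Lemma walk_ffun (T : finType) m p X phi z :
  @walk T m p X phi z = \sum_(w : {ffun 'I_m -> T})
    (\prod_(i < m) p i (w i)) * phi (z + \sum_(i < m) X i (w i)).
Proof.
elim: m z => [|m IH] z /=.
  have e (F : {ffun 'I_0 -> T} -> R) w0 : \sum_w F w = F w0.
    rewrite (bigD1 w0) //= big1 ?addr0 // => w /negP[]; apply/eqP/ffunP => -[] //.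
  have w0 : {ffun 'I_0 -> T} by apply: finfun => -[].
  by rewrite (e _ w0) !big_ord0 mul1r addr0.
rewrite big_ffun_ext /conv; apply: eq_bigr => t _.
rewrite IH mulr_sumr; apply: eq_bigr => w _.
have E i : ffun_ext w t (widen_ord (leqnSn m) i) = w i.
  rewrite ffunE; have -> : widen_ord (leqnSn m) i = lift ord_max i.
    by apply: val_inj => /=; rewrite /bump leqNgt ltn_ord.
  by rewrite liftK.
have E' : ffun_ext w t ord_max = t by rewrite ffunE unlift_none.
rewrite !big_ord_recr /= E'.
under [in RHS]eq_bigr => i _ do rewrite E.
under [X in _ + (X + _)]eq_bigr => i _ do rewrite E.
by rewrite mulrA [p m t * _]mulrC -addrA [X m t + _]addrC.
Qed.

End Walk.

(** * Smooth test functions and moment matching *)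

Section Smooth.
Context (R : realType) (V : zmodType) (d : nat) (l : 'I_d -> V -> R).

Definition lin (a : 'I_d -> R) (h : V) : R := \sum_i a i * l i h.
Definition quad (Q : 'I_d -> 'I_d -> R) (h : V) : R :=
  \sum_i \sum_j Q i j * (l i h * l j h).

(* A second-order Taylor bound along the coordinates [l], uniform in the scale [N]
   of the increment; it is stable under products and needs no derivatives. *)
Definition smooth_at (phi : V -> R) (K : R) :=
  forall z, `|phi z| <= K /\ exists a Q, forall h N, 0 <= N <= 1 ->
    (forall i, `|l i h| <= N) ->
    [/\ `|lin a h| <= K * N, `|quad Q h| <= K * N ^+ 2 &
        `|phi (z + h) - phi z - lin a h - quad Q h| <= K * N ^+ 3].

Definition smooth phi := exists2 K, 0 <= K & smooth_at phi K.

Lemma linD a a' h : lin (fun i => a i + a' i) h = lin a h + lin a' h.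
Proof. by rewrite /lin -big_split; apply: eq_bigr => i _ /=; rewrite mulrDl. Qed.

Lemma linZ c a h : lin (fun i => c * a i) h = c * lin a h.
Proof. by rewrite /lin mulr_sumr; apply: eq_bigr => i _; rewrite mulrA. Qed.

Lemma quadD a a' h : quad (fun i j => a i j + a' i j) h = quad a h + quad a' h.
Proof.
rewrite /quad -big_split; apply: eq_bigr => i _ /=; rewrite -big_split.
by apply: eq_bigr => j _ /=; rewrite mulrDl.
Qed.

Lemma quadZ c a h : quad (fun i j => c * a i j) h = c * quad a h.
Proof.
rewrite /quad mulr_sumr; apply: eq_bigr => i _; rewrite mulr_sumr.
by apply: eq_bigr => j _; rewrite -mulrA.
Qed.

Lemma lin_mul a a' h : lin a h * lin a' h = quad (fun i j => a i * a' j) h.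
Proof.
rewrite /lin /quad mulr_suml; apply: eq_bigr => i _; rewrite mulr_sumr.
by apply: eq_bigr => j _; rewrite mulrACA.
Qed.

Lemma smooth_mul phi psi : smooth phi -> smooth psi ->
  smooth (fun z => phi z * psi z).
Proof.
move=> [K K0 hp] [L L0 hq]; exists (7 * K * L); first by rewrite !mulr_ge0.
move=> z; have [p0 [a [A hA]]] := hp z; have [q0 [b [B hB]]] := hq z.
have KL0 : 0 <= K * L by rewrite mulr_ge0.
split.
  rewrite normrM; apply: (@le_trans _ _ (K * L)); first exact: ler_pM.
  by rewrite -mulrA ler_peMl//; lra.
exists (fun i => phi z * b i + psi z * a i).
exists (fun i j => phi z * B i j + psi z * A i j + a i * b j).
move=> h N /[dup] N01 /andP[N0 N1] hN.
have [la qa ra] := hA h N N01 hN; have [lb qb rb] := hB h N N01 hN.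
rewrite linD !linZ !quadD !quadZ -lin_mul.
have q1 : `|psi (z + h)| <= L by case: (hq (z + h)).
move: (lin a h) (lin b h) (quad A h) (quad B h) la qa ra lb qb rb.
move=> x y X Y la qa ra lb qb rb.
have N2 : N ^+ 2 <= N by rewrite expr2 ler_piMl.
have N30 : 0 <= N ^+ 3 by rewrite exprn_ge0.
have N20 : 0 <= N ^+ 2 by rewrite exprn_ge0.
have N32 : N ^+ 3 <= N ^+ 2 by rewrite exprS ler_piMl.
have N43 : N ^+ 4 <= N ^+ 3 by rewrite exprS ler_piMl.
have M (u v s t : R) : `|u| <= s -> `|v| <= t -> `|u * v| <= s * t.
  by move=> us vt; rewrite normrM ler_pM.
have KN : K * N <= K by rewrite ler_piMr.
have KN2 : K * N ^+ 2 <= K by rewrite ler_piMr // (le_trans N2).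
split.
- have h1 := M _ _ _ _ p0 lb; have h2 := M _ _ _ _ q0 la.
  apply: (le_trans (ler_normD _ _)); have : 0 <= K * L * N by rewrite mulr_ge0.
  nra.
- have h1 := M _ _ _ _ p0 qb; have h2 := M _ _ _ _ q0 qa.
  have h3 := M _ _ _ _ la lb.
  apply: (le_trans (ler_normD _ _)).
  apply: (le_trans (lerD (ler_normD _ _) (lexx _))).
  have : 0 <= K * L * N ^+ 2 by rewrite mulr_ge0.
  nra.
set r := phi (z + h) - phi z - x - X in ra.
set s := psi (z + h) - psi z - y - Y in rb.
(* Origin of the factor 7: the first four error terms are each at most [K * L * N ^+ 3] (the third
   is of order four, and [N <= 1]), and the last one at most three times that. *)
have -> : phi (z + h) * psi (z + h) - phi z * psi z - (phi z * y + psi z * x)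
   - (phi z * Y + psi z * X + x * y)
   = x * Y + X * y + X * Y + r * psi (z + h) + (phi z + x + X) * s.
  by rewrite /r /s; ring.
have h0 : `|phi z + x + X| <= 3 * K.
  apply: (le_trans (ler_normD _ _)).
  apply: (le_trans (lerD (ler_normD _ _) (lexx _))); nra.
have h1 := M _ _ _ _ la qb; have h2 := M _ _ _ _ qa lb; have h3 := M _ _ _ _ qa qb.
have h4 := M _ _ _ _ ra q1; have h5 := M _ _ _ _ h0 rb.
apply: (le_trans (ler_normD _ _)); rewrite -lerBrDr.
apply: (le_trans (ler_normD _ _)); rewrite -lerBrDr.
apply: (le_trans (ler_normD _ _)); rewrite -lerBrDr.
apply: (le_trans (ler_normD _ _)).
have e4 : K * N ^+ 2 * (L * N ^+ 2) = K * L * N ^+ 4 by ring.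
have e3 : K * N * (L * N ^+ 2) = K * L * N ^+ 3 by ring.
have e3' : K * N ^+ 2 * (L * N) = K * L * N ^+ 3 by ring.
have e5 : K * N ^+ 3 * L = K * L * N ^+ 3 by ring.
have e6 : 3 * K * (L * N ^+ 3) = 3 * (K * L * N ^+ 3) by ring.
have k4 : K * L * N ^+ 4 <= K * L * N ^+ 3 by rewrite ler_wpM2l.
rewrite {}e4 in h3; rewrite {}e3 in h1; rewrite {}e3' in h2; rewrite {}e5 in h4.
rewrite {}e6 in h5.
have -> : 7 * K * L * N ^+ 3 = 7 * (K * L * N ^+ 3) by ring.
lra.
Qed.

Lemma smoothZ c phi : smooth phi -> smooth (fun z => c * phi z).
Proof.
move=> [K K0 hp]; exists (`|c| * K); first by rewrite mulr_ge0.
move=> z; have [p0 [a [A hA]]] := hp z; split.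
  by rewrite normrM ler_wpM2l.
exists (fun i => c * a i), (fun i j => c * A i j) => h N N01 hN.
have [la qa ra] := hA h N N01 hN.
rewrite linZ quadZ -!mulrBr !normrM -!mulrA.
by split; rewrite ler_wpM2l.
Qed.

Lemma smoothD phi psi : smooth phi -> smooth psi ->
  smooth (fun z => phi z + psi z).
Proof.
move=> [K K0 hp] [L L0 hq]; exists (K + L); first by rewrite addr_ge0.
move=> z; have [p0 [a [A hA]]] := hp z; have [q0 [b [B hB]]] := hq z.
split; first by apply: (le_trans (ler_normD _ _)); apply: lerD.
exists (fun i => a i + b i), (fun i j => A i j + B i j) => h N N01 hN.
have [la qa ra] := hA h N N01 hN; have [lb qb rb] := hB h N N01 hN.
rewrite linD quadD !mulrDl; split.
- by apply: (le_trans (ler_normD _ _)); apply: lerD.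
- by apply: (le_trans (ler_normD _ _)); apply: lerD.
set r := phi (z + h) - phi z - lin a h - quad A h in ra.
set s := psi (z + h) - psi z - lin b h - quad B h in rb.
have -> : phi (z + h) + psi (z + h) - (phi z + psi z) - (lin a h + lin b h)
  - (quad A h + quad B h) = r + s by rewrite /r /s; ring.
by apply: (le_trans (ler_normD _ _)); apply: lerD.
Qed.

Lemma smooth_cst c : smooth (fun=> c).
Proof.
exists `|c| => // z; split => //; exists (fun=> 0), (fun _ _ => 0) => h N /andP[N0 _] _.
have l0 : lin (fun=> 0) h = 0 by rewrite /lin big1 // => i _; rewrite mul0r.
have q0 : quad (fun _ _ => 0) h = 0.
  by rewrite /quad big1 // => i _; rewrite big1 // => j _; rewrite mul0r.
by rewrite l0 q0 subrr !subr0 normr0; split; rewrite mulr_ge0 // exprn_ge0.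
Qed.

Lemma smooth_coord (psi : R -> R) K (i : 'I_d) :
  (forall x y, l i (x + y) = l i x + l i y) -> 0 <= K ->
  (forall x, `|psi x| <= K /\ exists a b, [/\ `|a| <= K, `|b| <= K &
     forall h, `|psi (x + h) - psi x - a * h - b * h ^+ 2| <= K * `|h| ^+ 3]) ->
  smooth (fun z => psi (l i z)).
Proof.
move=> li K0 hpsi; exists K => // z; have [p0 [a [b [aK bK ab]]]] := hpsi (l i z).
split => //.
exists (fun j => if j == i then a else 0).
exists (fun j k => if (j == i) && (k == i) then b else 0) => h N /andP[N0 N1] hN.
have -> : lin (fun j => if j == i then a else 0) h = a * l i h.
  rewrite /lin (bigD1 i) //= eqxx big1 ?addr0 // => j /negPf ->.
  by rewrite mul0r.
have -> : quad (fun j k => if (j == i) && (k == i) then b else 0) h = b * l i h ^+ 2.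
  rewrite /quad (bigD1 i) //= (bigD1 i) //= eqxx big1 ?addr0 ?big1 ?addr0 ?expr2 //.
    by move=> j /negPf -> /=; rewrite big1 // => k _; rewrite mul0r.
  by move=> j /negPf ->; rewrite mul0r.
have hi := hN i.
have h2 : `|l i h| ^+ 2 <= N ^+ 2 by rewrite lerXn2r ?nnegrE.
have h3 : `|l i h| ^+ 3 <= N ^+ 3 by rewrite lerXn2r ?nnegrE.
split; rewrite ?normrM ?normrX.
- exact: ler_pM.
- by apply: ler_pM => //; rewrite exprn_ge0.
- by rewrite li; apply: (le_trans (ab _)); rewrite ler_wpM2l.
Qed.

(** The constant, linear and quadratic parts of the expansion at [z] have the same mean under both
    laws, so only the two cubic remainders survive. *)
Lemma smooth_match phi K (T T' : finType) (p : T -> R) X (q : T' -> R) Y N z :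
  smooth_at phi K -> law p -> law q -> 0 <= N <= 1 ->
  (forall t i, `|l i (X t)| <= N) -> (forall t i, `|l i (Y t)| <= N) ->
  (forall i, \sum_t p t * l i (X t) = \sum_t q t * l i (Y t)) ->
  (forall i j, \sum_t p t * (l i (X t) * l j (X t)) =
               \sum_t q t * (l i (Y t) * l j (Y t))) ->
  `|conv p X phi z - conv q Y phi z| <= 2 * K * N ^+ 3.
Proof.
move=> hphi hp hq N01 hX hY m1 m2; have [_ [a [Q h]]] := hphi z.
have E (U : finType) (r : U -> R) (Z : U -> V) : law r -> (forall t i, `|l i (Z t)| <= N) ->
  `|conv r Z phi z - (phi z + \sum_i a i * (\sum_t r t * l i (Z t))
    + \sum_i \sum_j Q i j * (\sum_t r t * (l i (Z t) * l j (Z t))))| <= K * N ^+ 3.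
  move=> hr hZ.
  have -> : \sum_i a i * (\sum_t r t * l i (Z t)) = \sum_t r t * lin a (Z t).
    under eq_bigr => i _ do rewrite mulr_sumr.
    rewrite exchange_big; apply: eq_bigr => t _ /=; rewrite /lin mulr_sumr.
    by apply: eq_bigr => i _; rewrite mulrCA.
  have -> : \sum_i \sum_j Q i j * (\sum_t r t * (l i (Z t) * l j (Z t)))
      = \sum_t r t * quad Q (Z t).
    under eq_bigr => i _ do under eq_bigr => j _ do rewrite mulr_sumr.
    under eq_bigr => i _ do rewrite exchange_big.
    rewrite exchange_big; apply: eq_bigr => t _ /=; rewrite /quad mulr_sumr.
    apply: eq_bigr => i _; rewrite mulr_sumr.
    by apply: eq_bigr => j _; rewrite mulrCA.
  have -> : conv r Z phi z - (phi z + \sum_t r t * lin a (Z t)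
      + \sum_t r t * quad Q (Z t))
      = conv r Z (fun x => phi x - phi z - lin a (x - z) - quad Q (x - z)) z.
    rewrite /conv -[phi z]mul1r -{1}hr.2 mulr_suml -!big_split -sumrB.
    apply: eq_bigr => t _ /=; rewrite [z + _]addrC addrK; ring.
  have [r0 r1] := hr.
  rewrite -[leRHS]mul1r -r1 mulr_suml; apply: (le_trans (ler_norm_sum _ _ _)).
  apply: ler_sum => t _; rewrite normrM ger0_norm //; rewrite ler_wpM2l //.
  have [_ _] := h (Z t) N N01 (hZ t).
  by have -> : z + Z t - z = Z t by rewrite addrC addKr.
have e1 := E _ _ _ hp hX; have e2 := E _ _ _ hq hY.
rewrite -(eq_bigr _ (fun i _ => congr1 (fun x => a i * x) (m1 i))) in e2.
have m2' i : \sum_j Q i j * (\sum_t q t * (l i (Y t) * l j (Y t)))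
   = \sum_j Q i j * (\sum_t p t * (l i (X t) * l j (X t))).
  by apply: eq_bigr => j _; rewrite m2.
rewrite (eq_bigr _ (fun i _ => m2' i)) in e2.
set c := (phi z + _ + _) in e1 e2.
have -> : conv p X phi z - conv q Y phi z
  = (conv p X phi z - c) - (conv q Y phi z - c) by ring.
apply: (le_trans (ler_normB _ _)).
have -> : 2 * K * N ^+ 3 = K * N ^+ 3 + K * N ^+ 3 by ring.
exact: lerD.
Qed.

End Smooth.

(** * A smooth step function *)

Section Step.
Context (R : realType).

Definition cub (x : R) : R := Num.max x 0 ^+ 3.

Lemma cub_taylor (x h : R) :
  `|cub (x + h) - cub x - 3 * Num.max x 0 ^+ 2 * h - 3 * Num.max x 0 * h ^+ 2|
  <= `|h| ^+ 3.
Proof.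
rewrite -normrX /cub.
case: (leP x 0) => hx; case: (leP (x + h) 0) => hh.
- by rewrite !expr0n /= mulr0 !mul0r !subr0 normr0.
- rewrite expr0n /= !expr0n /= mulr0 !mul0r !subr0.
  have h0 : 0 <= h by lra.
  by rewrite !ger0_norm ?exprn_ge0 ?lerXn2r ?nnegrE //; lra.
(* When zero is crossed downwards the remainder is a sum of two terms of opposite signs, the second
   no larger than the first in absolute value. *)
- have h0 : h <= 0 by lra.
  have -> : 0 ^+ 3 - x ^+ 3 - 3 * x ^+ 2 * h - 3 * x * h ^+ 2 = h ^+ 3 + (- (x + h)) ^+ 3 by ring.
  have e : `|h ^+ 3| = (- h) ^+ 3 by rewrite exprNn -signr_odd /= expr1 mulN1r ler0_norm// -oppr_ge0 -mulN1r -[-1]expr1 -[1%N]/(odd 3 : nat) signr_odd -exprNn exprn_ge0//; lra.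
  have k1 : (- (x + h)) ^+ 3 <= (- h) ^+ 3 by rewrite lerXn2r ?nnegrE //; lra.
  have k2 : 0 <= (- (x + h)) ^+ 3 by rewrite exprn_ge0; lra.
  have e3 : (- h) ^+ 3 = - h ^+ 3 by ring.
  rewrite e ler_norml; lra.
- have -> : (x + h) ^+ 3 - x ^+ 3 - 3 * x ^+ 2 * h - 3 * x * h ^+ 2 = h ^+ 3 by ring.
  by [].
Qed.

(* The integrated quadratic B-spline, chosen for being C^2 with Lipschitz second
   derivative, which is what [smooth] asks for. *)
Definition step (x : R) : R :=
  (cub (3 * x) - 3 * cub (3 * x - 1) + 3 * cub (3 * x - 2) - cub (3 * x - 3)) / 6.

Lemma cub0 (x : R) : x <= 0 -> cub x = 0.
Proof. by move=> h; rewrite /cub; case: leP => //; rewrite ?expr0n //; lra. Qed.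

Lemma cubE (x : R) : 0 <= x -> cub x = x ^+ 3.
Proof. by move=> h; rewrite /cub max_l. Qed.

Lemma step0 (x : R) : x <= 0 -> step x = 0.
Proof. by move=> h; rewrite /step !cub0 //; lra. Qed.

Lemma step1 (x : R) : 1 <= x -> step x = 1.
Proof. by move=> h; rewrite /step !cubE; [field|lra..]. Qed.

Lemma step01 (x : R) : 0 <= step x <= 1.
Proof.
case: (leP x 0) => h0; first by rewrite step0 // lexx ler01.
case: (leP 1 x) => h1; first by rewrite step1 // lexx ler01.
rewrite /step (cub0 (x := 3 * x - 3)); last lra.
rewrite (cubE (x := 3 * x)); last lra.
have [y ey] : exists y, y = 3 * x by exists (3 * x).
rewrite -ey.
have y0 : 0 < y by lra.
have y3 : y < 3 by lra.
clear ey h0 h1 x.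
case: (leP y 1) => h2.
  rewrite !cub0; [|lra..].
  have : 0 <= y ^+ 3 <= 1 by rewrite exprn_ge0 ?exprn_ile1 //; lra.
  lra.
rewrite (cubE (x := y - 1)); last lra.
case: (leP y 2) => h3.
  rewrite !cub0; last lra.
  (* On this piece [6 * step] has Bernstein coefficients 1, 2, 4, 5 in [y - 1] and [2 - y], all
     between 0 and 6; the products below are what this argument needs. *)
  have : 0 <= (y - 1) * (2 - y) by rewrite mulr_ge0; lra.
  have : 0 <= (y - 1) ^+ 2 * (2 - y) by rewrite mulr_ge0 ?sqr_ge0; lra.
  have : 0 <= (y - 1) ^+ 3 by rewrite exprn_ge0; lra.
  have : 0 <= (2 - y) ^+ 2 * (y - 1) by rewrite mulr_ge0 ?sqr_ge0; lra.
  have : 0 <= (2 - y) ^+ 3 by rewrite exprn_ge0; lra.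
  move=> *; apply/andP; split; nra.
rewrite (cubE (x := y - 2)); last lra.
have -> : (y ^+ 3 - 3 * (y - 1) ^+ 3 + 3 * (y - 2) ^+ 3 - 0) / 6
   = 1 - (3 - y) ^+ 3 / 6 by field.
have : 0 <= 3 - y <= 1 by apply/andP; split; lra.
move: (3 - y) => s /andP[s0 s1]; apply/andP; split.
  have : s ^+ 3 <= 1 by rewrite exprn_ile1.
  lra.
have : 0 <= s ^+ 3 by rewrite exprn_ge0.
lra.
Qed.

Lemma step_taylor : exists2 K, 0 <= K & forall x, `|step x| <= K /\
  exists a b, [/\ `|a| <= K, `|b| <= K &
    forall h, `|step (x + h) - step x - a * h - b * h ^+ 2| <= K * `|h| ^+ 3].
Proof.
have b1 x : `|step x| <= 1 by have /andP[? ?] := step01 x; rewrite ger0_norm.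
exists 40 => // x; split; first by apply: (le_trans (b1 x)); lra.
pose a0 (y : R) := 3 * Num.max y 0 ^+ 2 * 3.
pose b0 (y : R) := 3 * Num.max y 0 * 9.
pose a := (a0 (3 * x) - 3 * a0 (3 * x - 1) + 3 * a0 (3 * x - 2) - a0 (3 * x - 3)) / 6.
pose b := (b0 (3 * x) - 3 * b0 (3 * x - 1) + 3 * b0 (3 * x - 2) - b0 (3 * x - 3)) / 6.
(* Each of the four cubes contributes a remainder of at most [27 * |h|^3], with weights 1, 3, 3, 1
   divided by 6, hence 36. *)
have main h : `|step (x + h) - step x - a * h - b * h ^+ 2| <= 36 * `|h| ^+ 3.
  pose r y := cub (y + 3 * h) - cub y - a0 y * h - b0 y * h ^+ 2.
  have hr y : `|r y| <= 27 * `|h| ^+ 3.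
    have -> : 27 * `|h| ^+ 3 = `|3 * h| ^+ 3 by rewrite normrM ger0_norm //; ring.
    have := cub_taylor y (3 * h).
    by apply: le_trans; rewrite le_eqVlt; apply/orP; left; apply/eqP; congr `|_|;
       rewrite /r /a0 /b0; ring.
  have -> : step (x + h) - step x - a * h - b * h ^+ 2 =
    (r (3 * x) - 3 * r (3 * x - 1) + 3 * r (3 * x - 2) - r (3 * x - 3)) / 6.
    rewrite /r /a /b /step.
    have e c : 3 * (x + h) - c = 3 * x - c + 3 * h by ring.
    rewrite !e (_ : 3 * (x + h) = 3 * x + 3 * h); last by ring.
    by field.
  move: (hr (3 * x)) (hr (3 * x - 1)) (hr (3 * x - 2)) (hr (3 * x - 3)).
  move: (r _) (r _) (r _) (r _) (`|h| ^+ 3) => r1 r2 r3 r4 H.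
  rewrite !ler_norml; lra.
have [aK bK] : `|a| <= 40 /\ `|b| <= 40.
  (* boundedness of the coefficients comes from the expansion at h = 1, -1 *)
  have m1 := main 1; have m2 := main (-1).
  rewrite normr1 expr1n mulr1 in m1.
  rewrite normrN1 expr1n mulr1 sqrrN expr1n in m2.
  move: m1 m2; rewrite expr1n !mulr1.
  move: (b1 (x + 1)) (b1 (x - 1)) (b1 x).
  move: (step (x + 1)) (step (x - 1)) (step x) => s1 s2 s3.
  by rewrite !ler_norml => ? ? ? ? ?; split; lra.
exists a, b; split => // h; apply: (le_trans (main h)).
by rewrite ler_wpM2r ?exprn_ge0 //; lra.
Qed.

End Step.

Lemma smooth_step (R : realType) (V : zmodType) (d : nat) (l : 'I_d -> V -> R) i al be :
  (forall x y, l i (x + y) = l i x + l i y) ->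
  smooth l (fun z => step (al * l i z + be)).
Proof.
move=> li; have [K K0 hK] := step_taylor R.
pose A := 1 + `|al|.
have A1 : 1 <= A by rewrite lerDl.
have aA : `|al| <= A by rewrite lerDr.
apply: (@smooth_coord _ _ _ _ (fun x => step (al * x + be)) (K * A ^+ 3)) => //.
  by rewrite mulr_ge0// exprn_ge0//; lra.
move=> x; have [p0 [a [b [aK bK ab]]]] := hK (al * x + be).
have A0 : 0 <= A by lra.
have A3 : 1 <= A ^+ 3 by rewrite exprn_ege1.
have A31 : A <= A ^+ 3 by rewrite -[leLHS]expr1 ler_weXn2l.
have A32 : A ^+ 2 <= A ^+ 3 by rewrite ler_weXn2l.
split; first by rewrite (le_trans p0)// ler_peMr.
exists (a * al), (b * al ^+ 2); split.
- by rewrite normrM ler_pM// (le_trans aA).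
- rewrite normrM normrX ler_pM// ?exprn_ge0 //; apply: le_trans A32.
  by rewrite lerXn2r ?nnegrE.
move=> h; have := ab (al * h).
rewrite (_ : al * x + be + al * h = al * (x + h) + be); last by ring.
rewrite (_ : a * (al * h) = a * al * h); last by ring.
rewrite (_ : b * (al * h) ^+ 2 = b * al ^+ 2 * h ^+ 2); last by ring.
move/le_trans; apply; rewrite normrM exprMn mulrA ler_wpM2r ?exprn_ge0//.
by rewrite ler_wpM2l// lerXn2r ?nnegrE.
Qed.

(** * The lattice walk *)

Section Lattice.
Context (R : realType).

Definition uwalk (V : zmodType) (T : finType) m (X : T -> V) (phi : V -> R) z : R :=
  walk m (fun=> @unif R T) (fun=> X) phi z.

Definition uconv (V : zmodType) (T : finType) (X : T -> V) (phi : V -> R) z : R :=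
  conv (@unif R T) X phi z.

Lemma uconv_pair (V : zmodType) (T1 T2 : finType) (X1 : T1 -> V) (X2 : T2 -> V) phi z :
  uconv (fun t : T1 * T2 => X1 t.1 + X2 t.2) phi z = uconv X1 (uconv X2 phi) z.
Proof.
rewrite /uconv /conv.
under [RHS]eq_bigr => t _ do rewrite mulr_sumr.
rewrite pair_big /=; apply: eq_bigr => -[t s] _ /=.
by rewrite /unif card_prod natrM invfM mulrA addrA.
Qed.

(** The averaging operators of the two components commute, so the joint steps can be sorted by
    component. *)
Lemma uwalk_pair (V : zmodType) (T1 T2 : finType) m (X1 : T1 -> V) (X2 : T2 -> V) phi z :
  uwalk m (fun t : T1 * T2 => X1 t.1 + X2 t.2) phi z = uwalk m X1 (uwalk m X2 phi) z.
Proof.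
elim: m z => [//|m IH] z; rewrite /uwalk /= -!/(uconv _ _ _).
rewrite -/(uwalk _ _ _).
rewrite /uconv (eq_conv _ _ _ IH) -!/(uconv _ _ _) uconv_pair.
apply: eq_conv => x; rewrite /uconv -walk_conv; exact: eq_walk.
Qed.

(* [xi] has variance 1/2, and its [m]-fold convolution is the binomial law of
   parameter [2m] recentred at [m]. *)
Definition xi (t : bool * bool) : R := t.1%:R - t.2%:R.

Definition pmf (m j : nat) : R := 'C(2 * m, j)%:R / 4 ^+ m.

Definition lat (m : nat) (g : R -> R) : R :=
  \sum_(j < (2 * m).+1) pmf m j * g (j%:R - m%:R).

Lemma eq_lat m g g' : g =1 g' -> lat m g = lat m g'.
Proof. by move=> e; apply: eq_bigr => j _; rewrite e. Qed.

(** A step [b1 - b2] has the law of two fair steps of 0 or [e] followed by a shift by [- e]. Hence m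
    steps are the power [2 * m] of the averaging operator [D], expanded by the binomial theorem. *)
Lemma walk_lat (V : lmodType R) m (e : V) phi z :
  uwalk m (fun t => xi t *: e) phi z = lat m (fun k => phi (z + k *: e)).
Proof.
pose D (f : V -> R) z := (f z + f (z + e)) / 2.
have eqD f g : f =1 g -> D f =1 D g by move=> h x; rewrite /D !h.
have iterD n f x : iter n D f x = \sum_(j < n.+1) 'C(n, j)%:R / 2 ^+ n * f (x + j%:R *: e).
  elim: n x => [|n IH] x.
    by rewrite big_ord_recl big_ord0 /= bin0 expr0 divr1 mul1r scale0r !addr0.
  have s i : x + e + i%:R *: e = x + (1 + i)%:R *: e.
    by rewrite -addrA natrD scalerDl scale1r.
  rewrite iterS /D !IH big_ord_recl [in LHS]big_ord_recr /=.
  rewrite [in RHS]big_ord_recl [in RHS]big_ord_recr /=.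
  rewrite !bin0 scale0r addr0 /bump /= binn s.
  have -> : 'C(n.+1, 1 + n) = 1%N by rewrite add1n binn.
  have h : (2:R) ^+ n != 0 by rewrite expf_neq0.
  have -> : \sum_(i < n) 'C(n.+1, 1 + i)%:R / 2 ^+ n.+1 * f (x + (1 + i)%:R *: e)
   = (\sum_(i < n) 'C(n, 1 + i)%:R / 2 ^+ n * f (x + (1 + i)%:R *: e)
      + \sum_(i < n) 'C(n, i)%:R / 2 ^+ n * f (x + e + i%:R *: e)) / 2.
    rewrite -big_split mulr_suml /=; apply: eq_bigr => i _.
    rewrite s add1n binS natrD exprS.
    by field.
  by rewrite exprS; field.
have convD f x : uconv (fun t => xi t *: e) f x = D (D f) (x - e).
  rewrite /uconv /conv.
  rewrite (eq_bigr (fun t : bool * bool => (fun a b =>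
     unif R (a, b) * f (x + xi (a, b) *: e)) t.1 t.2)); last by case.
  rewrite -(pair_big xpredT xpredT (fun a b =>
     unif R (a, b) * f (x + xi (a, b) *: e))) /=.
  rewrite !big_bool /= /D /unif card_prod card_bool /xi /=.
  rewrite subrr subr0 sub0r scale1r scaleN1r scale0r addr0 subrK.
by rewrite subrr scale0r addr0; field.
have itw f x : uwalk m (fun t => xi t *: e) f x = iter (2 * m) D f (x - m%:R *: e).
  elim: m x => [|n IH] x; first by rewrite muln0 scale0r subr0.
  rewrite (_ : (2 * n.+1 = (2 * n).+2)%N); last by lia.
  rewrite !iterS -[LHS]/(uconv _ (fun y => uwalk n (fun t => xi t *: e) f y) x) convD.
  transitivity (D (D (fun y => iter (2 * n) D f (y - n%:R *: e))) (x - e)).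
    by do 2 apply: (eqD).
  set y := x - n.+1%:R *: e.
  have -> : x = y + n%:R *: e + e.
    by rewrite /y -addrA -{3}[e]scale1r -scalerDl natr1 subrK.
  by rewrite /D addrK -!addrA ![n%:R *: e + _]addrC -!addrA !addNr !addr0.
rewrite itw iterD /lat; apply: eq_bigr => j _; rewrite /pmf exprM.
by congr (_ / _ ^+ _ * phi _); [ring|rewrite scalerBl addrAC -addrA].
Qed.

Lemma lat_sum_pmf m : \sum_(j < (2 * m).+1) pmf m j = 1.
Proof.
rewrite /pmf -mulr_suml; have := exprDn (1 : R) 1 (2 * m).
under eq_bigr => i _ do rewrite !expr1n mulr1.
move=> <-; rewrite exprM (_ : (1 + 1) ^+ 2 = 4 :> R); last by ring.
by rewrite divff // expf_neq0.
Qed.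

Lemma pmf_ge0 m j : 0 <= pmf m j.
Proof. by rewrite /pmf divr_ge0 // exprn_ge0. Qed.

Lemma lat_mono m g h : (forall k, g k <= h k) -> lat m g <= lat m h.
Proof. by move=> gh; apply: ler_sum => j _; rewrite ler_wpM2l // pmf_ge0. Qed.

Lemma lat_cst m c : lat m (fun=> c) = c.
Proof. by rewrite /lat -mulr_suml lat_sum_pmf mul1r. Qed.

Lemma latD m g h : lat m (fun k => g k + h k) = lat m g + lat m h.
Proof. by rewrite /lat -big_split; apply: eq_bigr => j _ /=; rewrite mulrDr. Qed.

Lemma latZ m c g : lat m (fun k => c * g k) = c * lat m g.
Proof. by rewrite /lat mulr_sumr; apply: eq_bigr => j _ /=; rewrite mulrCA. Qed.

Lemma latZr m c g : lat m (fun k => g k * c) = lat m g * c.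
Proof. by rewrite /lat mulr_suml; apply: eq_bigr => j _ /=; rewrite mulrA. Qed.

Lemma latB m g h : lat m (fun k => g k - h k) = lat m g - lat m h.
Proof. by rewrite /lat -sumrB; apply: eq_bigr => j _ /=; rewrite mulrBr. Qed.

Lemma lat_ge0 m g : (forall k, 0 <= g k) -> 0 <= lat m g.
Proof. by move=> h; rewrite -(lat_cst m 0); apply: lat_mono. Qed.

Lemma lat_norm m g : `|lat m g| <= lat m (fun k => `|g k|).
Proof.
apply: (le_trans (ler_norm_sum _ _ _)); apply: ler_sum => j _.
by rewrite normrM ger0_norm // pmf_ge0.
Qed.

Lemma pmf_sym m (j : nat) : (j <= 2 * m)%N -> pmf m (2 * m - j) = pmf m j.
Proof. by move=> h; rewrite /pmf bin_sub. Qed.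

Lemma lat_opp m g : lat m (fun k => g (- k)) = lat m g.
Proof.
rewrite /lat (reindex_inj rev_ord_inj) /=; apply: eq_bigr => j _.
rewrite subSS pmf_sym; last by rewrite -ltnS.
congr (_ * g _); rewrite natrB; last by rewrite -ltnS.
by rewrite natrM; ring.
Qed.

(** Passing from [m + k] to [m + k + 1] lowers the coefficient by the fraction
    [(2k + 1) / (m + k + 1)], at most [(2k + 1) / m]; these odd numbers add up to a square. *)
Lemma central_bin_bounds m k : (0 < m)%N ->
  ('C(2 * m, m + k)%:R <= 'C(2 * m, m)%:R :> R) /\
  'C(2 * m, m)%:R * (1 - k%:R ^+ 2 / m%:R) <= 'C(2 * m, m + k)%:R :> R.
Proof.
move=> m0; have mR : 0 < m%:R :> R by rewrite ltr0n.
elim: k => [|k [IH1 IH2]].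
  by rewrite addn0 expr0n /= mul0r subr0 mulr1.
have e := mul_bin_left (2 * m) (m + k).
rewrite addnS; case: (leqP k m) => km; last first.
  rewrite bin_small; last by lia.
  split=> //; have : (1 <= k%:R / m%:R :> R) by rewrite ler_pdivlMr // mul1r ler_nat ltnW.
  move=> h1; have : 1 <= k.+1%:R ^+ 2 / m%:R :> R.
    rewrite ler_pdivlMr // mul1r expr2 -natrM ler_nat.
    by apply: leq_trans (ltnW km) _; nia.
  move=> h2; rewrite mulr_ge0_le0 // subr_le0 //.
move/(congr1 (fun n => n%:R : R)) : e; rewrite !natrM.
have -> : (2 * m - (m + k))%:R = m%:R - k%:R :> R.
  by rewrite -natrB //; congr (_%:R); lia.
rewrite -natr1 natrD.
move: IH1 IH2; set c0 := 'C(2 * m, m)%:R; set c := 'C(_, m + k)%:R.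
set c1 := 'C(_, (m + k).+1)%:R => IH1 IH2 e.
have k0 : 0 <= k%:R :> R by [].
have c_ge0 : 0 <= c by rewrite /c.
have d0 : 0 < m%:R + k%:R + 1 :> R by lra.
have e1 : c1 = c - c * ((2 * k%:R + 1) / (m%:R + k%:R + 1)).
  apply: (@mulfI _ (m%:R + k%:R + 1)); first by rewrite gt_eqF.
  by rewrite e; field; rewrite gt_eqF.
have f0 : 0 <= (2 * k%:R + 1) / (m%:R + k%:R + 1) :> R by rewrite divr_ge0; lra.
split; first by rewrite e1; have := mulr_ge0 c_ge0 f0; lra.
have f1 : (2 * k%:R + 1) / (m%:R + k%:R + 1) <= (2 * k%:R + 1) / m%:R :> R.
  by rewrite ler_pM2l ?lef_pV2 ?posrE; lra.
have := ler_pM c_ge0 f0 IH1 f1.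
have -> : c0 * (1 - k.+1%:R ^+ 2 / m%:R) =
  c0 * (1 - k%:R ^+ 2 / m%:R) - c0 * ((2 * k%:R + 1) / m%:R).
  by rewrite -natr1; field; rewrite gt_eqF.
by rewrite e1; lra.
Qed.

Definition p0 m : R := pmf m m.

Lemma p0_gt0 m : 0 < p0 m.
Proof. by rewrite /p0 /pmf divr_gt0 ?exprn_gt0 // ltr0n bin_gt0; lia. Qed.

Lemma pmf_bounds m j : (0 < m)%N -> (j <= 2 * m)%N ->
  pmf m j <= p0 m /\ p0 m * (1 - (j%:R - m%:R) ^+ 2 / m%:R) <= pmf m j.
Proof.
move=> m0 j2.
suff H k : (k <= m)%N -> pmf m (m + k) <= p0 m /\
    p0 m * (1 - k%:R ^+ 2 / m%:R) <= pmf m (m + k).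
  case: (leqP m j) => jm.
    have -> : j = (m + (j - m))%N by lia.
    rewrite natrD [m%:R + _]addrC addrK; apply: (H (j - m)%N); lia.
  rewrite -(pmf_sym j2); have -> : (2 * m - j = m + (m - j))%N by lia.
  rewrite (_ : (j%:R - m%:R) ^+ 2 = (m - j)%:R ^+ 2).
    exact: (H (m - j)%N (leq_subr _ _)).
  by rewrite -sqrrN opprB (natrB _ (ltnW jm)).
move=> km; have [h1 h2] := central_bin_bounds k m0.
have i0 : 0 < (4 ^+ m)^-1 :> R by rewrite invr_gt0 exprn_gt0.
rewrite /p0 /pmf ler_pM2r //; split=> //.
by rewrite -mulrA [_^-1 * _]mulrC mulrA ler_pM2r.
Qed.

Lemma p0S m : p0 m.+1 = p0 m * ((2 * m%:R + 1) / (2 * (m%:R + 1))).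
Proof.
have e : ('C(2 * m.+1, m.+1) * m.+1 = 2 * (2 * m + 1) * 'C(2 * m, m))%N.
  have h1 := mul_bin_diag (2 * m.+1) m.
  have h2 := mul_bin_down (2 * m).+1 m.
  move: h1 h2; rewrite (_ : (2 * m.+1).-1 = (2 * m).+1)%N; last by lia.
  rewrite (_ : ((2 * m).+1 - m = m.+1)%N); last by lia.
  rewrite -[(2 * m).+1.-1]/(2 * m)%N.
  move: 'C(_, _) 'C(_, _) 'C(_, _) => a b c h1 h2.
  nia.
move/(congr1 (fun n => n%:R : R)): e; rewrite !natrM natrD natrM -natr1 => e.
have m0 : 0 <= m%:R :> R by [].
rewrite /p0 /pmf exprS.
have h : (4 : R) ^+ m != 0 by rewrite expf_neq0.
have -> : 'C(2 * m.+1, m.+1)%:R = 2 * (2 * m%:R + 1) * 'C(2 * m, m)%:R / (m%:R + 1) :> R.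
  by rewrite -e mulfK // gt_eqF //; lra.
field; rewrite h /= gt_eqF //; lra.
Qed.

(** Monotone convergence for the squares: [m * p0 m ^+ 2] increases, while [(m + 1/2) * p0 m ^+ 2]
    decreases from 1/2. The limit, in fact [1 / sqrt pi], stays abstract. *)
Lemma p0_sqrt_cvg : exists c : R, [/\ 0 < c,
  ((fun m => Num.sqrt m%:R * p0 m) @ \oo --> c)%classic &
  forall m, Num.sqrt m%:R * p0 m <= 1].
Proof.
pose a (m : nat) := m%:R * p0 m ^+ 2.
have aS m : a m <= a m.+1.
  have m0 : 0 <= m%:R :> R by [].
  have h : m%:R <= (m%:R + 1) * ((2 * m%:R + 1) / (2 * (m%:R + 1))) ^+ 2 :> R.
    have d : 0 < (2 * (m%:R + 1)) ^+ 2 :> R by apply: exprn_gt0; lra.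
    rewrite expr_div_n mulrA (ler_pdivlMr _ _ d); nra.
  rewrite /a p0S -(natr1 m); have := ler_wpM2r (sqr_ge0 (p0 m)) h.
  by congr (_ <= _); ring.
have bS m : (m%:R + 1/2) * p0 m ^+ 2 <= 1 / 2.
  elim: m => [|m IH].
    by rewrite /p0 /pmf expr0 muln0 bin0 divr1 expr1n mulr1 add0r.
  apply: le_trans IH.
  have m0 : 0 <= m%:R :> R by [].
  have h : (m%:R + 1 + 1/2) * ((2 * m%:R + 1) / (2 * (m%:R + 1))) ^+ 2 <= m%:R + 1/2 :> R.
    have d : 0 < (2 * (m%:R + 1)) ^+ 2 :> R by apply: exprn_gt0; lra.
    rewrite expr_div_n mulrA (ler_pdivrMr _ _ d); nra.
  rewrite p0S -(natr1 m); have := ler_wpM2r (sqr_ge0 (p0 m)) h.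
  by congr (_ <= _); ring.
have ab m : a m <= 1.
  have := bS m; rewrite /a mulrDl => h.
  have := sqr_ge0 (p0 m); lra.
have nd : nondecreasing_seq a by apply/nondecreasing_seqP.
have ac : cvgn a.
  by apply: nondecreasing_is_cvgn => //; exists 1 => _ [m _ <-].
have a1 : 0 < a 1%N by rewrite /a mul1r exprn_gt0 // p0_gt0.
have al : 0 < limn a by apply: (lt_le_trans a1); apply: nondecreasing_cvgn_le.
have e m : Num.sqrt m%:R * p0 m = Num.sqrt (a m).
  by rewrite /a sqrtrM // sqrtr_sqr gtr0_norm // p0_gt0.
exists (Num.sqrt (limn a)); split; first by rewrite sqrtr_gt0.
  rewrite (_ : (fun m => _) = Num.sqrt \o a); last by apply/funext => m; rewrite e.
  by apply: continuous_cvg => //; exact: sqrt_continuous.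
by move=> m; rewrite e -[leRHS]sqrtr1 ler_sqrt.
Qed.

(** * Counting lattice points in a window *)

Definition win m (c l w : R) : R := lat m (fun k => (`|c + l * k| <= w)%R%:R).

(** Its increment over the unit cell around a lattice point is the length of the part of the cell
    inside [[a, b]]. Summing these telescopes, which counts points without integer rounding. *)
Definition clamp (a b x : R) : R := Num.min (Num.max x a) b.

Lemma clampE a b x : a <= b ->
  clamp a b x = if x <= a then a else if x <= b then x else b.
Proof. by move=> ab; rewrite /clamp; case: (leP x a) => xa; case: leP; lra. Qed.

Lemma clamp_bound a b x : a <= b -> a <= clamp a b x <= b.
Proof.
by move=> ab; rewrite clampE //; case: (leP x a); case: (leP x b); rewrite ?lexx ?ab //;
  move=> *; apply/andP; split; lra.
Qed.

Lemma clamp_inc a b x y : a <= b -> y = x + 1 ->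
  [/\ 0 <= clamp a b y - clamp a b x <= 1,
      a <= x -> y <= b -> clamp a b y - clamp a b x = 1,
      y <= a -> clamp a b y - clamp a b x = 0 &
      b <= x -> clamp a b y - clamp a b x = 0].
Proof.
move=> ab ->; rewrite !clampE //.
case: (leP x a) => h1; case: (leP (x + 1) a) => h2; case: (leP x b) => h3;
  case: (leP (x + 1) b) => h4; split => *; lra.
Qed.

Lemma sum_clamp a b m : a <= b ->
  \sum_(j < (2 * m).+1) (clamp a b (j%:R - m%:R + 1/2) - clamp a b (j%:R - m%:R - 1/2))
  = clamp a b (m%:R + 1/2) - clamp a b (- m%:R - 1/2).
Proof.
move=> ab.
pose f (j : nat) := clamp a b (j%:R - m%:R - 1/2).
rewrite -(big_mkord xpredT (fun j : nat => clamp a b (j%:R - m%:R + 1/2) - f j)).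
rewrite (eq_bigr (fun j => f j.+1 - f j)); last first.
  move=> j _; congr (clamp _ _ _ - _); rewrite -(natr1 j); lra.
rewrite telescope_sumr // /f; congr (clamp _ _ _ - clamp _ _ _).
  by rewrite -(natr1 (2 * m)) natrM; lra.
by rewrite sub0r.
Qed.

Lemma win_le m c l w : (0 < m)%N -> 0 < l -> 0 <= w -> win m c l w <= p0 m * (2 * w / l + 1).
Proof.
move=> m0 l0 w0.
(* The interval is widened by half a cell on both sides, so that every point of the window
   contributes a full cell. *)
pose a := (- w - c) / l - 1/2; pose b := (w - c) / l + 1/2.
have ab : b - a = 2 * w / l + 1 by rewrite /a /b; field; rewrite gt_eqF.
have wl : 0 <= 2 * w / l by rewrite divr_ge0 ?mulr_ge0 // ltW.
have ab0 : a <= b by lra.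
apply: (@le_trans _ _ (p0 m * (clamp a b (m%:R + 1/2) - clamp a b (- m%:R - 1/2)))).
  rewrite -sum_clamp // mulr_sumr; apply: ler_sum => j _.
  set k := j%:R - m%:R.
  have [/andP[inc _] inc1 _ _] := @clamp_inc a b (k - 1/2) (k + 1/2) ab0 ltac:(lra).
  have [h1 _] := pmf_bounds m0 (ltnSE (ltn_ord j)).
  apply: ler_pM => //; [exact: pmf_ge0|].
  case: (leP `|c + l * k| w) => //=.
  rewrite ler_norml => /andP[k1 k2].
  have a1 : a + 1/2 <= k by rewrite /a subrK ler_pdivrMr // mulrC; lra.
  have b1 : k <= b - 1/2 by rewrite /b addrK ler_pdivlMr // mulrC; lra.
  by rewrite inc1; lra.
rewrite -ab ler_wpM2l ?(ltW (p0_gt0 m)) //.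
have /andP[_ h1] := clamp_bound (m%:R + 1/2) ab0.
have /andP[h2 _] := clamp_bound (- m%:R - 1/2) ab0.
lra.
Qed.

(** [D] bounds the absolute value of every lattice point of the window, so the mass there is at
    least [1 - D ^+ 2 / m] times the central one. *)
Lemma win_ge m c l w D : (0 < m)%N -> 0 < l -> 0 <= w -> `|c| + w <= l * D ->
  D ^+ 2 <= m%:R -> p0 m * (1 - D ^+ 2 / m%:R) * (2 * w / l - 1) <= win m c l w.
Proof.
move=> m0 l0 w0 cD D2.
have mR : 0 < m%:R :> R by rewrite ltr0n.
have D0 : 0 <= D by rewrite -(pmulr_rge0 _ l0) (le_trans _ cD) // addr_ge0.
have win0 : 0 <= win m c l w by apply: lat_ge0 => k.
have Dm : D <= m%:R.
  case: (leP D 1) => D1; first by rewrite (le_trans D1) // ler1n.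
  by apply: le_trans D2; rewrite expr2 ler_peMl // ltW.
have q0 : 0 <= 1 - D ^+ 2 / m%:R by rewrite subr_ge0 ler_pdivrMr // mul1r.
have [w1|w2] := leP (2 * w / l - 1) 0; last first.
(* The interval is narrowed by half a cell on both sides, so that the cell of a point outside the
   window contributes nothing. *)
- pose a := (- w - c) / l + 1/2; pose b := (w - c) / l - 1/2.
  have ab : b - a = 2 * w / l - 1 by rewrite /a /b; field; rewrite gt_eqF.
  have ab0 : a <= b by lra.
  have /ler_normlP[c1 c2] : `|c| <= `|c| by [].
  have bD : b <= m%:R - 1/2.
    by rewrite lerD2r (le_trans _ Dm) // ler_pdivrMr // [D * l]mulrC; lra.
  have aD : - m%:R + 1/2 <= a.
    by rewrite lerD2r; apply: (@le_trans _ _ (- D)); [lra|]; rewrite ler_pdivlMr // mulNr [D * l]mulrC; lra.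
  have -> : 2 * w / l - 1 = clamp a b (m%:R + 1/2) - clamp a b (- m%:R - 1/2).
    rewrite -ab !clampE //.
    have -> : (m%:R + 1/2 <= a) = false by apply/negP; lra.
    have -> : (- m%:R - 1/2 <= a) = true by apply/idP; lra.
    by case: leP; lra.
  rewrite -sum_clamp // mulr_sumr; apply: ler_sum => j _.
  set k := j%:R - m%:R.
  have [h1 h2] := pmf_bounds m0 (ltnSE (ltn_ord j)).
  have p00 := ltW (p0_gt0 m).
  have [/andP[_ inc] _ inc2 inc3] := @clamp_inc a b (k - 1/2) (k + 1/2) ab0 ltac:(lra).
  case: (leP `|c + l * k| w) => /=.
    rewrite mulr1 => hk; apply: le_trans h2.
    apply: (@le_trans _ _ (p0 m * (1 - D ^+ 2 / m%:R))).
      by rewrite ler_piMr // mulr_ge0 // ltW.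
    rewrite ler_wpM2l // lerB // ler_pM2r ?invr_gt0 //.
    rewrite -/k -(ger0_norm (sqr_ge0 k)) normrX lerXn2r ?nnegrE //.
    rewrite -(ler_pM2l l0) -[l in leLHS](gtr0_norm l0) -normrM.
    apply: le_trans cD; have -> : l * k = (c + l * k) - c by ring.
    by apply: (le_trans (ler_normB _ _)); rewrite addrC lerD2l.
  rewrite ltNge ler_norml negb_and -!ltNge mulr0 => /orP[k1|k2].
    have ka : k + 1/2 <= a by rewrite lerD2r ltW // ltr_pdivlMr // mulrC; lra.
    by rewrite inc2 // mulr0.
  have kb : b <= k - 1/2 by rewrite lerD2r ltW // ltr_pdivrMr // mulrC; lra.
  by rewrite inc3 // mulr0.
- apply: le_trans win0; apply: mulr_ge0_le0 w1.
  by apply: mulr_ge0 q0; apply: ltW; exact: p0_gt0.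
Qed.

End Lattice.

(** * One-sided asymptotic comparison *)

Section Asymp.
Context (R : realType).
Implicit Types u v w : nat -> R.

(** This is [limsup (u - v) <= 0]. Upper and lower estimates can be chained without knowing that
    either side converges. *)
Definition lesim u v := forall e, 0 < e -> \forall m \near \oo, u m <= v m + e.

Lemma lesim_near u v : (\forall m \near \oo, u m <= v m) -> lesim u v.
Proof. by move=> h e e0; apply: filterS h => m h; lra. Qed.

Lemma lesim_le u v : (forall m, u m <= v m) -> lesim u v.
Proof. by move=> h; apply: lesim_near; exact: nearW. Qed.

Lemma lesim_refl u : lesim u u.
Proof. exact: lesim_le. Qed.

Lemma lesim_trans v u w : lesim u v -> lesim v w -> lesim u w.
Proof.
move=> h k e e0; have e2 : 0 < e / 2 by rewrite divr_gt0.
near=> m; have : u m <= v m + e / 2 by near: m; exact: h.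
have : v m <= w m + e / 2 by near: m; exact: k.
lra.
Unshelve. all: end_near. Qed.

Lemma lesimD u v u' v' : lesim u v -> lesim u' v' ->
  lesim (fun m => u m + u' m) (fun m => v m + v' m).
Proof.
move=> h k e e0; have e2 : 0 < e / 2 by rewrite divr_gt0.
near=> m; have : u m <= v m + e / 2 by near: m; exact: h.
have : u' m <= v' m + e / 2 by near: m; exact: k.
lra.
Unshelve. all: end_near. Qed.

Lemma lesimN u v : lesim u v -> lesim (fun m => - v m) (fun m => - u m).
Proof.
move=> h e e0; near=> m; have : u m <= v m + e by near: m; exact: h.
lra.
Unshelve. all: end_near. Qed.

Lemma lesimZ c u v : 0 <= c -> lesim u v ->
  lesim (fun m => c * u m) (fun m => c * v m).
Proof.
move=> c0 h e e0; have c1 : 0 < 1 + c by lra.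
have e2 : 0 < e / (1 + c) by rewrite divr_gt0.
near=> m; have h1 : u m <= v m + e / (1 + c) by near: m; exact: h.
have h2 := ler_wpM2l c0 h1; apply: (le_trans h2); rewrite mulrDr lerD2l.
by rewrite mulrCA ler_piMr ?(ltW e0) // ler_pdivrMr // mul1r; lra.
Unshelve. all: end_near. Qed.

(** Encodes the order of limits used throughout: [m] grows for a fixed smoothing width [eta], which
    is sent to 0 only afterwards. *)
Lemma lesim_param u v (C : R) :
  (forall eta, 0 < eta <= 1 -> lesim u (fun m => v m + C * eta)) -> lesim u v.
Proof.
move=> h e e0; pose C' := 1 + `|C|.
have C0 : 0 < C' by rewrite /C'; have := normr_ge0 C; lra.
pose eta := Num.min 1 (e / 2 / C').
have eta0 : 0 < eta by rewrite lt_min ltr01 !divr_gt0.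
have eta1 : eta <= 1 by rewrite ge_min lexx.
have e2 : 0 < e / 2 by rewrite divr_gt0.
have Ce : C * eta <= e / 2.
  apply: (@le_trans _ _ (C' * eta)).
    by rewrite ler_pM2r // /C'; have := ler_norm C; lra.
  by rewrite mulrC -ler_pdivlMr // ge_min lexx orbT.
near=> m; have : u m <= v m + C * eta + e / 2.
  by near: m; apply: h; rewrite ?eta0.
lra.
Unshelve. all: end_near. Qed.

Lemma cvg_lesim u l : u @ \oo --> l <-> lesim u (fun=> l) /\ lesim (fun=> l) u.
Proof.
split=> [h|[h1 h2]].
  split=> e e0.
    move/cvgrPdist_le: h => /(_ e e0) h; near=> m.
    have : `|l - u m| <= e by near: m.
    by rewrite ler_norml; lra.
  move/cvgrPdist_le: h => /(_ e e0) h; near=> m.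
  have : `|l - u m| <= e by near: m.
  by rewrite ler_norml; lra.
apply/cvgrPdist_le => e e0; near=> m; rewrite ler_norml.
have : u m <= l + e by near: m; exact: h1.
have : l <= u m + e by near: m; exact: h2.
lra.
Unshelve. all: end_near. Qed.

Lemma cvg0_lesim u : (fun m => `|u m|) @ \oo --> (0 : R) -> u @ \oo --> (0 : R).
Proof. by move=> h; apply/norm_cvg0P. Qed.

Lemma cvg_sqrt_oo : (fun m : nat => Num.sqrt m%:R : R) @ \oo --> +oo.
Proof.
apply/cvgryPge => A; near=> m.
have : `|A| ^+ 2 <= m%:R by near: m; exact: nbhs_infty_ger.
move=> h; apply: (le_trans (ler_norm A)).
by rewrite -[leLHS](ger0_norm (normr_ge0 A)) -sqrtr_sqr ler_sqrt.
Unshelve. all: end_near. Qed.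

Lemma cvg_inv_sqrt : (fun m : nat => (Num.sqrt m%:R)^-1 : R) @ \oo --> (0 : R).
Proof.
apply/cvgrPdist_le => e e0; near=> m.
have h : e^-1 <= Num.sqrt m%:R.
  by near: m; move/cvgryPge: cvg_sqrt_oo; apply.
have e1 : 0 < e^-1 by rewrite invr_gt0.
rewrite sub0r normrN ger0_norm ?invr_ge0 ?sqrtr_ge0 //.
by rewrite -[e]invrK lef_pV2 // posrE (lt_le_trans e1).
Unshelve. all: end_near. Qed.

End Asymp.

(** * Uniform means and asymptotic rotation invariance *)

Section Mean.
Context (R : realType).

Definition mean (T : finType) (f : T -> R) : R := \sum_t unif R t * f t.

Lemma eq_mean (T : finType) (f g : T -> R) : f =1 g -> mean f = mean g.
Proof. by move=> e; apply: eq_bigr => t _; rewrite e. Qed.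

Lemma meanD (T : finType) (f g : T -> R) :
  mean (fun t => f t + g t) = mean f + mean g.
Proof. by rewrite /mean -big_split; apply: eq_bigr => t _ /=; rewrite mulrDr. Qed.

Lemma meanZ (T : finType) c (f : T -> R) : mean (fun t => c * f t) = c * mean f.
Proof. by rewrite /mean mulr_sumr; apply: eq_bigr => t _ /=; rewrite mulrCA. Qed.

Lemma meanZr (T : finType) c (f : T -> R) : mean (fun t => f t * c) = mean f * c.
Proof. by rewrite /mean mulr_suml; apply: eq_bigr => t _ /=; rewrite mulrA. Qed.

Lemma mean_cst (T : finType) (t0 : T) c : mean (fun _ : T => c) = c.
Proof. by rewrite /mean -mulr_suml (unif_law R t0).2 mul1r. Qed.

Lemma mean_pairM (T1 T2 : finType) (f : T1 -> R) (g : T2 -> R) :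
  mean (fun t : T1 * T2 => f t.1 * g t.2) = mean f * mean g.
Proof.
rewrite /mean mulr_suml.
under [RHS]eq_bigr => t _ do rewrite mulr_sumr.
rewrite pair_big /=; apply: eq_bigr => -[t s] _ /=.
by rewrite /unif card_prod natrM invfM mulrACA.
Qed.

Lemma mean_fst (T1 T2 : finType) (t2 : T2) (f : T1 -> R) :
  mean (fun t : T1 * T2 => f t.1) = mean f.
Proof.
rewrite -[RHS]mulr1 -(mean_cst t2 1) -mean_pairM.
by apply: eq_mean => t; rewrite mulr1.
Qed.

Lemma mean_snd (T1 T2 : finType) (t1 : T1) (f : T2 -> R) :
  mean (fun t : T1 * T2 => f t.2) = mean f.
Proof.
rewrite -[RHS]mul1r -(mean_cst t1 1) -mean_pairM.
by apply: eq_mean => t; rewrite mul1r.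
Qed.

Lemma mean_pair2 (T1 T2 : finType) (t1 : T1) (t2 : T2) (f f' : T1 -> R) (g g' : T2 -> R) :
  mean f = 0 -> mean f' = 0 ->
  mean (fun t : T1 * T2 => (f t.1 + g t.2) * (f' t.1 + g' t.2))
  = mean (fun t => f t * f' t) + mean (fun t => g t * g' t).
Proof.
move=> f0 f'0.
transitivity (mean (fun t : T1 * T2 => f t.1 * f' t.1 + g t.2 * g' t.2
    + f t.1 * g' t.2 + f' t.1 * g t.2)).
  by apply: eq_mean => t; ring.
rewrite !meanD !mean_pairM f0 f'0 !mul0r !addr0.
by rewrite (mean_fst t2 (fun t => f t * f' t)) (mean_snd t1 (fun t => g t * g' t)).
Qed.

Lemma mean_bool2 (f : bool * bool -> R) : mean f =
  (f (true, true) + f (true, false) + f (false, true) + f (false, false)) / 4.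
Proof.
rewrite /mean (eq_bigr (fun t : bool * bool => (fun a b => unif R (a, b) * f (a, b)) t.1 t.2)); last by case.
rewrite -(pair_big xpredT xpredT (fun a b => unif R (a, b) * f (a, b))) /=.
by rewrite !big_bool /= /unif card_prod card_bool; field.
Qed.

Lemma mean_xi c : mean (fun t => xi R t * c) = 0.
Proof. by rewrite mean_bool2 /xi /=; field. Qed.

Lemma mean_xi2 c c' : mean (fun t => (xi R t * c) * (xi R t * c')) = c * c' / 2.
Proof. by rewrite mean_bool2 /xi /=; field. Qed.

Lemma xi_norm t : `|xi R t| <= 1.
Proof.
by case: t => [[] []] /=; rewrite /xi /= ?subrr ?subr0 ?sub0r ?normrN ?normr0 ?normr1 ?ler01.
Qed.

Lemma lindeberg_unif (V : zmodType) d (l : 'I_d -> V -> R) phi K (T T' : finType)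
   (t0 : T) (t0' : T') (X : T -> V) (Y : T' -> V) N m z :
  smooth_at l phi K -> 0 <= N <= 1 ->
  (forall t i, `|l i (X t)| <= N) -> (forall t i, `|l i (Y t)| <= N) ->
  (forall i, mean (fun t => l i (X t)) = mean (fun t => l i (Y t))) ->
  (forall i j, mean (fun t => l i (X t) * l j (X t)) =
               mean (fun t => l i (Y t) * l j (Y t))) ->
  `|uwalk m X phi z - uwalk m Y phi z| <= m%:R * (2 * K * N ^+ 3).
Proof.
move=> hphi N01 hX hY m1 m2.
have -> : m%:R * (2 * K * N ^+ 3) = \sum_(n < m) 2 * K * N ^+ 3.
  by rewrite sumr_const card_ord mulr_natl.
apply: (@lindeberg _ _ _ _ m _ _ _ _ _ (fun=> 2 * K * N ^+ 3)) => [n _|n _|n x _].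
- exact: unif_law.
- exact: unif_law.
- by apply: (smooth_match _ hphi) => //; exact: unif_law.
Qed.

Definition lat2 m (g : R -> R -> R) : R := lat m (fun k => lat m (g k)).

Lemma eq_lat2 m g g' : (forall k k', g k k' = g' k k') -> lat2 m g = lat2 m g'.
Proof. by move=> e; apply: eq_lat => k; apply: eq_lat. Qed.

Lemma lat2_mono m g g' : (forall k k', g k k' <= g' k k') -> lat2 m g <= lat2 m g'.
Proof. by move=> e; apply: lat_mono => k; apply: lat_mono. Qed.

Lemma lat2D m g g' : lat2 m (fun k k' => g k k' + g' k k') = lat2 m g + lat2 m g'.
Proof. by rewrite /lat2 -latD; apply: eq_lat => k; rewrite latD. Qed.

Lemma lat2B m g g' : lat2 m (fun k k' => g k k' - g' k k') = lat2 m g - lat2 m g'.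
Proof. by rewrite /lat2 -latB; apply: eq_lat => k; rewrite latB. Qed.

Lemma lat2Z m c g : lat2 m (fun k k' => c * g k k') = c * lat2 m g.
Proof. by rewrite /lat2 -latZ; apply: eq_lat => k; rewrite latZ. Qed.

Lemma lat2_cst m c : lat2 m (fun _ _ => c) = c.
Proof. by rewrite /lat2 lat_cst lat_cst. Qed.

Lemma lat2_norm m g : `|lat2 m g| <= lat2 m (fun k k' => `|g k k'|).
Proof.
apply: (le_trans (lat_norm _ _)); apply: lat_mono => k; exact: lat_norm.
Qed.

Definition l2 (i : 'I_2) (z : R^o * R^o) : R := if i == ord0 then z.1 else z.2.

Lemma l2D i (z h : R^o * R^o) : l2 i (z + h) = l2 i z + l2 i h.
Proof. by rewrite /l2; case: ifP. Qed.

Definition phi2 (phi : R^o * R^o -> R) (m : nat) (a b c d : R) : R :=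
  lat2 m (fun k k' => phi ((a * k + b * k') / Num.sqrt m%:R,
                           (c * k + d * k') / Num.sqrt m%:R)).

Lemma phi2_walk phi m a b c d :
  phi2 phi m a b c d = uwalk m (fun t : (bool * bool) * (bool * bool) =>
     xi R t.1 *: (a / Num.sqrt m%:R, c / Num.sqrt m%:R) +
     xi R t.2 *: (b / Num.sqrt m%:R, d / Num.sqrt m%:R) : R^o * R^o) phi 0.
Proof.
rewrite (uwalk_pair m (fun t => xi R t *: ((a / Num.sqrt m%:R, c / Num.sqrt m%:R) : R^o * R^o))
  (fun t => xi R t *: ((b / Num.sqrt m%:R, d / Num.sqrt m%:R) : R^o * R^o)) phi 0).
rewrite walk_lat; apply: eq_lat => k; rewrite walk_lat; apply: eq_lat => k'.
congr (phi _); congr pair; rewrite /= /GRing.scale /=; ring.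
Qed.

(** The hypotheses say that the two linear images have the same covariance. With increments of size
    at most [C / sqrt m], the replacement costs [2 * K * C ^+ 3 / sqrt m]. *)
Lemma rot_clt phi a b c d a' b' c' d' : smooth l2 phi ->
  a * a + b * b = a' * a' + b' * b' -> c * c + d * d = c' * c' + d' * d' ->
  a * c + b * d = a' * c' + b' * d' ->
  (fun m => phi2 phi m a b c d - phi2 phi m a' b' c' d') @ \oo --> (0 : R).
Proof.
move=> [K K0 hK] g1 g2 g3.
pose C := 1 + `|a| + `|b| + `|c| + `|d| + `|a'| + `|b'| + `|c'| + `|d'|.
have C0 : 0 < C.
  by rewrite /C; repeat (apply: ltr_wpDr; first exact: normr_ge0).
apply/cvg0_lesim/cvg_lesim; split; last by apply: lesim_le.
have h : (fun m : nat => 2 * K * C ^+ 3 * (Num.sqrt m%:R)^-1 : R) @ \oo --> 2 * K * C ^+ 3 * 0.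
  by apply: cvgM; [exact: cvg_cst|exact: cvg_inv_sqrt].
rewrite mulr0 in h; move/cvg_lesim: h => [h _].
apply: lesim_trans h; apply: lesim_near.
near=> m.
have m0 : 0 < m%:R :> R by rewrite ltr0n; near: m; exact: nbhs_infty_gt.
have s0 : 0 < Num.sqrt m%:R :> R by rewrite sqrtr_gt0.
have sC : C <= Num.sqrt m%:R :> R by near: m; move/cvgryPge: (@cvg_sqrt_oo R); apply.
rewrite !phi2_walk.
set s := Num.sqrt m%:R in s0 sC *.
have ms : m%:R = s ^+ 2 by rewrite sqr_sqrtr // ltW.
pose N := C / s.
have -> : 2 * K * C ^+ 3 * s^-1 = m%:R * (2 * K * N ^+ 3).
  by rewrite ms /N; field; rewrite gt_eqF.
have bd (x y : R) t t' : `|x| + `|y| <= C -> `|xi R t * (x / s) + xi R t' * (y / s)| <= N.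
  move=> xy; rewrite !mulrA -mulrDl normrM normfV (gtr0_norm s0).
  rewrite ler_pM2r ?invr_gt0 //; apply: le_trans xy.
  by apply: (le_trans (ler_normD _ _)); apply: lerD; rewrite normrM ler_piMl // xi_norm.
have zero (x y : R) : mean (fun t : (bool * bool) * (bool * bool) => xi R t.1 * (x / s) + xi R t.2 * (y / s)) = 0.
  rewrite meanD (mean_fst (true, true) (fun t => xi R t * (x / s))).
  by rewrite (mean_snd (true, true) (fun t => xi R t * (y / s))) !mean_xi addr0.
have cov (x y x' y' : R) : mean (fun t : (bool * bool) * (bool * bool) =>
    (xi R t.1 * (x / s) + xi R t.2 * (y / s)) * (xi R t.1 * (x' / s) + xi R t.2 * (y' / s)))
    = (x * x' + y * y') / 2 / s ^+ 2.
  rewrite (mean_pair2 (true, true) (true, true) (f := fun t => xi R t * (x / s)) (f' := fun t => xi R t * (x' / s))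
     (fun t => xi R t * (y / s)) (fun t => xi R t * (y' / s))) ?mean_xi // !mean_xi2.
  by field; rewrite gt_eqF.
have n0 := @normr_ge0 R R.
have nC : [/\ `|a| + `|b| <= C, `|c| + `|d| <= C, `|a'| + `|b'| <= C & `|c'| + `|d'| <= C].
  move: (n0 a) (n0 b) (n0 c) (n0 d) (n0 a') (n0 b') (n0 c') (n0 d').
  by rewrite /C => *; split; lra.
case: nC => C1 C2 C3 C4.
apply: (lindeberg_unif (l := l2) (true, true, (true, true)) (true, true, (true, true))) => //.
- apply/andP; split; first by rewrite divr_ge0 // ltW.
  by rewrite /N ler_pdivrMr // mul1r.
- by move=> t i; rewrite /l2; case: ifP => _; apply: bd.
- by move=> t i; rewrite /l2; case: ifP => _; apply: bd.
- by move=> i; rewrite /l2; case: (i == ord0); rewrite !zero.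
- move=> i j; rewrite /l2; case: (i == ord0); case: (j == ord0); rewrite !cov.
  + by rewrite g1.
  + by rewrite g3.
  + by rewrite ![_ * a + _]addrC [c * a]mulrC [d * b]mulrC [c' * a']mulrC [d' * b']mulrC addrC g3 addrC.
  + by rewrite g2.
Unshelve. all: end_near. Qed.

End Mean.

(** * Sign correlations of the two-dimensional lattice walk *)

Section Angle.
Context (R : realType).

Definition ssg (eta x : R) : R := 2 * step ((2 * eta)^-1 * x + 1 / 2) - 1.

Definition bump (a eta x : R) : R :=
  step (eta^-1 * x + (a / eta + 1)) * step (- eta^-1 * x + (a / eta + 1)).

Lemma ssg_norm eta x : `|ssg eta x| <= 1.
Proof. by have := step01 ((2 * eta)^-1 * x + 1 / 2); rewrite /ssg ler_norml; lra. Qed.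

Lemma ind01 (b : bool) : 0 <= (b%:R : R) <= 1.
Proof. by case: b; rewrite ?lexx ?ler01. Qed.

Lemma sg_norm (x : R) : `|Num.sg x| <= 1.
Proof. by rewrite normr_sg; case: (x != 0); rewrite ?ler01. Qed.

Lemma sg_ssg eta x : 0 < eta -> `|Num.sg x - ssg eta x| <= 2 * (`|x| <= eta)%R%:R.
Proof.
move=> e0; case: (leP `|x| eta) => h.
  rewrite mulr1; apply: (le_trans (ler_normB _ _)).
  by have := sg_norm x; have := ssg_norm eta x; lra.
rewrite mulr0 normr_le0 subr_eq0; apply/eqP.
move: h; rewrite ltNge ler_norml negb_and -!ltNge => /orP[h|h].
  rewrite ltr0_sg; last by lra.
  rewrite /ssg step0; first by lra.
  suff : (2 * eta)^-1 * x <= - (1 / 2) by lra.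
  by rewrite mulrC ler_pdivrMr; lra.
rewrite gtr0_sg; last by lra.
rewrite /ssg step1; first by lra.
suff : 1 / 2 <= (2 * eta)^-1 * x by lra.
by rewrite [leRHS]mulrC ler_pdivlMr; lra.
Qed.

Lemma bump01 a eta x : 0 <= bump a eta x <= 1.
Proof.
rewrite /bump; set u := step _; set v := step _.
have /andP[u0 u1] : 0 <= u <= 1 by exact: step01.
have /andP[v0 v1] : 0 <= v <= 1 by exact: step01.
by rewrite mulr_ge0 //= mulr_ile1.
Qed.

Lemma bump_ge a eta x : 0 < eta -> (`|x| <= a)%R%:R <= bump a eta x.
Proof.
move=> e0; case: (leP `|x| a) => h; last by rewrite mulr0n; case/andP: (bump01 a eta x).
have ei : 0 < eta^-1 by rewrite invr_gt0.
move: h; rewrite ler_norml => /andP[h1 h2].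
rewrite /bump !step1 ?mulr1 //.
  have := ler_wpM2r (ltW ei) h2; lra.
have := ler_wpM2r (ltW ei) h1; lra.
Qed.

Lemma bump_le a eta x : 0 < eta -> bump a eta x <= (`|x| <= a + eta)%R%:R.
Proof.
move=> e0; case: (leP `|x| (a + eta)) => h; first by case/andP: (bump01 a eta x).
have ei : 0 < eta^-1 by rewrite invr_gt0.
have e1 : eta / eta = 1 by rewrite divff // gt_eqF.
move: h; rewrite ltNge ler_norml negb_and -!ltNge => /orP[h|h].
  rewrite /bump step0 ?mul0r //.
  have : (x + (a + eta)) * eta^-1 <= 0 by apply: mulr_le0_ge0; lra.
  rewrite !mulrDl e1; lra.
rewrite /bump mulrC step0 ?mul0r //.
have : (a + eta - x) * eta^-1 <= 0 by apply: mulr_le0_ge0; lra.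
rewrite !mulrDl e1; lra.
Qed.

Lemma smooth_bump (V : zmodType) d (l : 'I_d -> V -> R) i a eta :
  (forall x y, l i (x + y) = l i x + l i y) ->
  smooth l (fun z => bump a eta (l i z)).
Proof. by move=> li; apply: smooth_mul; apply: smooth_step. Qed.

Lemma smooth_ssg (V : zmodType) d (l : 'I_d -> V -> R) i eta :
  (forall x y, l i (x + y) = l i x + l i y) ->
  smooth l (fun z => ssg eta (l i z)).
Proof.
move=> li; apply: smoothD; last exact: smooth_cst.
by apply: smoothZ; apply: smooth_step.
Qed.

Lemma p0_lesim : lesim (fun m => p0 R m) (fun=> 0).
Proof.
have [c [_ _ h]] := p0_sqrt_cvg R.
have /cvg_lesim[k _] := @cvg_inv_sqrt R.
apply: lesim_trans k; apply: lesim_near; near=> m.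
have m0 : 0 < m%:R :> R by rewrite ltr0n; near: m; exact: nbhs_infty_gt.
have s0 : 0 < Num.sqrt m%:R :> R by rewrite sqrtr_gt0.
by rewrite -[leRHS]mul1r ler_pdivlMr // mulrC.
Unshelve. all: end_near. Qed.

Definition proj (t k k' : R) : R := cos t * k + sin t * k'.

Definition near_axis (m : nat) (t eta : R) : R :=
  lat2 m (fun k k' => (`|proj t k k'| <= eta * Num.sqrt m%:R)%R%:R).

Lemma sqrt_pos_near : \forall m \near \oo, 0 < Num.sqrt m%:R :> R.
Proof.
near=> m; rewrite sqrtr_gt0 ltr0n; near: m; exact: nbhs_infty_gt.
Unshelve. all: end_near. Qed.

Lemma cos2Dsin2' (t : R) : cos t * cos t + sin t * sin t = 1.
Proof. by rewrite -!expr2 cos2Dsin2. Qed.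

(** Rotation reduces to the first axis. The smoothing doubles the half-width to [2 * eta * sqrt m],
    and a one-dimensional window of that size has mass at most [(4 * eta * sqrt m + 1) * p0], where
    [sqrt m * p0 <= 1]. *)
Lemma near_axis_le t eta : 0 < eta -> lesim (fun m => near_axis m t eta) (fun=> 4 * eta).
Proof.
move=> e0.
pose phi (z : R^o * R^o) := bump eta eta (l2 ord0 z).
have sphi : smooth (@l2 R) phi by apply: smooth_bump => x y; exact: l2D.
have /cvg_lesim[h _] := rot_clt (a := cos t) (b := sin t) (a' := 1) (b' := 0)
  (c := 0) (d := 0) (c' := 0) (d' := 0) sphi
  ltac:(rewrite cos2Dsin2'; ring) ltac:(ring) ltac:(ring).
have k1 : lesim (fun m => phi2 phi m 1 0 0 0) (fun=> 4 * eta).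
  apply: (@lesim_trans _ (fun m => 4 * eta + p0 R m)); last first.
    by rewrite -[X in lesim _ (fun=> X)]addr0; apply: lesimD p0_lesim; exact: lesim_refl.
  apply: lesim_near; near=> m.
  have s0 : 0 < Num.sqrt m%:R :> R by near: m; exact: sqrt_pos_near.
  have m0 : (0 < m)%N by rewrite sqrtr_gt0 ltr0n in s0.
  apply: (@le_trans _ _ (win m 0 1 (2 * eta * Num.sqrt m%:R))).
    rewrite /win /phi2 /lat2; apply: lat_mono => k.
    rewrite -[leRHS](lat_cst m); apply: lat_mono => k'.
    rewrite /phi /l2 /= !(mul0r, addr0, add0r, mul1r).
    apply: (le_trans (bump_le _ _ e0)).
    rewrite normrM normfV (gtr0_norm s0) ler_pdivrMr //.
    by rewrite (_ : eta + eta = 2 * eta) //; ring.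
  apply: (le_trans (win_le _ m0 ltr01 _)).
    by rewrite mulr_ge0 ?sqrtr_ge0 // mulr_ge0 // ltW.
  have [c [_ _ pb]] := p0_sqrt_cvg R.
  have := ler_wpM2l (_ : 0 <= 4 * eta) (pb m); rewrite mulr_ge0 ?(ltW e0) // => /(_ isT).
  by rewrite divr1; lra.
apply: (@lesim_trans _ (fun m => phi2 phi m (cos t) (sin t) 0 0)).
  apply: lesim_near; near=> m.
  have s0 : 0 < Num.sqrt m%:R :> R by near: m; exact: sqrt_pos_near.
  apply: lat2_mono => k k'; rewrite /phi /l2 /=.
  apply: le_trans (bump_ge _ _ e0).
  by rewrite normrM normfV (gtr0_norm s0) ler_pdivrMr.
have := lesimD h k1; rewrite add0r.
by apply: lesim_trans; apply: lesim_le => m; lra.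
Unshelve. all: end_near. Qed.

Definition sgcorr (m : nat) (t t' : R) : R :=
  lat2 m (fun k k' => Num.sg (proj t k k') * Num.sg (proj t' k k')).

Lemma mul_close (x y x' y' : R) : `|y| <= 1 -> `|x'| <= 1 ->
  `|x * y - x' * y'| <= `|x - x'| + `|y - y'|.
Proof.
move=> y1 x1; have -> : x * y - x' * y' = (x - x') * y + x' * (y - y') by ring.
apply: (le_trans (ler_normD _ _)); rewrite !normrM.
by apply: lerD; [rewrite ler_piMr|rewrite ler_piMl].
Qed.

Lemma sgZ_inv (s x : R) : 0 < s -> Num.sg (x / s) = Num.sg x.
Proof. by move=> s0; rewrite sgrM sgrV (gtr0_sg s0) mulr1. Qed.

Definition ssg2 eta (z : R^o * R^o) : R := ssg eta (l2 ord0 z) * ssg eta (l2 ord_max z).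

Lemma sgcorr_smooth m t t' eta : 0 < eta -> (0 < m)%N ->
  `|sgcorr m t t' - phi2 (ssg2 eta) m (cos t) (sin t) (cos t') (sin t')|
  <= 2 * (near_axis m t eta + near_axis m t' eta).
Proof.
move=> e0 m0; have s0 : 0 < Num.sqrt m%:R :> R by rewrite sqrtr_gt0 ltr0n.
rewrite /sgcorr /phi2 -lat2B; apply: (le_trans (lat2_norm _ _)).
rewrite -lat2D -lat2Z; apply: lat2_mono => k k'.
rewrite -(sgZ_inv (proj t k k') s0) -(sgZ_inv (proj t' k k') s0) /ssg2 /l2 /=.
apply: (le_trans (mul_close _ _ (sg_norm _) (ssg_norm _ _))).
rewrite mulrDr.
have E (u : R) : (`|u| <= eta * Num.sqrt m%:R)%R = (`|u / Num.sqrt m%:R| <= eta).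
  by rewrite normrM normfV (gtr0_norm s0) ler_pdivrMr.
by rewrite !E; apply: lerD; exact: sg_ssg.
Qed.

Lemma cvg0_param (u : nat -> R) (C : R) :
  (forall eta, 0 < eta <= 1 -> lesim (fun m => `|u m|) (fun=> C * eta)) ->
  u @ \oo --> (0 : R).
Proof.
move=> h; apply/cvg0_lesim/cvg_lesim; split; last exact: lesim_le.
apply: (@lesim_param _ _ _ C) => eta he.
by apply: (lesim_trans (h eta he)); apply: lesim_le => m; lra.
Qed.

Lemma eq_cvg_seq (u v : nat -> R) (l : R) : (forall m, u m = v m) ->
  u @ \oo --> l -> v @ \oo --> l.
Proof. by move=> /funext ->. Qed.

Lemma cvg_seqD (u v : nat -> R) (a b : R) : u @ \oo --> a -> v @ \oo --> b ->
  (fun m => u m + v m) @ \oo --> a + b.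
Proof. by move=> hu hv; apply: cvgD. Qed.

Lemma cvg_seq_cst (c : R) : (fun _ : nat => c) @ \oo --> c.
Proof. exact: cvg_cst. Qed.

Lemma cvg_seqZ c (u : nat -> R) (a : R) : u @ \oo --> a ->
  (fun m => c * u m) @ \oo --> c * a.
Proof. by move=> hu; apply: cvgM => //; exact: cvg_cst. Qed.

Lemma sgcorr_rot t t' h :
  (fun m => sgcorr m (t + h) (t' + h) - sgcorr m t t') @ \oo --> (0 : R).
Proof.
(* Two applications of [sgcorr_smooth] give twice the sum of four axis neighbourhoods, each
   asymptotically at most [4 * eta]. *)
apply: (@cvg0_param _ 32) => eta /andP[e0 _].
have sphi : smooth (@l2 R) (ssg2 eta).
  by apply: smooth_mul; apply: smooth_ssg => x y; exact: l2D.
have := rot_clt (a := cos (t + h)) (b := sin (t + h)) (a' := cos t) (b' := sin t)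
  (c := cos (t' + h)) (d := sin (t' + h)) (c' := cos t') (d' := sin t') sphi.
rewrite !cos2Dsin2' => /(_ erefl erefl).
have -> : cos (t + h) * cos (t' + h) + sin (t + h) * sin (t' + h)
   = cos t * cos t' + sin t * sin t'.
  rewrite -[in RHS]cosB (_ : t - t' = (t + h) - (t' + h)); last by ring.
  by rewrite -cosB.
move=> /(_ erefl) /cvg_norm; rewrite normr0 => /cvg_lesim[H _].
have Z := (lesimD H (lesimZ (ler0n R 2) (lesimD (lesimD (near_axis_le (t + h) e0)
   (near_axis_le (t' + h) e0)) (lesimD (near_axis_le t e0) (near_axis_le t' e0))))).
apply: (lesim_trans _ (lesim_trans Z _)); last by apply: lesim_le => m; lra.
apply: lesim_near; near=> m.
have m0 : (0 < m)%N by near: m; exact: nbhs_infty_gt.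
have h1 := sgcorr_smooth t t' e0 m0; have h2 := sgcorr_smooth (t + h) (t' + h) e0 m0.
move: h1 h2; set A := sgcorr _ t t'; set B := sgcorr _ _ _.
set A' := phi2 _ _ (cos t) _ _ _; set B' := phi2 _ _ _ _ _ _ => h1 h2.
have -> : B - A = (B' - A') + ((B - B') - (A - A')) by ring.
apply: (le_trans (ler_normD _ _)); rewrite lerD2l.
apply: (le_trans (ler_normB _ _)); lra.
Unshelve. all: end_near. Qed.

(** The middle sign cannot differ from both outer ones. The identity thus says that disagreement is
    additive: [1 - s1 s3 = (1 - s1 s2) + (1 - s2 s3)]. *)
Lemma sg_between (x1 x2 x3 c1 c2 c3 : R) : x1 != 0 -> x2 != 0 -> x3 != 0 ->
  0 <= c1 -> 0 <= c3 -> 0 < c2 -> c2 * x2 = c1 * x1 + c3 * x3 ->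
  Num.sg x1 * Num.sg x3 - Num.sg x1 * Num.sg x2 - Num.sg x2 * Num.sg x3 + 1 = 0.
Proof.
move=> n1 n2 n3 c10 c30 c20 e.
have p (x y : R) : 0 <= x -> 0 < y -> 0 <= x * y by move=> ? ?; rewrite mulr_ge0 // ltW.
case: (ltgtP x1 0) n1 => // h1 _; case: (ltgtP x3 0) n3 => // h3 _;
  case: (ltgtP x2 0) n2 => // h2 _; rewrite ?(ltr0_sg h1) ?(gtr0_sg h1)
  ?(ltr0_sg h2) ?(gtr0_sg h2) ?(ltr0_sg h3) ?(gtr0_sg h3); try lra.
- have := mulr_gt0 c20 h2; have := mulr_ge0_le0 c10 (ltW h1).
  have := mulr_ge0_le0 c30 (ltW h3); lra.
- have := pmulr_rlt0 x2 c20; rewrite h2 => h2'.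
  have := mulr_ge0 c10 (ltW h1); have := mulr_ge0 c30 (ltW h3); lra.
Qed.

Lemma proj_between (t1 t2 t3 k k' : R) :
  sin (t3 - t1) * proj t2 k k' = sin (t3 - t2) * proj t1 k k' + sin (t2 - t1) * proj t3 k k'.
Proof.
rewrite /proj !sinB.
have e1 := cos2Dsin2' t1; have e2 := cos2Dsin2' t2; have e3 := cos2Dsin2' t3.
ring.
Qed.

Lemma near_axis_tie m t eta : 0 <= eta ->
  lat2 m (fun k k' => (proj t k k' == 0)%:R) <= near_axis m t eta.
Proof.
move=> e0; apply: lat2_mono => k k'; case: eqP => [->|_].
  by rewrite normr0 mulr_ge0 // sqrtr_ge0.
by have /andP[] := ind01 (`|proj t k k'| <= eta * Num.sqrt m%:R).
Qed.

Lemma sgcorr_add t1 t2 t3 : t1 <= t2 <= t3 -> 0 < t3 - t1 < pi ->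
  (fun m => sgcorr m t1 t3 - sgcorr m t1 t2 - sgcorr m t2 t3 + 1) @ \oo --> (0 : R).
Proof.
move=> /andP[t12 t23] /andP[t13 t3p].
(* The combination is 0 unless one of three projections vanishes, and at most 4 in absolute value
   then; each tie lies in an axis neighbourhood of mass at most [4 * eta] in the limit. *)
apply: (@cvg0_param _ 48) => eta /andP[e0 _].
have Z := lesimZ (ler0n R 4) (lesimD (lesimD (near_axis_le t1 e0) (near_axis_le t2 e0))
  (near_axis_le t3 e0)).
apply: (lesim_trans _ (lesim_trans Z _)); last by apply: lesim_le => m; lra.
apply: lesim_le => m.
apply: (@le_trans _ _ (4 * (lat2 m (fun k k' => (proj t1 k k' == 0)%:R)
   + lat2 m (fun k k' => (proj t2 k k' == 0)%:R)
   + lat2 m (fun k k' => (proj t3 k k' == 0)%:R)))); last first.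
  by rewrite ler_wpM2l //; apply: lerD; [apply: lerD|]; apply: near_axis_tie; exact: ltW.
rewrite -[X in `|_ + X|](lat2_cst m) /sgcorr -!lat2B -!lat2D -lat2Z.
apply: (le_trans (lat2_norm _ _)); apply: lat2_mono => k k'.
set x1 := proj t1 k k'; set x2 := proj t2 k k'; set x3 := proj t3 k k'.
have M (x y : R) : `|Num.sg x * Num.sg y| <= 1.
  by rewrite normrM mulr_ile1 // sg_norm.
have le4 : `|Num.sg x1 * Num.sg x3 - Num.sg x1 * Num.sg x2 - Num.sg x2 * Num.sg x3 + 1| <= 4.
  have := M x1 x3; have := M x1 x2; have := M x2 x3; rewrite !ler_norml; lra.
case: (boolP (x1 == 0)) => n1; last case: (boolP (x2 == 0)) => n2;
  last case: (boolP (x3 == 0)) => n3.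
- have := ind01 (x2 == 0); have := ind01 (x3 == 0); rewrite /=; lra.
- have := ind01 (x3 == 0); rewrite /=; lra.
- rewrite /=; lra.
rewrite (@sg_between x1 x2 x3 (sin (t3 - t2)) (sin (t3 - t1)) (sin (t2 - t1))) //.
- by rewrite normr0 /=; lra.
- by apply: sin_ge0_pi; apply/andP; split; lra.
- by apply: sin_ge0_pi; apply/andP; split; lra.
- by apply: sin_gt0_pi; apply/andP; split; lra.
- exact: proj_between.
Qed.

Lemma sgcorr_refl t : (fun m => sgcorr m t t) @ \oo --> (1 : R).
Proof.
suff h : (fun m => 1 - sgcorr m t t) @ \oo --> (0 : R).
  have -> : (fun m => sgcorr m t t) = (fun m => 1 - (1 - sgcorr m t t)).
    by apply/funext => m; ring.
  by rewrite -[X in _ --> X]subr0; apply: cvgB => //; exact: cvg_cst.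
apply: (@cvg0_param _ 4) => eta /andP[e0 _].
apply: (lesim_trans _ (near_axis_le t e0)); apply: lesim_le => m.
apply: le_trans (near_axis_tie m t (ltW e0)).
rewrite -[X in `|X - _|](lat2_cst m) -lat2B; apply: (le_trans (lat2_norm _ _)).
apply: lat2_mono => k k'; case: (boolP (proj t k k' == 0)) => h.
  by rewrite (eqP h) sgr0 mul0r subr0 normr1.
by rewrite -expr2 sqr_sg h subrr normr0.
Qed.

Lemma sgcorr_sym m t t' : sgcorr m t t' = sgcorr m t' t.
Proof. by apply: eq_lat2 => k k'; rewrite mulrC. Qed.

Lemma sgcorr_pi m t : sgcorr m t pi = - sgcorr m t 0.
Proof.
rewrite -mulN1r -lat2Z; apply: eq_lat2 => k k'.
rewrite /proj cospi sinpi cos0 sin0 !mul0r !addr0 mul1r mulN1r sgrN.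
by rewrite mulrN mulN1r.
Qed.

(* The disagreement probability is thus additive in the angle, up to o(1), and
   monotone, hence linear. *)
Lemma sgcorr_additive t s : 0 <= t -> 0 <= s -> 0 < t + s <= pi ->
  (fun m => (1 - sgcorr m 0 (t + s)) - (1 - sgcorr m 0 t) - (1 - sgcorr m 0 s)) @ \oo --> (0 : R).
Proof.
move=> t0 s0 /andP[ts0 tsp].
have rot := sgcorr_rot 0 s t; rewrite add0r in rot.
have [tsl|tsg] := ltP (t + s) pi.
  have A := @sgcorr_add 0 t (t + s).
  have {A} A := A ltac:(apply/andP; split; lra) ltac:(apply/andP; split; lra).
  rewrite [s + t]addrC in rot.
  have := cvg_seqZ (c := -1) (cvg_seqD A rot); rewrite addr0 mulr0.
  by apply: eq_cvg_seq => m; ring.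
(* At a total angle [pi] the sine needed by [sgcorr_add] vanishes. The directions 0 and [pi] are
   opposite, so [sgcorr_pi] together with a rotation gives the same relation. *)
have e : s + t = pi by lra.
have e' : t + s = pi by lra.
have := cvg_seqZ (c := -1) rot.
have := cvg_seqD (sgcorr_refl 0) (cvg_seq_cst (c := -1)).
rewrite e e' subrr mulr0 => r1 r2.
have := cvg_seqD r1 r2; rewrite addr0.
by apply: eq_cvg_seq => m; rewrite !sgcorr_pi (sgcorr_sym m t 0); ring.
Qed.

End Angle.

Section Angle2.
Context (R : realType).

(** Up to ties, twice the probability that the signs along directions 0 and [t] differ. Its limit 2
    at [pi] will fix the slope [2 / pi]. *)
Let P (t : R) (m : nat) : R := 1 - sgcorr m 0 t.

Let P_ge0 t m : 0 <= P t m.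
Proof.
rewrite /P subr_ge0; apply: (le_trans (ler_norm _)).
apply: (le_trans (lat2_norm _ _)); rewrite -[leRHS](lat2_cst m).
by apply: lat2_mono => k k'; rewrite normrM mulr_ile1 // sg_norm.
Qed.

Let P_add t s : 0 <= t -> 0 <= s -> 0 < t + s <= pi ->
  (fun m => P (t + s) m - P t m - P s m) @ \oo --> (0 : R).
Proof. exact: sgcorr_additive. Qed.

Let P_mono t s : 0 <= t <= s -> 0 < s <= pi -> lesim (P t) (P s).
Proof.
move=> /andP[t0 ts] /andP[s0 sp].
have := @P_add t (s - t) t0; rewrite subrKC => /(_ ltac:(lra) ltac:(apply/andP; split; lra)).
move=> /cvg_lesim[_ h].
have h2 := lesimD h (lesim_refl (P t)).
apply: (lesim_trans _ (lesim_trans h2 _)); apply: lesim_le => m; first by lra.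
by have := P_ge0 (s - t) m; lra.
Qed.

Let P_pi : P pi @ \oo --> (2 : R).
Proof.
have := cvg_seqD (cvg_seq_cst (c := 1)) (sgcorr_refl (0 : R)).
by apply: eq_cvg_seq => m; rewrite /P sgcorr_pi; ring.
Qed.

Let P_mult N j : (0 < N)%N -> (0 < j <= N)%N ->
  (fun m => P (j%:R * (pi / N%:R)) m - j%:R * P (pi / N%:R) m) @ \oo --> (0 : R).
Proof.
move=> N0; have NR : 0 < N%:R :> R by rewrite ltr0n.
have h0 : 0 < pi / N%:R :> R by rewrite divr_gt0 // pi_gt0.
elim: j => // j IH /andP[_ jN].
have [->|j0] := posnP j.
  apply: eq_cvg_seq (cvg_seq_cst (c := 0)) => m; rewrite !mul1r; ring.
have {}IH := IH ltac:(by rewrite j0 ltnW).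
have jh : 0 < j%:R * (pi / N%:R) :> R by rewrite mulr_gt0 // ltr0n.
have e : j.+1%:R * (pi / N%:R) = j%:R * (pi / N%:R) + pi / N%:R :> R.
  by rewrite -natr1 mulrDl mul1r.
have le : j.+1%:R * (pi / N%:R) <= pi :> R.
  by rewrite mulrCA ler_piMr ?pi_ge0 // ler_pdivrMr // mul1r ler_nat.
have A := @P_add (j%:R * (pi / N%:R)) (pi / N%:R) (ltW jh) (ltW h0).
have {}A := A ltac:(apply/andP; split; lra).
rewrite -e in A; have := cvg_seqD A IH; rewrite addr0.
by apply: eq_cvg_seq => m; rewrite -(natr1 j); ring.
Qed.

Let P_grid N j : (0 < N)%N -> (j <= N)%N ->
  P (j%:R * (pi / N%:R)) @ \oo --> (2 * j%:R / N%:R : R).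
Proof.
move=> N0 jN; have NR : 0 < N%:R :> R by rewrite ltr0n.
have PN : P (pi / N%:R) @ \oo --> (2 / N%:R : R).
  have := P_mult N0 (j := N); rewrite N0 leqnn => /(_ isT).
  rewrite mulrCA divff ?gt_eqF // mulr1 => A.
  have := cvg_seqZ (c := N%:R^-1) (cvg_seqD P_pi (cvg_seqZ (c := -1) A)).
  rewrite (_ : N%:R^-1 * (2 + -1 * 0) = 2 / N%:R); last by ring.
  apply: eq_cvg_seq => m.
  by field; rewrite gt_eqF.
have [->|j0] := posnP j.
  rewrite mul0r mulr0 mul0r.
  have := cvg_seqD (cvg_seq_cst (c := 1)) (cvg_seqZ (c := -1) (sgcorr_refl (0 : R))).
  by rewrite mulr1 subrr; apply: eq_cvg_seq => m; rewrite /P; ring.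
have A := P_mult N0 (j := j); rewrite j0 jN in A; have {}A := A isT.
have := cvg_seqD A (cvg_seqZ (c := j%:R) PN).
rewrite add0r (_ : j%:R * (2 / N%:R) = 2 * j%:R / N%:R); last by ring.
by apply: eq_cvg_seq => m; ring.
Qed.

(** Sheppard's formula for the walk. Additivity gives the limits [2 * j / N] at the angles
    [j * pi / N], and monotonicity squeezes [theta] between two neighbouring ones. *)
Lemma sgcorr_cvg (theta : R) : 0 < theta < pi ->
  (fun m => sgcorr m 0 theta) @ \oo --> 1 - 2 * theta / pi.
Proof.
move=> /andP[t0 tp]; have p0 := pi_gt0 R.
suff h : P theta @ \oo --> 2 * theta / pi.
  have := cvg_seqD (cvg_seq_cst (c := 1)) (cvg_seqZ (c := -1) h).
  by rewrite mulN1r; apply: eq_cvg_seq => m; rewrite /P; ring.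
have grid (eta : R) : 0 < eta -> exists N j, [/\ (0 < N)%N, (j.+1 <= N)%N, 2 / N%:R <= eta,
    j%:R * (pi / N%:R) <= theta & theta < j.+1%:R * (pi / N%:R)].
  move=> e0; pose N := (Num.truncn (2 / eta)).+1; exists N.
  have NR : 0 < N%:R :> R by rewrite ltr0n.
  have x0 : 0 <= theta / (pi / N%:R) by rewrite divr_ge0 ?(ltW t0) // divr_ge0 ?ltW.
  have hN : 0 < pi / N%:R :> R by rewrite divr_gt0.
  have /andP[j1 j2] := truncn_itv x0.
  exists (Num.truncn (theta / (pi / N%:R))); rewrite ler_pdivlMr // in j1.
  rewrite ltr_pdivrMr // in j2.
  split => //.
    rewrite -(ltr_nat R) -(ltr_pM2r hN); apply: (le_lt_trans j1).
    by rewrite mulrCA divff ?mulr1 // gt_eqF.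
  have := truncnS_gt (2 / eta); rewrite -/N ltr_pdivrMr // => h.
  by rewrite ler_pdivrMr // mulrC ltW.
apply/cvg_lesim; split; apply: (@lesim_param _ _ _ 1) => eta /andP[e0 _].
  have [N [j [N0 jN hN h1 h2]]] := grid _ e0.
  have NR : 0 < N%:R :> R by rewrite ltr0n.
  have le : j.+1%:R * (pi / N%:R) <= pi :> R.
    by rewrite mulrCA ler_piMr ?pi_ge0 // ler_pdivrMr // mul1r ler_nat.
  have A : lesim (P theta) (P (j.+1%:R * (pi / N%:R))).
    by apply: P_mono; apply/andP; split; lra.
  have /cvg_lesim[B _] := P_grid N0 jN.
  apply: (lesim_trans A); apply: (lesim_trans B); apply: lesim_le => _.
  apply: (@le_trans _ _ (2 * j%:R / N%:R + 2 / N%:R)).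
    by rewrite -(natr1 j) mulrDr mulr1 mulrDl.
  rewrite mul1r; apply: lerD => //; rewrite -!mulrA ler_pM2l //.
  by rewrite ler_pdivlMr // -mulrA [_^-1 * _]mulrC.
have [N [j [N0 jN hN h1 h2]]] := grid _ e0.
have NR : 0 < N%:R :> R by rewrite ltr0n.
have j0 : 0 <= j%:R * (pi / N%:R) :> R by rewrite mulr_ge0 // divr_ge0 // ltW.
have A : lesim (P (j%:R * (pi / N%:R))) (P theta).
  by apply: P_mono; apply/andP; split; lra.
have /cvg_lesim[_ B] := P_grid N0 (ltnW jN).
have C := lesimD (lesim_trans B A) (lesim_refl (fun=> 1 * eta)).
apply: lesim_trans C; apply: lesim_le => _.
apply: (@le_trans _ _ (2 * j%:R / N%:R + 2 / N%:R)); last by rewrite mul1r lerD2l.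
rewrite -[X in _ + X / _]mulr1 -mulrDl -mulrDr natr1 -!mulrA ler_pM2l //.
by rewrite ler_pdivrMr // -mulrA [_^-1 * _]mulrC ltW.
Qed.

End Angle2.

(** * Window probabilities *)

Section Window.
Context (R : realType).

Definition lnn (m : nat) : R := ln m%:R.
Definition wid (m : nat) : R := Num.sqrt m%:R / lnn m.

Lemma lnn_oo : lnn @ \oo --> +oo.
Proof.
apply/cvgryPge => A; near=> m.
have h : expR A <= m%:R by near: m; exact: nbhs_infty_ger.
by rewrite -[A]expRK /lnn ler_ln // posrE ?expR_gt0 // (lt_le_trans _ h) // expR_gt0.
Unshelve. all: end_near. Qed.

Lemma inv_cvg0 (u : nat -> R) : u @ \oo --> +oo -> (fun m => (u m)^-1) @ \oo --> (0 : R).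
Proof.
move=> /cvgryPge h; apply/cvgrPdist_le => e e0; near=> m.
have k : e^-1 <= u m by near: m; exact: h.
have e1 : 0 < e^-1 by rewrite invr_gt0.
have u0 : 0 < u m by exact: lt_le_trans k.
rewrite sub0r normrN gtr0_norm ?invr_gt0 //.
by rewrite -[e]invrK lef_pV2.
Unshelve. all: end_near. Qed.

Lemma lnn_inv0 : (fun m => (lnn m)^-1) @ \oo --> (0 : R).
Proof. exact: inv_cvg0 lnn_oo. Qed.

Lemma lnn_gt0_near : \forall m \near \oo, 1 <= lnn m.
Proof. by move/cvgryPge: lnn_oo; apply. Qed.

Lemma cvg_seqM (u v : nat -> R) (a b : R) : u @ \oo --> a -> v @ \oo --> b ->
  (fun m => u m * v m) @ \oo --> a * b.
Proof. by move=> hu hv; apply: cvgM. Qed.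

Lemma cvg_near (u v : nat -> R) (l : R) : (\forall m \near \oo, u m = v m) ->
  u @ \oo --> l -> v @ \oo --> l.
Proof. by move=> h k; apply: cvg_trans k; apply: near_eq_cvg; apply: filterS h => m ->. Qed.

Lemma squeeze0 (u v : nat -> R) : (\forall m \near \oo, 0 <= u m <= v m) ->
  v @ \oo --> (0 : R) -> u @ \oo --> (0 : R).
Proof.
move=> h hv; apply: (squeeze_cvgr (f := fun=> 0) (h := v)) => //.
exact: cvg_cst.
Qed.

(** Since [sqrt m = expR (lnn m / 2)], the term of degree [k + 1] of the exponential series already
    dominates [lnn m ^+ k]; [C] collects its constants. *)
Lemma lnn_pow_sqrt k : (fun m => lnn m ^+ k / Num.sqrt m%:R) @ \oo --> (0 : R).
Proof.
pose C : R := 2 ^+ k.+1 * (k.+1)`!%:R.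
have C0 : 0 < C by rewrite mulr_gt0 ?exprn_gt0 // ltr0n fact_gt0.
have h := cvg_seqZ (c := C) lnn_inv0; rewrite mulr0 in h.
apply: squeeze0 h; near=> m.
have l1 : 1 <= lnn m by near: m; exact: lnn_gt0_near.
have l0 : 0 < lnn m by lra.
have m0 : 0 < m%:R :> R by rewrite ltr0n; near: m; exact: nbhs_infty_gt.
have s0 : 0 < Num.sqrt m%:R :> R by rewrite sqrtr_gt0.
apply/andP; split; first by rewrite divr_ge0 // exprn_ge0 // ltW.
rewrite ler_pdivrMr //.
have e : (Num.sqrt m%:R) = expR (lnn m / 2).
  apply: (@pexpIrn _ 2) => //; rewrite ?nnegrE ?expR_ge0 ?ltW //.
  rewrite sqr_sqrtr ?ltW // -expRM_natl mulrC divfK //.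
  by rewrite /lnn lnK // posrE.
have h := expR_ge1Dxn k (divr_ge0 (ltW l0) (ler0n R 2)); rewrite -e in h.
have {}h : (lnn m / 2) ^+ k.+1 / (k.+1)`!%:R <= Num.sqrt m%:R by lra.
rewrite ler_pdivrMr ?ltr0n ?fact_gt0 // expr_div_n ler_pdivrMr ?exprn_gt0 // in h.
rewrite mulrAC ler_pdivlMr // -exprSr; apply: (le_trans h).
by rewrite /C le_eqVlt; apply/orP; left; apply/eqP; ring.
Unshelve. all: end_near. Qed.

Lemma wid_inv0 : (fun m => (wid m)^-1) @ \oo --> (0 : R).
Proof.
have := lnn_pow_sqrt 1; apply: eq_cvg_seq => m.
by rewrite /wid invfM invrK mulrC.
Qed.

Lemma wid_sq : (fun m => wid m ^+ 2 / m%:R) @ \oo --> (0 : R).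
Proof.
have := cvg_seqM lnn_inv0 lnn_inv0; rewrite mulr0; apply: cvg_near.
near=> m.
have m0 : 0 < m%:R :> R by rewrite ltr0n; near: m; exact: nbhs_infty_gt.
have l1 : 1 <= lnn m by near: m; exact: lnn_gt0_near.
have l0 : 0 < lnn m by lra.
rewrite /wid expr_div_n sqr_sqrtr ?ltW //; field.
by rewrite !gt_eqF.
Unshelve. all: end_near. Qed.

Lemma wid_gt0_near : \forall m \near \oo, 0 < wid m.
Proof.
near=> m; rewrite /wid divr_gt0 //; first by near: m; exact: sqrt_pos_near.
have : 1 <= lnn m by near: m; exact: lnn_gt0_near.
lra.
Unshelve. all: end_near. Qed.

(* Up to a constant, the probability of a three-dimensional window of width [wid]. *)
Definition nrm (m : nat) : R := (wid m * p0 R m) ^+ 3.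

Lemma nrm_gt0_near : \forall m \near \oo, 0 < nrm m.
Proof.
by apply: filterS wid_gt0_near => m h; rewrite exprn_gt0 // mulr_gt0 // p0_gt0.
Qed.

(** As [sqrt m * p0] has a positive limit, [nrm] is of order [(log m)^-3]: dividing by it costs
    three more logarithms. Every error term below is measured against this. *)
Lemma nrm_cvg0 k : (fun m => lnn m ^+ k / Num.sqrt m%:R / nrm m) @ \oo --> (0 : R).
Proof.
have [c [c0 hc _]] := p0_sqrt_cvg R.
have hi : (fun m => (Num.sqrt m%:R * p0 R m)^-1) @ \oo --> c^-1.
  by apply: cvgV; [rewrite gt_eqF|].
have := cvg_seqM (lnn_pow_sqrt (k + 3)) (cvg_seqM hi (cvg_seqM hi hi)).
rewrite mul0r; apply: cvg_near; near=> m.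
have s0 : 0 < Num.sqrt m%:R :> R by near: m; exact: sqrt_pos_near.
have l1 : 1 <= lnn m by near: m; exact: lnn_gt0_near.
have l0 : 0 < lnn m by lra.
have p := p0_gt0 R m.
by rewrite /nrm /wid exprD; field; rewrite !gt_eqF.
Unshelve. all: end_near. Qed.

Definition lat3win (m : nat) (a b c d e f s : R) : R :=
  lat m (fun k1 => (`|a * k1| <= s)%R%:R *
    lat m (fun k2 => (`|b * k1 + c * k2| <= s)%R%:R *
      lat m (fun k3 => (`|d * k1 + e * k2 + f * k3| <= s)%R%:R))).

Lemma lat3win_le m a b c d e f s : (0 < m)%N -> 0 < a -> 0 < c -> 0 < f -> 0 <= s ->
  lat3win m a b c d e f s <= (p0 R m * (2 * s / a + 1)) *
    (p0 R m * (2 * s / c + 1)) * (p0 R m * (2 * s / f + 1)).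
Proof.
move=> m0 a0 c0 f0 s0; have q0 := p0_gt0 R m.
have pos x : 0 < x -> 0 <= p0 R m * (2 * s / x + 1).
  move=> x0; apply: mulr_ge0; first exact: ltW.
  by apply: addr_ge0 => //; apply: divr_ge0; [exact: mulr_ge0|exact: ltW].
have i0 (t : bool) : 0 <= t%:R :> R by rewrite ler0n.
apply: (@le_trans _ _ (lat m (fun k1 => (`|0 + a * k1| <= s)%R%:R *
   (p0 R m * (2 * s / c + 1) * (p0 R m * (2 * s / f + 1)))))).
  apply: lat_mono => k1; rewrite add0r ler_wpM2l //.
  apply: (@le_trans _ _ (lat m (fun k2 => (`|b * k1 + c * k2| <= s)%R%:R *
     (p0 R m * (2 * s / f + 1))))).
    by apply: lat_mono => k2; rewrite ler_wpM2l //; apply: win_le.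
  by rewrite latZr ler_wpM2r ?pos //; apply: win_le.
rewrite latZr -[leRHS]mulrA; apply: ler_wpM2r; first by apply: mulr_ge0; exact: pos.
exact: win_le.
Qed.

(** The system is triangular, so the coordinates are bounded in turn by [s / a], then by
    [(s + |b| s / a) / c]. The hypotheses on [C] make [C * s] a valid [D] for [win_ge] in all three
    nested windows. *)
Lemma lat3win_ge m a b c d e f s C : (0 < m)%N -> 0 < a -> 0 < c -> 0 < f -> 0 <= s ->
  s <= a * (C * s) -> `|b| * (s / a) + s <= c * (C * s) ->
  `|d| * (s / a) + `|e| * ((s + `|b| * (s / a)) / c) + s <= f * (C * s) ->
  (C * s) ^+ 2 <= m%:R ->
  0 <= 2 * s / a - 1 -> 0 <= 2 * s / c - 1 -> 0 <= 2 * s / f - 1 ->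
  (p0 R m * (1 - (C * s) ^+ 2 / m%:R)) ^+ 3 *
    ((2 * s / a - 1) * (2 * s / c - 1) * (2 * s / f - 1)) <= lat3win m a b c d e f s.
Proof.
move=> m0 a0 c0 f0 s0 h1 h2 h3 Dm a1 c1 f1; set D := C * s in h1 h2 h3 Dm *.
have mR : 0 < m%:R :> R by rewrite ltr0n.
have q0 := p0_gt0 R m.
set P := p0 R m * _.
have D1 : 0 <= 1 - D ^+ 2 / m%:R by rewrite subr_ge0 ler_pdivrMr // mul1r.
have P0 : 0 <= P by apply: mulr_ge0; first exact: ltW.
have q1 := ltW q0.
have i0 (t : bool) : 0 <= t%:R :> R by rewrite ler0n.
have -> : P ^+ 3 * ((2 * s / a - 1) * (2 * s / c - 1) * (2 * s / f - 1))
  = (P * (2 * s / a - 1)) * ((P * (2 * s / c - 1)) * (P * (2 * s / f - 1))) by ring.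
apply: (@le_trans _ _ (lat m (fun k1 => (`|0 + a * k1| <= s)%R%:R *
   (P * (2 * s / c - 1) * (P * (2 * s / f - 1)))))).
  rewrite latZr ler_wpM2r ?mulr_ge0 //; apply: (@win_ge _ m 0 a s D) => //.
  by rewrite normr0 add0r.
apply: lat_mono => k1; rewrite add0r.
case: (leP `|a * k1| s) => hk1; last by rewrite !mul0r.
rewrite !mul1r.
have {}hk1 : `|k1| <= s / a by rewrite ler_pdivlMr // mulrC -(gtr0_norm a0) -normrM.
have M x y : `|y| <= x -> forall z : R, `|z * y| <= `|z| * x.
  by move=> yx z; rewrite normrM ler_wpM2l.
apply: (@le_trans _ _ (lat m (fun k2 => (`|b * k1 + c * k2| <= s)%R%:R *
     (P * (2 * s / f - 1))))).
  rewrite latZr ler_wpM2r ?mulr_ge0 //; apply: (@win_ge _ m (b * k1) c s D) => //.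
  by apply: le_trans h2; rewrite lerD2r; exact: M.
apply: lat_mono => k2.
case: (leP `|b * k1 + c * k2| s) => hk2; last by rewrite !mul0r.
rewrite !mul1r.
have {}hk2 : `|k2| <= (s + `|b| * (s / a)) / c.
  rewrite ler_pdivlMr // mulrC -{1}(gtr0_norm c0) -normrM.
  have -> : c * k2 = (b * k1 + c * k2) - b * k1 by ring.
  by apply: (le_trans (ler_normB _ _)); apply: lerD => //; exact: M.
apply: (@win_ge _ m (d * k1 + e * k2) f s D) => //; apply: le_trans h3; rewrite lerD2r.
by apply: (le_trans (ler_normD _ _)); apply: lerD; exact: M.
Qed.

(** The limit is the volume [8 t^3 / (a c f)] of a parallelepiped. Counting errors vanish because
    [wid] tends to infinity, and the mass is flat on the window because [wid ^+ 2 / m] tends to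
    0. *)
Lemma lat3win_cvg a b c d e f t : 0 < a -> 0 < c -> 0 < f -> 0 < t ->
  (fun m => lat3win m a b c d e f (t * wid m) / nrm m) @ \oo -->
    8 / (a * c * f) * t ^+ 3.
Proof.
move=> a0 c0 f0 t0.
have i (x : R) : (fun m => 2 * t / x + (wid m)^-1) @ \oo --> 2 * t / x + 0.
  by apply: cvg_seqD wid_inv0; exact: cvg_seq_cst.
have j (x : R) : (fun m => 2 * t / x + -1 * (wid m)^-1) @ \oo --> 2 * t / x + -1 * 0.
  by apply: cvg_seqD; [exact: cvg_seq_cst|exact: cvg_seqZ wid_inv0].
(* Sum of the values required by the three nested windows, so that one constant serves them all. *)
pose C := a^-1 + (`|b| / a + 1) / c + (`|d| / a + `|e| * ((1 + `|b| / a) / c) + 1) / f.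
have n0 := @normr_ge0 R R.
have Ca : [/\ 1 <= a * C, `|b| / a + 1 <= c * C &
     `|d| / a + `|e| * ((1 + `|b| / a) / c) + 1 <= f * C].
  have x1 : 0 <= a^-1 by rewrite invr_ge0 ltW.
  have x2 : 0 <= (`|b| / a + 1) / c.
    apply: divr_ge0 (ltW c0); apply: addr_ge0 => //; exact: divr_ge0 (n0 b) (ltW a0).
  have x3 : 0 <= (`|d| / a + `|e| * ((1 + `|b| / a) / c) + 1) / f.
    have y1 : 0 <= `|b| / a by exact: divr_ge0 (n0 b) (ltW a0).
    apply: divr_ge0 (ltW f0); apply: addr_ge0 => //; apply: addr_ge0.
      exact: divr_ge0 (n0 d) (ltW a0).
    by apply: mulr_ge0 => //; apply: divr_ge0 (ltW c0); apply: addr_ge0.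
  rewrite /C; split.
  - by rewrite [leRHS]mulrC -ler_pdivrMr // div1r; lra.
  - by rewrite [leRHS]mulrC -ler_pdivrMr //; lra.
  - by rewrite [leRHS]mulrC -ler_pdivrMr //; lra.
have k : (fun m => 1 + - (C * t) ^+ 2 * (wid m ^+ 2 / m%:R)) @ \oo --> 1 + - (C * t) ^+ 2 * 0.
  by apply: cvg_seqD; [exact: cvg_seq_cst|exact: cvg_seqZ wid_sq].
have up := cvg_seqM (cvg_seqM (i a) (i c)) (i f).
have lo := cvg_seqM (cvg_seqM k (cvg_seqM k k)) (cvg_seqM (cvg_seqM (j a) (j c)) (j f)).
have eup : (2 * t / a + 0) * (2 * t / c + 0) * (2 * t / f + 0) = 8 / (a * c * f) * t ^+ 3.
  by field; rewrite !gt_eqF.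
rewrite eup in up.
have elo : (1 + - (C * t) ^+ 2 * 0) * ((1 + - (C * t) ^+ 2 * 0) * (1 + - (C * t) ^+ 2 * 0)) *
  ((2 * t / a + -1 * 0) * (2 * t / c + -1 * 0) * (2 * t / f + -1 * 0)) = 8 / (a * c * f) * t ^+ 3.
  by field; rewrite !gt_eqF.
rewrite elo in lo.
have cd : (fun m => (C * t) ^+ 2 * (wid m ^+ 2 / m%:R)) @ \oo --> (C * t) ^+ 2 * 0.
  exact: cvg_seqZ wid_sq.
rewrite mulr0 in cd.
have bigw (x : R) : 0 < x -> \forall m \near \oo, (wid m)^-1 <= x.
  move=> x0; move/cvgrPdist_le: wid_inv0 => /(_ x x0); apply: filterS => m.
  by rewrite sub0r normrN; apply: le_trans; exact: ler_norm.
have tx x : 0 < x -> 0 < 2 * t / x by move=> x0; rewrite divr_gt0 // mulr_gt0.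
apply/cvg_lesim; split.
  move/cvg_lesim: up => [up _]; apply: lesim_trans up; apply: lesim_near; near=> m.
  have w0 : 0 < wid m by near: m; exact: wid_gt0_near.
  have m0 : (0 < m)%N by near: m; exact: nbhs_infty_gt.
  have q0 := p0_gt0 R m.
  have nr0 : 0 < nrm m by rewrite exprn_gt0 // mulr_gt0.
  rewrite ler_pdivrMr //; apply: (le_trans (lat3win_le _ _ _ m0 a0 c0 f0 _)).
    by rewrite mulr_ge0 // ltW.
  rewrite le_eqVlt; apply/orP; left; apply/eqP.
  by rewrite /nrm; field; rewrite !gt_eqF.
move/cvg_lesim: lo => [_ lo]; apply: (lesim_trans lo); apply: lesim_near; near=> m.
have w0 : 0 < wid m by near: m; exact: wid_gt0_near.
have m0 : (0 < m)%N by near: m; exact: nbhs_infty_gt.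
have mR : 0 < m%:R :> R by rewrite ltr0n.
have q0 := p0_gt0 R m.
have nr0 : 0 < nrm m by rewrite exprn_gt0 // mulr_gt0.
have s0 : 0 < t * wid m by rewrite mulr_gt0.
have wa x : 0 < x -> (wid m)^-1 <= 2 * t / x -> 0 <= 2 * (t * wid m) / x - 1.
  move=> x0; rewrite -(ler_pM2r w0) mulVf ?gt_eqF // => h.
  by rewrite subr_ge0; apply: (le_trans h); rewrite mulrAC mulrA.
rewrite ler_pdivlMr //; apply: le_trans (lat3win_ge (C := C) m0 a0 c0 f0 (ltW s0) _ _ _ _ _ _ _).
- rewrite le_eqVlt; apply/orP; left; apply/eqP.
  by rewrite /nrm; field; rewrite !gt_eqF.
- by rewrite mulrA; apply: ler_peMl; [exact: ltW|case: Ca].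
- have [_ h _] := Ca; have := ler_wpM2r (ltW s0) h.
  rewrite -[c * C * _]mulrA; apply: le_trans.
  by rewrite le_eqVlt; apply/orP; left; apply/eqP; field; rewrite !gt_eqF.
- have [_ _ h] := Ca; have := ler_wpM2r (ltW s0) h.
  rewrite -[f * C * _]mulrA; apply: le_trans.
  by rewrite le_eqVlt; apply/orP; left; apply/eqP; field; rewrite !gt_eqF.
- have : (C * t) ^+ 2 * (wid m ^+ 2 / m%:R) <= 1.
    near: m; move/cvgrPdist_le: cd => /(_ 1 ltr01); apply: filterS => m'.
    by rewrite sub0r normrN; apply: le_trans; exact: ler_norm.
  move=> h; rewrite mulrA ler_pdivrMr // mul1r in h; apply: le_trans h.
  by rewrite le_eqVlt; apply/orP; left; apply/eqP; ring.
- by apply: wa => //; near: m; apply: bigw; exact: tx.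
- by apply: wa => //; near: m; apply: bigw; exact: tx.
- by apply: wa => //; near: m; apply: bigw; exact: tx.
Unshelve. all: end_near. Qed.

End Window.

(** * Joint law of windows and signs *)

Section Transfer.
Context (R : realType).

Lemma mean_walk (V : zmodType) (T : finType) m (X : T -> V) phi :
  uwalk m X phi 0 = mean (R := R) (fun w : {ffun 'I_m -> T} => phi (\sum_i X (w i))).
Proof.
rewrite /uwalk walk_ffun; apply: eq_bigr => w _; rewrite add0r; congr (_ * _).
by rewrite prodr_const card_ord /unif card_ffun card_ord natrX exprVn.
Qed.

Lemma mean_mono (T : finType) (f g : T -> R) : (forall t, f t <= g t) -> mean f <= mean g.
Proof. by move=> h; apply: ler_sum => t _; rewrite ler_wpM2l // invr_ge0. Qed.

Lemma mean_norm (T : finType) (f : T -> R) : `|mean f| <= mean (fun t => `|f t|).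
Proof.
apply: (le_trans (ler_norm_sum _ _ _)); apply: ler_sum => t _.
by rewrite normrM ger0_norm // invr_ge0.
Qed.

Lemma meanB (T : finType) (f g : T -> R) :
  mean (fun t => f t - g t) = mean f - mean g.
Proof. by rewrite /mean -sumrB; apply: eq_bigr => t _ /=; rewrite mulrBr. Qed.

Definition crd (i : 'I_5) (z : 'rV[R]_5) : R := z 0 i.

Lemma crdD i z h : crd i (z + h) = crd i z + crd i h.
Proof. by rewrite /crd mxE. Qed.

(** Coordinates 0 to 2 are measured in window widths and coordinates 3 and 4 in units of [sqrt m];
    one test function with fixed smoothness constant then serves every [m]. *)
Definition sc (m : nat) (i : 'I_5) : R :=
  if (i < 3)%N then (wid R m)^-1 else (Num.sqrt m%:R)^-1.

Definition stat (T : finType) (Z : 'I_5 -> T -> R) m (w : {ffun 'I_m -> T}) : 'rV[R]_5 :=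
  \row_i (sc m i * \sum_j Z i (w j)).

Definition lat5 m (g : R -> R -> R -> R -> R -> R) : R :=
  lat m (fun k1 => lat m (fun k2 => lat m (fun k3 => lat m (fun k4 => lat m (g k1 k2 k3 k4))))).

Definition cvec (E : 'I_5 -> 'I_5 -> R) m (k1 k2 k3 k4 k5 : R) : 'rV[R]_5 :=
  \row_i (sc m i * (k1 * E (inord 0) i + k2 * E (inord 1) i + k3 * E (inord 2) i
     + k4 * E (inord 3) i + k5 * E (inord 4) i)).

Let bb := (bool * bool)%type.

Lemma mean5 (c c' : 'I_5 -> R) :
  let y (c : 'I_5 -> R) (t : bb * bb * bb * bb * bb) :=
     xi R t.1.1.1.1 * c (inord 0) + xi R t.1.1.1.2 * c (inord 1) + xi R t.1.1.2 * c (inord 2)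
     + xi R t.1.2 * c (inord 3) + xi R t.2 * c (inord 4) in
  mean (y c) = 0 /\
  mean (fun t => y c t * y c' t) = (\sum_n c n * c' n) / 2.
Proof.
pose t0 := (true, true).
have Z1 (T : finType) (s : T) (f : T -> R) x : mean f = 0 ->
   mean (fun t : T * bb => f t.1 + xi R t.2 * x) = 0.
  move=> f0; rewrite meanD (mean_fst t0) f0 (mean_snd s (fun t => xi R t * x)).
  by rewrite mean_xi addr0.
pose y1 (c : 'I_5 -> R) (t : bb) := xi R t * c (inord 0).
pose y2 (c : 'I_5 -> R) (t : bb * bb) := y1 c t.1 + xi R t.2 * c (inord 1).
pose y3 (c : 'I_5 -> R) (t : bb * bb * bb) := y2 c t.1 + xi R t.2 * c (inord 2).
pose y4 (c : 'I_5 -> R) (t : bb * bb * bb * bb) := y3 c t.1 + xi R t.2 * c (inord 3).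
have m1 e : mean (y1 e) = 0 by exact: mean_xi.
have m2 e : mean (y2 e) = 0 by apply: (Z1 _ t0).
have m3 e : mean (y3 e) = 0 by apply: (Z1 _ (t0, t0)).
have m4 e : mean (y4 e) = 0 by apply: (Z1 _ (t0, t0, t0)).
split; first by apply: (Z1 _ (t0, t0, t0, t0) (y4 c)).
have step (T : finType) (s : T) (f f' : T -> R) x x' q : mean f = 0 -> mean f' = 0 ->
   mean (fun t => f t * f' t) = q / 2 ->
   mean (fun t : T * bb => (f t.1 + xi R t.2 * x) * (f' t.1 + xi R t.2 * x')) = (q + x * x') / 2.
  move=> f0 f0' fq.
  rewrite (mean_pair2 s t0 (fun t => xi R t * x) (fun t => xi R t * x')) // fq mean_xi2.
  by field.
have e1 := mean_xi2 (c (inord 0)) (c' (inord 0)).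
have e2 := step _ t0 (y1 c) (y1 c') (c (inord 1)) (c' (inord 1)) _ (m1 c) (m1 c') e1.
have e3 := step _ (t0, t0) (y2 c) (y2 c') (c (inord 2)) (c' (inord 2)) _ (m2 c) (m2 c') e2.
have e4 := step _ (t0, t0, t0) (y3 c) (y3 c') (c (inord 3)) (c' (inord 3)) _ (m3 c) (m3 c') e3.
have e5 := step _ (t0, t0, t0, t0) (y4 c) (y4 c') (c (inord 4)) (c' (inord 4)) _ (m4 c) (m4 c') e4.
rewrite e5; congr (_ / 2); rewrite !big_ord_recl big_ord0 addr0 !addrA.
have -> : ord0 = inord 0 :> 'I_5 by apply: val_inj; rewrite /= inordK.
have -> : lift (inord 0) ord0 = inord 1 :> 'I_5 by apply: val_inj; rewrite /= !inordK.
have -> : lift (inord 0) (lift ord0 ord0) = inord 2 :> 'I_5 by apply: val_inj; rewrite /= !inordK.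
have -> : lift (inord 0) (lift ord0 (lift ord0 ord0)) = inord 3 :> 'I_5 by apply: val_inj; rewrite /= !inordK.
have -> // : lift (inord 0) (lift ord0 (lift ord0 (lift ord0 ord0))) = inord 4 :> 'I_5 by apply: val_inj; rewrite /= !inordK.
Qed.

Lemma lat5_walk E m phi : lat5 m (fun k1 k2 k3 k4 k5 => phi (cvec E m k1 k2 k3 k4 k5)) =
  uwalk m (fun t : bb * bb * bb * bb * bb =>
     xi R t.1.1.1.1 *: (\row_i (sc m i * E (inord 0) i)) +
     xi R t.1.1.1.2 *: (\row_i (sc m i * E (inord 1) i)) +
     xi R t.1.1.2 *: (\row_i (sc m i * E (inord 2) i)) +
     xi R t.1.2 *: (\row_i (sc m i * E (inord 3) i)) +
     xi R t.2 *: (\row_i (sc m i * E (inord 4) i))) phi 0.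
Proof.
pose e n : 'rV[R]_5 := \row_i (sc m i * E (inord n) i).
pose x n (t : bb) := xi R t *: e n.
rewrite (uwalk_pair m (fun t : bb * bb * bb * bb => x 0%N t.1.1.1 + x 1%N t.1.1.2 + x 2%N t.1.2 + x 3%N t.2) (x 4%N)).
rewrite (uwalk_pair m (fun t : bb * bb * bb => x 0%N t.1.1 + x 1%N t.1.2 + x 2%N t.2) (x 3%N)).
rewrite (uwalk_pair m (fun t : bb * bb => x 0%N t.1 + x 1%N t.2) (x 2%N)).
rewrite (uwalk_pair m (x 0%N) (x 1%N)).
rewrite walk_lat; apply: eq_lat => k1; rewrite walk_lat; apply: eq_lat => k2.
rewrite walk_lat; apply: eq_lat => k3; rewrite walk_lat; apply: eq_lat => k4.
rewrite walk_lat; apply: eq_lat => k5; congr (phi _).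
by apply/rowP => i; rewrite !mxE; ring.
Qed.

Lemma wid_inv_near (x : R) : 0 < x -> \forall m \near \oo, (wid R m)^-1 <= x.
Proof.
move=> x0; move/cvgrPdist_le: (@wid_inv0 R) => /(_ x x0); apply: filterS => m.
by rewrite sub0r normrN; apply: le_trans; exact: ler_norm.
Qed.

(** Increments are at most [C' / wid], so the replacement costs [2 * K * m * (C' / wid) ^+ 3], that
    is a constant times [(log m)^3 / sqrt m], still negligible after division by [nrm]. The factor
    1/2 in the covariances is the variance of [xi]. *)
Lemma transfer (T : finType) (t0 : T) (Z E : _) (C : R) phi :
  smooth crd phi -> (forall i (t : T), `|Z i t| <= C) -> (forall i, mean (Z i) = 0) ->
  (forall i j, mean (fun t => Z i t * Z j t) = (\sum_n E n i * E n j) / 2) ->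
  (fun m => (mean (fun w : {ffun 'I_m -> T} => phi (stat Z w)) -
     lat5 m (fun k1 k2 k3 k4 k5 => phi (cvec E m k1 k2 k3 k4 k5))) / nrm R m) @ \oo --> (0 : R).
Proof.
move=> [K K0 hK] ZC Z0 ZE.
pose C' := 1 + `|C| + \sum_n \sum_i `|E n i|.
have sE : 0 <= \sum_n \sum_i `|E n i|.
  by apply: sumr_ge0 => n _; apply: sumr_ge0.
have C0 : 0 < C' by rewrite /C'; have := normr_ge0 C; lra.
have h := cvg_seqZ (c := 2 * K * C' ^+ 3) (@nrm_cvg0 R 3); rewrite mulr0 in h.
apply/cvg0_lesim; apply: squeeze0 h; near=> m.
have m0 : 0 < m%:R :> R by rewrite ltr0n; near: m; exact: nbhs_infty_gt.
have s0 : 0 < Num.sqrt m%:R :> R by rewrite sqrtr_gt0.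
have l1 : 1 <= lnn R m by near: m; exact: lnn_gt0_near.
have w0 : 0 < wid R m by near: m; exact: wid_gt0_near.
have n0 : 0 < nrm R m by near: m; exact: nrm_gt0_near.
have wC : (wid R m)^-1 <= C'^-1 by near: m; apply: wid_inv_near; rewrite invr_gt0.
rewrite normr_ge0 /= normrM normfV (gtr0_norm n0) mulrA ler_pM2r ?invr_gt0 //.
pose N := C' / wid R m.
have -> : 2 * K * C' ^+ 3 * (lnn R m ^+ 3 / Num.sqrt m%:R) = m%:R * (2 * K * N ^+ 3).
  have e : m%:R = Num.sqrt m%:R ^+ 2 :> R by rewrite sqr_sqrtr // ltW.
  have l0 : 0 < lnn R m by lra.
  by rewrite {2}e /N /wid; field; rewrite !gt_eqF.
have sc0 i : 0 <= sc m i by rewrite /sc; case: ifP; rewrite invr_ge0 // ltW.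
have scw i : sc m i <= (wid R m)^-1.
  rewrite /sc; case: ifP => // _; rewrite lef_pV2 ?posrE //.
  by rewrite /wid ler_pdivrMr; [rewrite ler_peMr // ltW|lra].
have -> : mean (fun w : {ffun 'I_m -> T} => phi (stat Z w))
   = uwalk m (fun t => \row_i (sc m i * Z i t)) phi 0.
  rewrite mean_walk; apply: eq_mean => w; congr (phi _).
  apply/rowP => i; rewrite /stat mxE summxE mulr_sumr.
  by apply: eq_bigr => j _; rewrite mxE.
rewrite lat5_walk.
pose y (i : 'I_5) (t : bb * bb * bb * bb * bb) : R :=
     xi R t.1.1.1.1 * E (inord 0) i + xi R t.1.1.1.2 * E (inord 1) i + xi R t.1.1.2 * E (inord 2) i
     + xi R t.1.2 * E (inord 3) i + xi R t.2 * E (inord 4) i.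
set Y := (X in _ - uwalk m X _ _).
have Yc i t : crd i (Y t) = sc m i * y i t by rewrite /crd /Y !mxE /y; ring.
have Xc i t : crd i (\row_i (sc m i * Z i t)) = sc m i * Z i t by rewrite /crd mxE.
have bd i (x : R) : `|x| <= C' -> `|sc m i * x| <= N.
  move=> xC; rewrite normrM ger0_norm // /N mulrC.
  by apply: ler_pM.
have y_le i t : `|y i t| <= \sum_n `|E n i|.
  rewrite !big_ord_recl big_ord0 addr0 !addrA.
  have -> : ord0 = inord 0 :> 'I_5 by apply: val_inj; rewrite /= inordK.
  have -> : lift (inord 0) ord0 = inord 1 :> 'I_5 by apply: val_inj; rewrite /= !inordK.
  have -> : lift (inord 0) (lift ord0 ord0) = inord 2 :> 'I_5 by apply: val_inj; rewrite /= !inordK.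
  have -> : lift (inord 0) (lift ord0 (lift ord0 ord0)) = inord 3 :> 'I_5 by apply: val_inj; rewrite /= !inordK.
  have -> : lift (inord 0) (lift ord0 (lift ord0 (lift ord0 ord0))) = inord 4 :> 'I_5 by apply: val_inj; rewrite /= !inordK.
  have b t' x : `|xi R t' * x| <= `|x| by rewrite normrM ler_piMl // xi_norm.
  rewrite /y; do 4 (apply: (le_trans (ler_normD _ _)); apply: lerD => //).
have tt := (true, true).
refine (@lindeberg_unif R _ 5 crd phi K T _ t0 (tt, tt, tt, tt, tt) _ Y N m 0 hK _ _ _ _ _).
- apply/andP; split; first by rewrite divr_ge0 // ltW.
  by rewrite /N -(mulfV (_ : C' != 0)) ?gt_eqF // ler_pM2l.
- move=> t i; rewrite Xc; apply: bd; apply: (le_trans (ZC i t)).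
  by rewrite /C'; have := ler_norm C; lra.
- move=> t i; rewrite Yc; apply: bd; apply: (le_trans (y_le i t)).
  apply: (@le_trans _ _ (\sum_n \sum_i `|E n i|)); last by rewrite /C'; have := normr_ge0 C; lra.
  apply: ler_sum => n _; rewrite (bigD1 i) //= lerDl; exact: sumr_ge0.
- move=> i; rewrite (eq_mean (Xc i)) (eq_mean (Yc i)) !meanZ Z0.
  by have [-> _] := mean5 (fun n => E n i) (fun n => E n i).
- move=> i j.
  transitivity (mean (fun t => sc m i * sc m j * (Z i t * Z j t))).
    by apply: eq_mean => t; rewrite !Xc; ring.
  transitivity (mean (fun t => sc m i * sc m j * (y i t * y j t))); last first.
    by apply: eq_mean => t; rewrite !Yc; ring.
  rewrite !meanZ ZE; congr (_ * _).
  by have [_ <-] := mean5 (fun n => E n i) (fun n => E n j).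
Unshelve. all: end_near. Qed.

End Transfer.

Section Joint.
Context (R : realType).

Lemma lesim_norm (u : nat -> R) (c : R) : lesim u (fun=> c) -> lesim (fun m => - u m) (fun=> c) ->
  lesim (fun m => `|u m|) (fun=> c).
Proof.
move=> h1 h2 e e0; near=> m.
have : u m <= c + e by near: m; exact: h1.
have : - u m <= c + e by near: m; exact: h2.
by rewrite ler_norml; lra.
Unshelve. all: end_near. Qed.

Lemma cvg_norm0 (u : nat -> R) : u @ \oo --> (0 : R) -> (fun m => `|u m|) @ \oo --> (0 : R).
Proof. by move=> h; rewrite -(normr0 R); apply: cvg_norm. Qed.

Definition coords (T : Type) (B0 B1 B2 P Q : T -> R) (i : 'I_5) : T -> R :=
  match val i with 0%N => B0 | 1%N => B1 | 2%N => B2 | 3%N => P | _ => Q end.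

(* Row [n] lists the coefficients of the [n]-th walk in the five coordinates: a
   Cholesky factor for the three windows, and two vectors at angle [th] for the
   two signs. *)
Definition gens (a b c d e f g th : R) (n i : 'I_5) : R :=
  nth 0 (nth [::] [:: [:: a; b; d; 0; 0]; [:: 0; c; e; 0; 0]; [:: 0; 0; f; 0; 0];
     [:: 0; 0; 0; g; g * cos th]; [:: 0; 0; 0; 0; g * sin th]] n) i.

Definition o5 (n : nat) : 'I_5 := inord n.

Definition testf (t eta : R) (G : R -> R -> R) (z : 'rV[R]_5) : R :=
  bump t eta (crd (o5 0) z) * bump t eta (crd (o5 1) z) * bump t eta (crd (o5 2) z)
  * G (crd (o5 3) z) (crd (o5 4) z).

Context (T : finType) (t0 : T) (B : 'I_3 -> T -> R) (P Q : T -> R).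
Context (a b c d e f g th C : R).
Context (a0 : 0 < a) (c0 : 0 < c) (f0 : 0 < f) (g0 : 0 < g) (thp : 0 < th < pi).

Let i0 : 'I_3 := inord 0.
Let i1 : 'I_3 := inord 1.
Let i2 : 'I_3 := inord 2.
Let Z := coords (B i0) (B i1) (B i2) P Q.
Let E := gens a b c d e f g th.
Context (ZC : forall i t, `|Z i t| <= C).
Context (Z0 : forall i, mean (Z i) = 0).
Context (ZE : forall i j, mean (fun t => Z i t * Z j t) = (\sum_n E n i * E n j) / 2).

Definition tot (F : T -> R) m (w : {ffun 'I_m -> T}) : R := \sum_j F (w j).

Definition inwin (t : R) m (w : {ffun 'I_m -> T}) : bool :=
  [forall k, `|tot (B k) w| <= t * wid R m].

Let s m : R := Num.sqrt m%:R.

Lemma crd_stat (n : nat) m (w : {ffun 'I_m -> T}) : (n < 5)%N -> crd (o5 n) (stat Z w) =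
  match n with 0%N => tot (B i0) w / wid R m | 1%N => tot (B i1) w / wid R m
   | 2%N => tot (B i2) w / wid R m | 3%N => tot P w / s m | _ => tot Q w / s m end.
Proof.
rewrite /crd /stat mxE /sc /Z /coords /o5 /=.
by case: n => [|[|[|[|[|n]]]]] // _; rewrite inordK //= mulrC.
Qed.

Lemma crd_cvec (n : nat) m k1 k2 k3 k4 k5 : (n < 5)%N -> crd (o5 n) (cvec E m k1 k2 k3 k4 k5) =
  match n with 0%N => a * k1 / wid R m | 1%N => (b * k1 + c * k2) / wid R m
   | 2%N => (d * k1 + e * k2 + f * k3) / wid R m
   | 3%N => g * proj 0 k4 k5 / s m | _ => g * proj th k4 k5 / s m end.
Proof.
rewrite /crd /cvec mxE /sc /E /gens /o5 /proj cos0 sin0.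
by case: n => [|[|[|[|[|n]]]]] // _; rewrite !inordK //=; ring.
Qed.

Definition latBox m t eta : R :=
  lat m (fun k1 => bump t eta (a * k1 / wid R m) *
    lat m (fun k2 => bump t eta ((b * k1 + c * k2) / wid R m) *
      lat m (fun k3 => bump t eta ((d * k1 + e * k2 + f * k3) / wid R m)))).

Definition latG m (G : R -> R -> R) : R :=
  lat2 m (fun k4 k5 => G (g * proj 0 k4 k5 / s m) (g * proj th k4 k5 / s m)).

(** The matrix [gens] is block diagonal: in the walk model windows and signs are exactly
    independent, which is what uncorrelated remainders buy. *)
Lemma lat5_split m t eta G :
  lat5 m (fun k1 k2 k3 k4 k5 => testf t eta G (cvec E m k1 k2 k3 k4 k5))
  = latBox m t eta * latG m G.
Proof.
rewrite /lat5 /latBox -latZr; apply: eq_lat => k1; cbv beta.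
rewrite -[in RHS]mulrA -latZr -latZ; apply: eq_lat => k2; cbv beta.
rewrite -[in RHS](mulrA (bump _ _ _)) -latZr -!latZ; apply: eq_lat => k3; cbv beta.
rewrite /latG /lat2 -!latZ; apply: eq_lat => k4; cbv beta.
rewrite -!latZ; apply: eq_lat => k5; cbv beta.
by rewrite /testf !crd_cvec // !mulrA.
Qed.

Lemma latBox_bounds m t eta : 0 < wid R m -> 0 < eta ->
  lat3win m a b c d e f (t * wid R m) <= latBox m t eta <=
  lat3win m a b c d e f ((t + eta) * wid R m).
Proof.
move=> w0 e0.
have E1 (u x : R) : (`|u / wid R m| <= x)%R = (`|u| <= x * wid R m)%R.
  by rewrite normrM normfV (gtr0_norm w0) ler_pdivrMr.
have l u x : (`|u| <= x * wid R m)%R%:R <= bump x eta (u / wid R m).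
  by rewrite -E1; exact: bump_ge.
have r u x : bump x eta (u / wid R m) <= (`|u| <= (x + eta) * wid R m)%R%:R.
  by rewrite -E1; exact: bump_le.
have p x u : 0 <= bump x eta u by have /andP[] := bump01 x eta u.
have lp g1 : (forall k, 0 <= g1 k) -> 0 <= lat m g1 by exact: lat_ge0.
apply/andP; split.
  apply: lat_mono => k1; apply: ler_pM; rewrite ?ler0n //.
    by apply: (lp) => k2; rewrite mulr_ge0 // lp.
  apply: lat_mono => k2; apply: ler_pM; rewrite ?ler0n //; first exact: lp.
  by apply: lat_mono => k3.
apply: lat_mono => k1; apply: ler_pM; rewrite ?ler0n //.
  by apply: (lp) => k2; rewrite mulr_ge0 // lp.
apply: lat_mono => k2; apply: ler_pM; rewrite ?ler0n //; first exact: lp.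
by apply: lat_mono => k3.
Qed.

Let kap : R := 8 / (a * c * f).

Lemma kap_gt0 : 0 < kap.
Proof. by rewrite /kap divr_gt0 // !mulr_gt0. Qed.

Let D t m : R := mean (fun w : {ffun 'I_m -> T} => (inwin t w)%:R).

Let A t eta G m : R := mean (fun w : {ffun 'I_m -> T} => testf t eta G (stat Z w)).

Lemma A_transfer t eta G : smooth (@crd R) (fun z : 'rV[R]_5 => G (crd (o5 3) z) (crd (o5 4) z)) ->
  (fun m => (A t eta G m - latBox m t eta * latG m G) / nrm R m) @ \oo --> (0 : R).
Proof.
move=> sG; have sphi : smooth (@crd R) (testf t eta G).
  apply: smooth_mul sG; apply: smooth_mul; [apply: smooth_mul|];
  by apply: smooth_bump => x y; exact: crdD.
have := transfer t0 sphi ZC Z0 ZE.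
by apply: eq_cvg_seq => m; rewrite lat5_split.
Qed.

Lemma inwin_nat t m (w : {ffun 'I_m -> T}) : (inwin t w)%:R =
  (`|tot (B i0) w| <= t * wid R m)%R%:R * (`|tot (B i1) w| <= t * wid R m)%R%:R
   * (`|tot (B i2) w| <= t * wid R m)%R%:R :> R.
Proof.
rewrite -!natrM !mulnb; congr ((nat_of_bool _)%:R).
have ei (k : 'I_3) : [\/ k = i0, k = i1 | k = i2].
  case: k => [[|[|[|k]]] hk]; [apply: Or31|apply: Or32|apply: Or33|by []];
    by apply: val_inj; rewrite /= inordK.
apply/idP/idP => [/forallP h|/andP[/andP[h0 h1] h2]]; first by rewrite !h.
by apply/forallP => k; case: (ei k) => ->.
Qed.

Lemma testf_inwin t eta m (w : {ffun 'I_m -> T}) : 0 < wid R m -> 0 < eta ->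
  (inwin t w)%:R <= testf t eta (fun _ _ => 1) (stat Z w) <= (inwin (t + eta) w)%:R.
Proof.
move=> w0 e0.
have E1 (u x : R) : (`|u / wid R m| <= x)%R = (`|u| <= x * wid R m)%R.
  by rewrite normrM normfV (gtr0_norm w0) ler_pdivrMr.
have l u x : (`|u| <= x * wid R m)%R%:R <= bump x eta (u / wid R m).
  by rewrite -E1; exact: bump_ge.
have r u x : bump x eta (u / wid R m) <= (`|u| <= (x + eta) * wid R m)%R%:R.
  by rewrite -E1; exact: bump_le.
have p x u : 0 <= bump x eta u by have /andP[] := bump01 x eta u.
rewrite !inwin_nat /testf mulr1 !crd_stat //.
have pp x u v : 0 <= bump x eta u * bump x eta v by apply: mulr_ge0; exact: p.
have ii (x y : bool) : 0 <= x%:R * y%:R :> R by apply: mulr_ge0; rewrite ler0n.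
by apply/andP; split; apply: ler_pM; rewrite ?pp ?ii ?ler0n ?p ?l ?r //;
  apply: ler_pM; rewrite ?ler0n ?p ?l ?r.
Qed.

Lemma latG1 m : latG m (fun _ _ => 1) = 1.
Proof. exact: lat2_cst. Qed.

Lemma latBox_lesim t eta : 0 < t -> 0 < eta ->
  lesim (fun m => latBox m t eta / nrm R m) (fun=> kap * (t + eta) ^+ 3) /\
  lesim (fun=> kap * t ^+ 3) (fun m => latBox m t eta / nrm R m).
Proof.
move=> t_0 e0; split.
  have /cvg_lesim[h _] := lat3win_cvg b d e a0 c0 f0 (addr_gt0 t_0 e0).
  apply: lesim_trans h; apply: lesim_near; near=> m.
  have w0 : 0 < wid R m by near: m; exact: wid_gt0_near.
  have n0 : 0 < nrm R m by near: m; exact: nrm_gt0_near.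
  by rewrite ler_pM2r ?invr_gt0 //; have /andP[] := latBox_bounds t w0 e0.
have /cvg_lesim[_ h] := lat3win_cvg b d e a0 c0 f0 t_0.
apply: (lesim_trans h); apply: lesim_near; near=> m.
have w0 : 0 < wid R m by near: m; exact: wid_gt0_near.
have n0 : 0 < nrm R m by near: m; exact: nrm_gt0_near.
by rewrite ler_pM2r ?invr_gt0 //; have /andP[] := latBox_bounds t w0 e0.
Unshelve. all: end_near. Qed.

Lemma A1_transfer t eta :
  (fun m => A t eta (fun _ _ => 1) m / nrm R m - latBox m t eta / nrm R m) @ \oo --> (0 : R).
Proof.
have := @A_transfer t eta (fun _ _ => 1) (smooth_cst _ 1).
by apply: eq_cvg_seq => m; rewrite latG1 mulr1 mulrBl.
Qed.

(** The hard window lies between soft windows of half-widths [t - t * eta / 2] and [t], each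
    smoothed over [t * eta / 2]; their limits differ by a multiple of [eta]. *)
Lemma D_cvg t : 0 < t -> (fun m => D t m / nrm R m) @ \oo --> kap * t ^+ 3.
Proof.
move=> t_0; have k0 := kap_gt0.
have t3 : 0 < t ^+ 3 by rewrite exprn_gt0.
apply/cvg_lesim; split; apply: (@lesim_param _ _ _ (kap * t ^+ 3 * 3)) => eta /andP[e0 e1].
  (* A smoothing width relative to [t] keeps the inner window nondegenerate, and
     [(1 + eta / 2)^3 <= 1 + 3 * eta] explains the factor 3. *)
  have te0 : 0 < t * eta / 2 by rewrite divr_gt0 // mulr_gt0.
  have [h1 _] := latBox_lesim t_0 te0.
  have /cvg_lesim[h2 _] := A1_transfer t (t * eta / 2).
  have h3 := lesimD h2 h1.
  apply: (lesim_trans _ (lesim_trans h3 _)).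
    apply: lesim_near; near=> m.
    have w0 : 0 < wid R m by near: m; exact: wid_gt0_near.
    have n0 : 0 < nrm R m by near: m; exact: nrm_gt0_near.
    rewrite subrK ler_pM2r ?invr_gt0 //; apply: mean_mono => w.
    by have /andP[] := testf_inwin t w w0 te0.
  apply: lesim_le => m; rewrite add0r.
  have K0 : 0 < kap * t ^+ 3 by rewrite mulr_gt0.
  have -> : kap * (t + t * eta / 2) ^+ 3 =
      kap * t ^+ 3 * (1 + eta * (3 / 2 + 3 / 4 * eta + eta ^+ 2 / 8)) by field.
  have -> : kap * t ^+ 3 + kap * t ^+ 3 * 3 * eta = kap * t ^+ 3 * (1 + eta * 3) by ring.
  rewrite ler_pM2l // lerD2l ler_pM2l //.
  have : eta ^+ 2 <= 1 by rewrite expr_le1 // ltW.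
  lra.
have te0 : 0 < t * eta / 2 by rewrite divr_gt0 // mulr_gt0.
have te1 : 0 < t - t * eta / 2.
  have -> : t - t * eta / 2 = t * (1 - eta / 2) by field.
  by rewrite mulr_gt0 //; lra.
have [_ h1] := latBox_lesim te1 te0.
have /cvg_lesim[_ h2] := A1_transfer (t - t * eta / 2) (t * eta / 2).
have h3 := lesimD (lesimD h2 h1) (lesim_refl (fun=> kap * t ^+ 3 * 3 * eta)).
apply: (lesim_trans _ (lesim_trans h3 _)).
  apply: lesim_le => m; rewrite add0r.
  have K0 : 0 < kap * t ^+ 3 by rewrite mulr_gt0.
  have -> : kap * (t - t * eta / 2) ^+ 3 + kap * t ^+ 3 * 3 * eta =
      kap * t ^+ 3 * (1 + eta * (3 / 2 + 3 / 4 * eta - eta ^+ 2 / 8)) by field.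
  rewrite -[leLHS]mulr1 ler_pM2l // lerDl mulr_ge0 ?(ltW e0) //.
  have : eta ^+ 2 <= 1 by rewrite expr_le1 // ltW.
  lra.
apply: lesim_near; near=> m.
have w0 : 0 < wid R m by near: m; exact: wid_gt0_near.
have n0 : 0 < nrm R m by near: m; exact: nrm_gt0_near.
rewrite subrK lerD2r ler_pM2r ?invr_gt0 //; apply: mean_mono => w.
have /andP[_] := testf_inwin (t - t * eta / 2) w w0 te0.
by rewrite subrK.
Unshelve. all: end_near. Qed.

Definition Gss (eta x y : R) : R := ssg eta x * ssg eta y.
(** Soft indicator of the band [|x| <= 2 * eta]; outside it, a shift of the argument by at most
    [eta] leaves the sign unchanged, as in [sg_shift]. *)
Definition chi1 (eta x y : R) : R := bump (2 * eta) eta x.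
Definition chi2 (eta x y : R) : R := bump (2 * eta) eta y.

Lemma scaled_le (eta u : R) m : 0 < s m ->
  (`|g * u / s m| <= eta)%R = (`|u| <= eta / g * s m)%R.
Proof.
move=> s0; rewrite !normrM normfV (gtr0_norm s0) (gtr0_norm g0) ler_pdivrMr //.
by rewrite mulrAC ler_pdivlMr // mulrC.
Qed.

Lemma latG_ss eta m : 0 < eta -> (0 < m)%N ->
  `|latG m (Gss eta) - sgcorr m 0 th|
  <= 2 * (near_axis m 0 (eta / g) + near_axis m th (eta / g)).
Proof.
move=> e0 m0; have s0 : 0 < s m by rewrite sqrtr_gt0 ltr0n.
rewrite distrC /sgcorr /latG -lat2B; apply: (le_trans (lat2_norm _ _)).
rewrite -lat2D -lat2Z; apply: lat2_mono => k k'.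
have E2 u : Num.sg u = Num.sg (g * u / s m) by rewrite (sgZ_inv _ s0) sgrM (gtr0_sg g0) mul1r.
rewrite (E2 (proj 0 k k')) (E2 (proj th k k')).
apply: (le_trans (mul_close _ _ (sg_norm _) (ssg_norm _ _))).
by rewrite -!scaled_le // [leRHS]mulrDr; apply: lerD; exact: sg_ssg.
Qed.

Lemma latG_chi eta m : 0 < eta -> (0 < m)%N ->
  latG m (chi1 eta) <= near_axis m 0 (3 * eta / g) /\
  latG m (chi2 eta) <= near_axis m th (3 * eta / g).
Proof.
move=> e0 m0; have s0 : 0 < s m by rewrite sqrtr_gt0 ltr0n.
have H u : bump (2 * eta) eta (g * u / s m) <= (`|u| <= 3 * eta / g * s m)%R%:R.
  rewrite -scaled_le //; apply: (le_trans (bump_le _ _ e0)).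
  by rewrite (_ : 2 * eta + eta = 3 * eta) //; ring.
by split; apply: lat2_mono => k k'; exact: H.
Qed.

Lemma latG_cvg eta : 0 < eta ->
  lesim (fun m => `|latG m (Gss eta) - (1 - 2 * th / pi)|) (fun=> 16 / g * eta).
Proof.
move=> e0; have eg : 0 < eta / g by rewrite divr_gt0.
have h1 := lesimZ (ler0n R 2) (lesimD (near_axis_le 0 eg) (near_axis_le th eg)).
have h2 : (fun m => `|sgcorr m 0 th - (1 - 2 * th / pi)|) @ \oo --> (0 : R).
  apply: cvg_norm0.
  have := cvg_seqD (sgcorr_cvg thp) (cvg_seq_cst (c := - (1 - 2 * th / pi))).
  by rewrite subrr.
have /cvg_lesim[h3 _] := h2.
apply: (lesim_trans _ (lesim_trans (lesimD h1 h3) _)).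
  apply: lesim_near; near=> m.
  have m0 : (0 < m)%N by near: m; exact: nbhs_infty_gt.
  apply: (le_trans _ (lerD (latG_ss e0 m0) (lexx _))).
  have -> : latG m (Gss eta) - (1 - 2 * th / pi) = (latG m (Gss eta) - sgcorr m 0 th) +
     (sgcorr m 0 th - (1 - 2 * th / pi)) by ring.
  exact: ler_normD.
by apply: lesim_le => m; rewrite addr0 le_eqVlt; apply/orP; left; apply/eqP; ring.
Unshelve. all: end_near. Qed.

Lemma sg_shift (eta x y : R) : 0 < eta -> `|y - x| <= eta ->
  `|Num.sg y - ssg eta x| <= 2 * bump (2 * eta) eta x.
Proof.
move=> e0 yx; case: (leP `|x| (2 * eta)) => hx.
  have h := bump_ge (2 * eta) x e0; rewrite hx in h.
  apply: (@le_trans _ _ 2); last by have : (1 : R) <= bump (2 * eta) eta x by []; lra.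
  apply: (le_trans (ler_normB _ _)).
  by have := sg_norm y; have := ssg_norm eta x; lra.
have e1 : Num.sg y = Num.sg x.
  move: yx hx; rewrite ler_norml => /andP[y1 y2].
  case: (leP 0 x) => x0.
    by rewrite ger0_norm // => hx; rewrite !gtr0_sg //; lra.
  by rewrite ltr0_norm // => hx; rewrite !ltr0_sg //; lra.
rewrite e1; apply: (le_trans (sg_ssg x e0)).
rewrite [(_ <= eta)%R]leNgt (_ : eta < `|x|) /=; last by lra.
by rewrite mulr0 mulr_ge0 //; have /andP[] := bump01 (2 * eta) eta x.
Qed.

Context (la lb : 'I_3 -> R).

(** A remainder plus its regression on the window statistics. On the window the regression part is
    of order [sqrt m / log m], hence negligible against the scale [sqrt m] of the remainder. *)
Definition lincomb (l : 'I_3 -> R) (F : T -> R) m (w : {ffun 'I_m -> T}) : R :=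
  tot F w + \sum_k l k * tot (B k) w.

Let N t m : R := mean (fun w : {ffun 'I_m -> T} =>
  Num.sg (lincomb la P w) * Num.sg (lincomb lb Q w) * (inwin t w)%:R).

Let L : R := \sum_k `|la k| + \sum_k `|lb k|.

Lemma testf_mul t eta G z : testf t eta G z =
  testf t eta (fun _ _ => 1) z * G (crd (o5 3) z) (crd (o5 4) z).
Proof. by rewrite /testf mulr1. Qed.

(** On the window the regression part shifts the argument of a sign by at most [eta] in units of
    [sqrt m]. The right-hand side separates the cost of softening the window from that of the two
    bands where a sign may flip. *)
Lemma sign_pointwise t eta m (w : {ffun 'I_m -> T}) : 0 < wid R m -> 0 < s m -> 0 < eta ->
  L * ((t + eta) * wid R m) <= eta * s m ->
  `|Num.sg (lincomb la P w) * Num.sg (lincomb lb Q w) * (inwin t w)%:R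
     - testf t eta (Gss eta) (stat Z w)|
  <= (testf t eta (fun _ _ => 1) (stat Z w) - (inwin t w)%:R)
    + 2 * (testf t eta (chi1 eta) (stat Z w) + testf t eta (chi2 eta) (stat Z w)).
Proof.
move=> w0 s0 e0 hL.
have /andP[h1 h2] := testf_inwin t w w0 e0.
rewrite (testf_mul t eta (Gss eta)) (testf_mul t eta (chi1 eta)) (testf_mul t eta (chi2 eta)) !crd_stat //.
set Psi := testf _ _ _ _ in h1 h2 *.
set x := tot P w / s m; set y := tot Q w / s m.
set I : R := (inwin t w)%:R in h1 *.
have I0 : 0 <= I by rewrite ler0n.
set S := Num.sg _ * Num.sg _.
have S1 : `|S| <= 1 by rewrite normrM mulr_ile1 // sg_norm.
have -> : S * I - Psi * Gss eta x y = Psi * (S - Gss eta x y) - S * (Psi - I) by ring.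
apply: (le_trans (ler_normB _ _)); rewrite addrC; apply: lerD.
  have PI : 0 <= Psi - I by rewrite subr_ge0.
  by rewrite normrM (ger0_norm PI) ler_piMl.
rewrite normrM (ger0_norm (le_trans I0 h1)) -mulrDr mulrCA.
(* Outside the enlarged window [Psi] vanishes, so the bound on the shift may be used below. *)
case: (boolP (inwin (t + eta) w)) h2 => [hw _|_ h2]; last first.
  have -> : Psi = 0 by apply/eqP; rewrite eq_le h2 (le_trans I0 h1).
  by rewrite !mul0r.
apply: ler_wpM2l; first exact: le_trans h1.
apply: (le_trans (mul_close _ _ (sg_norm _) (ssg_norm _ _))); rewrite mulrDr.
have sh (l : 'I_3 -> R) (F : T -> R) : \sum_k `|l k| <= L ->
    `|Num.sg (lincomb l F w) - ssg eta (tot F w / s m)|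
     <= 2 * bump (2 * eta) eta (tot F w / s m).
  move=> lL; rewrite -(sgZ_inv (lincomb l F w) s0); apply: sg_shift => //.
  rewrite -mulrBl normrM normfV (gtr0_norm s0) ler_pdivrMr //.
  have -> : lincomb l F w - tot F w = \sum_k l k * tot (B k) w by rewrite /lincomb addrC addKr.
  apply: le_trans hL; apply: (le_trans (ler_norm_sum _ _ _)).
  have z0 : 0 <= (t + eta) * wid R m by move/forallP: hw => /(_ i0); exact: le_trans.
  apply: (le_trans _ (ler_wpM2r z0 lL)); rewrite mulr_suml; apply: ler_sum => k _.
  by rewrite normrM ler_wpM2l //; move/forallP: hw.
have sp (l : 'I_3 -> R) : 0 <= \sum_k `|l k| by exact: sumr_ge0.
by apply: lerD; apply: sh; rewrite /L ?lerDl ?lerDr.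
Qed.

Lemma N_cvg t : 0 < t ->
  (fun m => N t m / nrm R m) @ \oo --> kap * t ^+ 3 * (1 - 2 * th / pi).
Proof.
move=> t_0; have k0 := kap_gt0.
pose Ct := 3 * t ^+ 2 + 3 * t + 1.
have Ct0 : 0 < Ct.
  by rewrite /Ct; have := sqr_ge0 t; lra.
pose M := kap * t ^+ 3 + kap * Ct + 1.
pose rho0 : R := 1 - 2 * th / pi.
have K0 : 0 < kap * t ^+ 3 by rewrite mulr_gt0 // exprn_gt0.
suff h : (fun m => N t m / nrm R m - kap * t ^+ 3 * rho0) @ \oo --> (0 : R).
  have := cvg_seqD h (cvg_seq_cst (c := kap * t ^+ 3 * rho0)).
  by rewrite add0r; apply: eq_cvg_seq => m; rewrite subrK.
(* Successively: softening of the window, since [(t + eta)^3 <= t^3 + Ct * eta]; twice the two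
   bands, each of mass at most [12 * M * eta / g]; and the smoothed main term, whose box and sign
   factors are both approximate. *)
apply: (@cvg0_param _ _ (kap * Ct + 48 * M / g + (kap * Ct + kap * t ^+ 3 * (16 / g)))) => eta /andP[e0 e1].
have [up lo] := latBox_lesim t_0 e0.
have te3 : kap * (t + eta) ^+ 3 <= kap * t ^+ 3 + kap * Ct * eta.
  rewrite -mulrA -mulrDr ler_pM2l //.
  have -> : (t + eta) ^+ 3 = t ^+ 3 + (3 * t ^+ 2 + 3 * t * eta + eta ^+ 2) * eta by ring.
  rewrite lerD2l ler_pM2r // /Ct.
  have : t * eta <= t by rewrite ler_piMr // ltW.
  have : eta ^+ 2 <= 1 by rewrite expr_le1 // ltW.
  lra.
have X1 : lesim (fun m => `|latBox m t eta / nrm R m - kap * t ^+ 3|) (fun=> kap * Ct * eta).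
  apply: lesim_norm.
    apply: (lesim_trans (lesimD up (lesim_refl (fun=> - (kap * t ^+ 3))))).
    by apply: lesim_le => m; lra.
  have := lesimN (lesimD lo (lesim_refl (fun=> - (kap * t ^+ 3)))).
  move/lesim_trans; apply; apply: lesim_le => m; rewrite subrr oppr0.
  by rewrite mulr_ge0 ?(ltW e0) // mulr_ge0 // ltW.
have ABound : \forall m \near \oo, latBox m t eta / nrm R m <= M.
  have := up _ ltr01; apply: filterS => m h; apply: (le_trans h).
  rewrite /M; have : kap * Ct * eta <= kap * Ct by rewrite ler_piMr // mulr_ge0 // ltW.
  lra.
have sm1 : smooth (@crd R) (fun z : 'rV[R]_5 => chi1 eta (crd (o5 3) z) (crd (o5 4) z)).
  by apply: (@smooth_bump R _ 5 (@crd R) (o5 3)) => x y; exact: crdD.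
have sm2 : smooth (@crd R) (fun z : 'rV[R]_5 => chi2 eta (crd (o5 3) z) (crd (o5 4) z)).
  by apply: (@smooth_bump R _ 5 (@crd R) (o5 4)) => x y; exact: crdD.
have sm3 : smooth (@crd R) (fun z : 'rV[R]_5 => Gss eta (crd (o5 3) z) (crd (o5 4) z)).
  apply: smooth_mul.
    by apply: (@smooth_ssg R _ 5 (@crd R) (o5 3)) => x y; exact: crdD.
  by apply: (@smooth_ssg R _ 5 (@crd R) (o5 4)) => x y; exact: crdD.
have eg : 0 < 3 * eta / g by rewrite divr_gt0 // mulr_gt0.
have latBox0 m : 0 <= latBox m t eta.
  have p u : 0 <= bump t eta u by have /andP[] := bump01 t eta u.
  by apply: lat_ge0 => k1; rewrite mulr_ge0 //; apply: lat_ge0 => k2; rewrite mulr_ge0 //;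
    apply: lat_ge0 => k3.
have M0 : 0 <= M.
  have k1 : 0 < kap * Ct by rewrite mulr_gt0.
  by rewrite /M; lra.
have chiA G (tt : R) : smooth (@crd R) (fun z : 'rV[R]_5 => G (crd (o5 3) z) (crd (o5 4) z)) ->
    (forall m, (0 < m)%N -> latG m G <= near_axis m tt (3 * eta / g)) ->
    lesim (fun m => A t eta G m / nrm R m) (fun=> M * (4 * (3 * eta / g))).
  move=> sG hG; have /cvg_lesim[tr _] := A_transfer t eta sG.
  have := lesimD tr (lesimZ M0 (near_axis_le tt eg)).
  rewrite add0r => h; apply: lesim_trans h; apply: lesim_near; near=> m.
  have m0 : (0 < m)%N by near: m; exact: nbhs_infty_gt.
  have n0 : 0 < nrm R m by near: m; exact: nrm_gt0_near.
  have BM : latBox m t eta / nrm R m <= M by near: m; exact: ABound.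
  have le1 : latBox m t eta * latG m G / nrm R m <= M * near_axis m tt (3 * eta / g).
    rewrite mulrAC.
    apply: (@le_trans _ _ (latBox m t eta / nrm R m * near_axis m tt (3 * eta / g))).
      apply: ler_wpM2l; last exact: hG.
      by apply: divr_ge0 => //; exact: ltW.
    apply: ler_wpM2r BM; apply: lat_ge0 => k; apply: lat_ge0 => k'; exact: ler0n.
  rewrite mulrBl; lra.
have Y1 := chiA (chi1 eta) 0 sm1 (fun m m0 => (latG_chi e0 m0).1).
have Y2 := chiA (chi2 eta) th sm2 (fun m m0 => (latG_chi e0 m0).2).
have Y3 : lesim (fun m => (A t eta (fun _ _ => 1) m - D t m) / nrm R m) (fun=> kap * Ct * eta).
  have /cvg_lesim[tr _] := A1_transfer t eta.
  have /cvg_lesim[_ dd] := D_cvg t_0.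
  have := lesimD (lesimD tr up) (lesimN dd).
  move=> h; apply: (lesim_trans _ (lesim_trans h _)); apply: lesim_le => m; last by lra.
  by rewrite subrK mulrBl.
have Y4 : lesim (fun m => `|A t eta (Gss eta) m / nrm R m - kap * t ^+ 3 * rho0|)
   (fun=> kap * Ct * eta + kap * t ^+ 3 * (16 / g * eta)).
  have tr0 := A_transfer t eta sm3.
  have /cvg_lesim[tr _] : (fun m => `|(A t eta (Gss eta) m - latBox m t eta * latG m (Gss eta)) / nrm R m|) @ \oo --> (0 : R).
    exact: cvg_norm0.
  have := lesimD tr (lesimD X1 (lesimZ (ltW K0) (latG_cvg e0))).
  rewrite add0r; move=> h; apply: lesim_trans h; apply: lesim_near; near=> m.
  have n0 : 0 < nrm R m by near: m; exact: nrm_gt0_near.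
  set al := latBox m t eta / nrm R m; set ga := latG m (Gss eta).
  have -> : A t eta (Gss eta) m / nrm R m - kap * t ^+ 3 * rho0 =
    (A t eta (Gss eta) m - latBox m t eta * ga) / nrm R m + ((al - kap * t ^+ 3) * ga
      + kap * t ^+ 3 * (ga - rho0)).
    by rewrite /al; field; rewrite gt_eqF.
  apply: (le_trans (ler_normD _ _)); rewrite lerD2l.
  apply: (le_trans (ler_normD _ _)); apply: lerD.
    rewrite normrM ler_piMr // /ga /latG; apply: (le_trans (lat2_norm _ _)).
    rewrite -[leRHS](lat2_cst m); apply: lat2_mono => k k'.
    by rewrite normrM mulr_ile1 // ssg_norm.
  by rewrite normrM (gtr0_norm K0).
have := lesimD (lesimD Y3 (lesimZ (ler0n R 2) (lesimD Y1 Y2))) Y4.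
move=> h; apply: (lesim_trans _ (lesim_trans h _)); last first.
  apply: lesim_le => m; rewrite le_eqVlt; apply/orP; left; apply/eqP; ring.
have L0 : 0 <= L by rewrite /L addr_ge0 // sumr_ge0.
have wl : \forall m \near \oo, L * ((t + eta) * wid R m) <= eta * s m.
  have q0 : 0 < eta / (1 + L * (t + eta)).
    by rewrite divr_gt0 // ltr_pwDl // mulr_ge0 //; lra.
  move/cvgrPdist_le: (@lnn_inv0 R) => /(_ _ q0) hh; near=> m.
  have l1 : 1 <= lnn R m by near: m; exact: lnn_gt0_near.
  have s0 : 0 < s m by near: m; exact: sqrt_pos_near.
  have : `|0 - (lnn R m)^-1| <= eta / (1 + L * (t + eta)) by near: m.
  have l0 : 0 < lnn R m by lra.
  have q1 : 0 < 1 + L * (t + eta) by rewrite ltr_pwDl // mulr_ge0 //; lra.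
  rewrite sub0r normrN gtr0_norm ?invr_gt0 // ler_pdivlMr // mulrDr mulr1 => h'.
  rewrite /wid -/(s m) [leLHS](_ : _ = (lnn R m)^-1 * (L * (t + eta)) * s m); last by ring.
  rewrite ler_pM2r //; have : 0 < (lnn R m)^-1 by rewrite invr_gt0.
  lra.
apply: lesim_near; near=> m.
have w0 : 0 < wid R m by near: m; exact: wid_gt0_near.
have n0 : 0 < nrm R m by near: m; exact: nrm_gt0_near.
have s0 : 0 < s m by near: m; exact: sqrt_pos_near.
have wL : L * ((t + eta) * wid R m) <= eta * s m by near: m; exact: wl.
have -> : N t m / nrm R m - kap * t ^+ 3 * rho0 = (N t m - A t eta (Gss eta) m) / nrm R m
  + (A t eta (Gss eta) m / nrm R m - kap * t ^+ 3 * rho0) by rewrite mulrBl; ring.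
apply: (le_trans (ler_normD _ _)); rewrite lerD2r.
rewrite -!mulrDl mulrA -mulrDl normrM normfV (gtr0_norm n0) ler_pM2r ?invr_gt0 //.
rewrite /N /A -meanB; apply: (le_trans (mean_norm _)).
rewrite /D -meanB -meanD -meanZ -meanD; apply: mean_mono => w.
exact: sign_pointwise.
Unshelve. all: end_near. Qed.

End Joint.

Lemma inwin_mono (R : realType) (T : finType) (B : 'I_3 -> T -> R) t t' m (w : {ffun 'I_m -> T}) :
  0 < wid R m -> t <= t' -> inwin B t w -> inwin B t' w.
Proof.
move=> w0 tt /forallP h; apply/forallP => k; apply: (le_trans (h k)).
by rewrite ler_pM2r.
Qed.

Lemma cvg_seqV (R : realType) (u : nat -> R) (a : R) : a != 0 -> u @ \oo --> a ->
  (fun m => (u m)^-1) @ \oo --> a^-1.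
Proof. by move=> a0 hu; apply: cvgV. Qed.

Lemma sandwich_indicator (R : realType) (l b u e bad : bool) :
  (l -> b) -> (b -> u) -> (~~ bad -> (l ==> e) && (e ==> u)) ->
  `|e%:R - b%:R| <= u%:R - l%:R + bad%:R :> R.
Proof.
case: l b u e bad => [] [] [] [] [] //= h1 h2 h3;
  rewrite ?(subrr, subr0, sub0r, addr0, add0r, normrN, normr0, normr1) ?addr_ge0 ?lerDl //.
all: by [have := h1 isT|have := h2 isT|have := h3 isT].
Qed.

(** Off a negligible set the event lies between windows of half-widths arbitrarily close to [c],
    whose masses [K * t ^+ 3] are continuous in [t]. The factor [K * c ^+ 3] cancels in the
    ratio. *)
Lemma sandwich_ratio (R : realType) (T : finType) (B : 'I_3 -> T -> R) (K rho c : R)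
    (S : forall m, {ffun 'I_m -> T} -> R) (Ev Bad : forall m, {ffun 'I_m -> T} -> bool) :
  0 < K -> 0 < c ->
  (forall t, 0 < t -> (fun m => mean (R := R) (fun w : {ffun 'I_m -> T} => (inwin B t w)%:R) / nrm R m)
      @ \oo --> K * t ^+ 3) ->
  (fun m => mean (fun w : {ffun 'I_m -> T} => S m w * (inwin B c w)%:R) / nrm R m)
      @ \oo --> K * c ^+ 3 * rho ->
  (forall m w, `|S m w| <= 1) ->
  (fun m => mean (R := R) (fun w : {ffun 'I_m -> T} => (Bad m w)%:R) / nrm R m) @ \oo --> (0 : R) ->
  (forall eta, 0 < eta < c -> \forall m \near \oo, forall w : {ffun 'I_m -> T}, ~~ Bad m w ->
     (inwin B (c - eta) w ==> Ev m w) && (Ev m w ==> inwin B (c + eta) w)) ->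
  (fun m => mean (fun w : {ffun 'I_m -> T} => S m w * (Ev m w)%:R) /
            mean (R := R) (fun w : {ffun 'I_m -> T} => (Ev m w)%:R)) @ \oo --> rho.
Proof.
move=> K0 c0 hD hN S1 hBad hEv.
have c3 : 0 < c ^+ 3 by rewrite exprn_gt0.
(* Used with [F = S] for the numerator and with [F = 1] for the denominator. *)
have main (F : forall m, {ffun 'I_m -> T} -> R) : (forall m w, `|F m w| <= 1) ->
   (fun m => (mean (fun w : {ffun 'I_m -> T} => F m w * (Ev m w)%:R) -
              mean (fun w : {ffun 'I_m -> T} => F m w * (inwin B c w)%:R)) / nrm R m) @ \oo --> (0 : R).
  (* The outer and inner windows have half-widths [c + c * eta / 2] and [c - c * eta / 2]; their
     masses differ by [K * c ^+ 3 * eta * (3 + eta ^+ 2 / 4)]. *)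
  move=> F1; apply: (@cvg0_param _ _ (K * c ^+ 3 * 8)) => eta /andP[e0 e1].
  have t0 : 0 < c * eta / 2 by rewrite divr_gt0 // mulr_gt0.
  have t1 : c * eta / 2 < c.
    by rewrite ltr_pdivrMr // ltr_pM2l //; lra.
  have cp : 0 < c + c * eta / 2 by rewrite addr_gt0.
  have cm : 0 < c - c * eta / 2 by rewrite subr_gt0.
  have /cvg_lesim[h1 _] := cvg_seqD (cvg_seqD (hD _ cp) (cvg_seqZ (c := -1) (hD _ cm))) hBad.
  apply: (lesim_trans _ (lesim_trans h1 _)); last first.
    apply: lesim_le => _; rewrite addr0.
    have -> : K * (c + c * eta / 2) ^+ 3 + -1 * (K * (c - c * eta / 2) ^+ 3)
       = K * c ^+ 3 * (eta * (3 + eta ^+ 2 / 4)) by field.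
    rewrite -[leRHS]mulrA ler_pM2l ?mulr_gt0 // mulrC ler_pM2r //.
    have : eta ^+ 2 <= 1 by rewrite expr_le1 // ltW.
    lra.
  have ev := hEv (c * eta / 2) ltac:(by rewrite t0 t1).
  apply: lesim_near; near=> m.
  have w0 : 0 < wid R m by near: m; exact: wid_gt0_near.
  have n0 : 0 < nrm R m by near: m; exact: nrm_gt0_near.
  have evm : forall w : {ffun 'I_m -> T}, ~~ Bad m w ->
     (inwin B (c - c * eta / 2) w ==> Ev m w) && (Ev m w ==> inwin B (c + c * eta / 2) w).
    by near: m; exact: ev.
  rewrite mulN1r -mulrBl -mulrDl normrM normfV (gtr0_norm n0) ler_pM2r ?invr_gt0 //.
  rewrite -meanB; apply: (le_trans (mean_norm _)); rewrite -meanB -meanD.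
  apply: mean_mono => w; rewrite -mulrBr normrM.
  apply: (@le_trans _ _ `|(Ev m w)%:R - (inwin B c w)%:R|).
    by rewrite ler_piMl.
  have m1 : inwin B (c - c * eta / 2) w -> inwin B c w.
    by apply: inwin_mono => //; lra.
  have m2 : inwin B c w -> inwin B (c + c * eta / 2) w.
    by apply: inwin_mono => //; lra.
  exact: sandwich_indicator m1 m2 (evm w).
have n1 (m : nat) (w : {ffun 'I_m -> T}) : `|1 : R| <= 1 by rewrite normr1.
have e1 := main (fun _ _ => 1) n1.
have F1 m (f : {ffun 'I_m -> T} -> R) : mean (fun w => 1 * f w) = mean f.
  by apply: eq_mean => w; rewrite mul1r.
have num := cvg_seqD (main S S1) hN.
have den := cvg_seqD e1 (hD c c0).
rewrite !add0r in num den.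
have Kc : K * c ^+ 3 != 0 by rewrite gt_eqF // mulr_gt0.
have := cvg_seqM num (cvg_seqV Kc den).
have -> : K * c ^+ 3 * rho / (K * c ^+ 3) = rho by rewrite mulrAC divff // mul1r.
apply: cvg_near; near=> m.
have n0 : 0 < nrm R m by near: m; exact: nrm_gt0_near.
have E (f g : {ffun 'I_m -> T} -> R) : (mean f - mean g) / nrm R m + mean g / nrm R m = mean f / nrm R m.
  by rewrite mulrBl subrK.
by rewrite !F1 !E invf_div mulrA divfK // gt_eqF.
Unshelve. all: end_near. Qed.

(** * Moments of a block of three rankings *)

Section Moments.
Context (R : realType).

Definition xs (k : 'I_3) (s : ranking) : R := pm1 R (s k < s (ordS k))%N.

Lemma pm1_sq b : pm1 R b * pm1 R b = 1.
Proof. by case: b; rewrite /pm1; ring. Qed.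

Lemma pm1_neg b : pm1 R (~~ b) = - pm1 R b.
Proof. by case: b; rewrite /pm1 //= opprK. Qed.

Lemma mean_reindex (T : finType) (h : T -> T) (f : T -> R) : injective h ->
  mean (fun t => f (h t)) = mean f.
Proof. by move=> hi; rewrite /mean [RHS](reindex_inj hi). Qed.

Lemma ordS_neq (k : 'I_3) : k != ordS k.
Proof. by case: k => [[|[|[|k]]] hk]. Qed.

(** Reversing a ranking is a bijection that negates every vote. *)
Lemma mean_xs k : mean (xs k) = 0.
Proof.
suff h : mean (xs k) = - mean (xs k) by lra.
rewrite -mulN1r -meanZ -(@mean_reindex _ (fun s : ranking => (s * perm rev_ord_inj)%g)); last exact: mulIg.
apply: eq_mean => s; rewrite /xs !permM !permE /= mulN1r -pm1_neg; congr (pm1 _ _).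
have : s k != s (ordS k) by rewrite (inj_eq perm_inj) ordS_neq.
rewrite -val_eqE /=; move: (s k) (s (ordS k)) => x y; have := ltn_ord x; have := ltn_ord y.
rewrite -leqNgt; lia.
Qed.

Lemma mean_xs_shift k l :
  mean (fun s => xs (ordS k) s * xs (ordS l) s) = mean (fun s => xs k s * xs l s).
Proof.
have oi : injective (@ordS 3) by exact: can_inj (@ordSK 3).
rewrite -(@mean_reindex _ (fun s : ranking => (perm oi * s)%g) (fun s => xs k s * xs l s)); last exact: mulgI.
by apply: eq_mean => s; rewrite /xs !permM !permE.
Qed.

(** A ranking is transitive, so its three cyclic votes are never all equal: one of the products is 1
    and two are -1. *)
Lemma xs_nae (s : ranking) :
  xs alt_a s * xs alt_b s + xs alt_b s * xs alt_c s + xs alt_c s * xs alt_a s = -1.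
Proof.
have -> : xs alt_a s = pm1 R (s alt_a < s alt_b)%N by rewrite /xs; congr (pm1 _ (_ < val (s _))%N); exact: val_inj.
have -> : xs alt_b s = pm1 R (s alt_b < s alt_c)%N by rewrite /xs; congr (pm1 _ (_ < val (s _))%N); exact: val_inj.
have -> : xs alt_c s = pm1 R (s alt_c < s alt_a)%N by rewrite /xs; congr (pm1 _ (_ < val (s _))%N); exact: val_inj.
have ab : s alt_a != s alt_b by rewrite (inj_eq perm_inj).
have bc : s alt_b != s alt_c by rewrite (inj_eq perm_inj).
have ca : s alt_c != s alt_a by rewrite (inj_eq perm_inj).
move: ab bc ca; rewrite -!val_eqE /=; move: (val _) (val _) (val _) => x y z.
rewrite /pm1; case: (ltngtP x y) => // h1 _; case: (ltngtP y z) => // h2 _;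
  case: (ltngtP z x) => // h3 _; try (exfalso; lia); ring.
Qed.

(* For distinct cyclically oriented pairs the votes of one voter have correlation
   -1/3. *)
Definition cx (k l : 'I_3) : R := if k == l then 1 else - (1 / 3).

Lemma ranking0 : ranking.
Proof. exact: 1%g. Qed.

(** Cyclic relabelling makes the three mixed moments equal, and by [xs_nae] they sum to -1. *)
Lemma mean_xs2 k l : mean (fun s => xs k s * xs l s) = cx k l.
Proof.
rewrite /cx; case: eqP => [->|/eqP kl].
  rewrite -[RHS](mean_cst ranking0); apply: eq_mean => s; exact: pm1_sq.
have o1 : ordS alt_a = alt_b by exact: val_inj.
have o2 : ordS alt_b = alt_c by exact: val_inj.
have o3 : ordS alt_c = alt_a by exact: val_inj.
have e1 := mean_xs_shift alt_a alt_b; have e2 := mean_xs_shift alt_b alt_c.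
rewrite o1 o2 in e1; rewrite o2 o3 in e2.
have tot : mean (fun s => xs alt_a s * xs alt_b s) + mean (fun s => xs alt_b s * xs alt_c s)
   + mean (fun s => xs alt_c s * xs alt_a s) = -1.
  by rewrite -!meanD -[RHS](mean_cst ranking0); apply: eq_mean => s; exact: xs_nae.
have sym i j : mean (fun s => xs i s * xs j s) = mean (fun s => xs j s * xs i s).
  by apply: eq_mean => s; rewrite mulrC.
have ei (j : 'I_3) : [\/ j = alt_a, j = alt_b | j = alt_c].
  by case: j => [[|[|[|j]]] hj]; [apply: Or31|apply: Or32|apply: Or33|by []];
    apply: val_inj.
have ab : mean (fun s => xs alt_a s * xs alt_b s) = - (1 / 3) by lra.
have bc : mean (fun s => xs alt_b s * xs alt_c s) = - (1 / 3) by lra.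
have ca : mean (fun s => xs alt_c s * xs alt_a s) = - (1 / 3) by lra.
by move: kl; case: (ei k) => ->; case: (ei l) => -> //; rewrite ?ab ?bc ?ca // sym.
Qed.

Lemma mean_ffun_prod n (T : finType) (f : 'I_n -> T -> R) :
  mean (fun w : {ffun 'I_n -> T} => \prod_i f i (w i)) = \prod_i mean (f i).
Proof.
rewrite /mean bigA_distr_bigA; apply: eq_bigr => w _.
rewrite big_split /=; congr (_ * _).
by rewrite prodr_const card_ord /unif card_ffun card_ord natrX exprVn.
Qed.

Definition triple := {ffun 'I_3 -> ranking}.

Definition uu (k : 'I_3) (w : triple) : R := (\sum_j xs k (w j)) / 2.
Definition vv (k : 'I_3) (w : triple) : R := - (\prod_j xs k (w j)) / 2.

Lemma mean_sum (T I : finType) (F : I -> T -> R) :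
  mean (fun t => \sum_i F i t) = \sum_i mean (F i).
Proof.
rewrite /mean; under eq_bigr => t _ do rewrite mulr_sumr.
by rewrite exchange_big.
Qed.

(** Writes the vote of a single member as a product over the whole block, so that [mean_ffun_prod]
    applies. *)
Let pick (k : 'I_3) (j i : 'I_3) (s : ranking) : R := if i == j then xs k s else 1.

Let prod_pick k j (w : triple) : \prod_i pick k j i (w i) = xs k (w j).
Proof.
rewrite (bigD1 j) //= big1 ?mulr1 /pick ?eqxx //.
by move=> i /negPf ->.
Qed.

Lemma mean_u k : mean (uu k) = 0.
Proof.
rewrite /uu meanZr mean_sum big1 ?mul0r // => j _.
rewrite -(eq_mean (fun w => prod_pick k j w)) (mean_ffun_prod (pick k j)).
rewrite (bigD1 j) //= (_ : mean (pick k j j) = 0) ?mul0r //.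
by rewrite -(mean_xs k); apply: eq_mean => s; rewrite /pick eqxx.
Qed.

Lemma mean_v k : mean (vv k) = 0.
Proof.
transitivity (mean (fun w : triple => - (1 / 2) * \prod_j xs k (w j))).
  by apply: eq_mean => w; rewrite /vv; field.
rewrite meanZ (mean_ffun_prod (fun=> xs k)) (bigD1 ord0) //= mean_xs; ring.
Qed.

Lemma mean_uu k l : mean (fun w => uu k w * uu l w) = 3 / 4 * cx k l.
Proof.
transitivity (mean (fun w : triple => 1 / 4 * \sum_j \sum_i xs k (w j) * xs l (w i))).
  apply: eq_mean => w; rewrite /uu.
  have -> : \sum_j \sum_i xs k (w j) * xs l (w i) =
     (\sum_j xs k (w j)) * (\sum_j xs l (w j)).
    by rewrite mulr_suml; apply: eq_bigr => j _; rewrite mulr_sumr.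
  by field.
rewrite meanZ mean_sum (eq_bigr (fun=> cx k l)); last first.
  move=> j _; rewrite mean_sum (bigD1 j) //= big1 ?addr0.
    transitivity (mean (fun w : triple => \prod_i (pick k j i (w i) * pick l j i (w i)))).
      by apply: eq_mean => w; rewrite big_split /= !prod_pick.
    rewrite (mean_ffun_prod (fun i s => pick k j i s * pick l j i s)).
    rewrite (bigD1 j) //= big1 ?mulr1.
      by rewrite -mean_xs2; apply: eq_mean => s; rewrite /pick eqxx.
    move=> i /negPf ij; rewrite -[RHS](mean_cst ranking0); apply: eq_mean => s.
    by rewrite /pick ij mulr1.
  move=> i ij.
  transitivity (mean (fun w : triple => \prod_h (pick k j h (w h) * pick l i h (w h)))).
    by apply: eq_mean => w; rewrite big_split /= !prod_pick.
  rewrite (mean_ffun_prod (fun h s => pick k j h s * pick l i h s)).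
  rewrite (bigD1 j) //= (_ : mean _ = 0) ?mul0r //.
  rewrite -(mean_xs k); apply: eq_mean => s.
  by rewrite /pick eqxx eq_sym (negPf ij) mulr1.
by rewrite sumr_const card_ord -[_ *+ 3]mulr_natr; field.
Qed.

Lemma mean_vv k l : mean (fun w => vv k w * vv l w) = 1 / 4 * cx k l ^+ 3.
Proof.
transitivity (mean (fun w : triple => 1 / 4 * \prod_j (xs k (w j) * xs l (w j)))).
  by apply: eq_mean => w; rewrite /vv big_split /=; field.
rewrite meanZ (mean_ffun_prod (fun _ s => xs k s * xs l s)).
by rewrite prodr_const card_ord mean_xs2.
Qed.

Lemma mean_uv k l : mean (fun w => uu k w * vv l w) = 0.
Proof.
transitivity (mean (fun w : triple => - (1 / 4) * \sum_j (xs k (w j) * \prod_i xs l (w i)))).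
  by apply: eq_mean => w; rewrite /uu /vv -mulr_suml; field.
rewrite meanZ mean_sum big1 ?mulr0 // => j _.
transitivity (mean (fun w : triple => \prod_i (pick k j i (w i) * xs l (w i)))).
  by apply: eq_mean => w; rewrite big_split /= prod_pick.
rewrite (mean_ffun_prod (fun i s => pick k j i s * xs l s)).
(* The voter [ordS j] differs from [j], hence contributes a lone vote, of mean 0. *)
rewrite (bigD1 (ordS j)) //= (_ : mean _ = 0) ?mul0r //.
rewrite -(mean_xs l); apply: eq_mean => s.
by rewrite /pick eq_sym (negPf (ordS_neq j)) mul1r.
Qed.

Definition lc (al be : 'I_3 -> R) (w : triple) : R := \sum_k (al k * uu k w + be k * vv k w).

Lemma mean_lc0 al be : mean (lc al be) = 0.
Proof.
rewrite /lc mean_sum big1 // => k _.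
by rewrite meanD !meanZ mean_u mean_v !mulr0 addr0.
Qed.

Lemma mean_lc al be al' be' : mean (fun w => lc al be w * lc al' be' w) =
  \sum_k \sum_l (al k * al' l * (3 / 4 * cx k l) + be k * be' l * (1 / 4 * cx k l ^+ 3)).
Proof.
transitivity (mean (fun w => \sum_k \sum_l (al k * al' l * (uu k w * uu l w)
   + be k * be' l * (vv k w * vv l w) + al k * be' l * (uu k w * vv l w)
   + be k * al' l * (uu l w * vv k w)))).
  apply: eq_mean => w; rewrite /lc mulr_suml; apply: eq_bigr => k _.
  by rewrite mulr_sumr; apply: eq_bigr => l _; ring.
rewrite mean_sum; apply: eq_bigr => k _; rewrite mean_sum; apply: eq_bigr => l _.
by rewrite !meanD !meanZ mean_uu mean_vv !mean_uv !mulr0 !addr0.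
Qed.

End Moments.

(** * Regression of block majorities and the limiting correlation *)

Section Chol.
Context (R : realType).

(** Factorises twice the matrix with diagonal [p] and off-diagonal entries [s], whose eigenvalues
    are [p - s] (twice) and [p + 2 * s]. The factor 2 offsets the variance 1/2 of [xi]; by symmetry
    one number [b] serves for two entries. *)
Lemma cholesky3 (p s : R) : 0 < p - s -> 0 < p + 2 * s ->
  exists a b c e f : R, [/\ 0 < a, 0 < c, 0 < f &
    [/\ a * a = 2 * p, a * b = 2 * s, b * b + c * c = 2 * p,
        b * b + c * e = 2 * s & b * b + e * e + f * f = 2 * p]].
Proof.
move=> h1 h2; have p0 : 0 < p by lra.
have ps : 0 < p + s by lra.
have x0 : 0 < 2 * p by lra.
have y0 : 0 < 2 * (p - s) * (p + s) / p by rewrite divr_gt0 // !mulr_gt0.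
have z0 : 0 < 2 * (p - s) * (p + 2 * s) / (p + s) by rewrite divr_gt0 // !mulr_gt0.
pose a := Num.sqrt (2 * p); pose c := Num.sqrt (2 * (p - s) * (p + s) / p).
pose f := Num.sqrt (2 * (p - s) * (p + 2 * s) / (p + s)).
have a0 : 0 < a by rewrite sqrtr_gt0.
have c0 : 0 < c by rewrite sqrtr_gt0.
have f0 : 0 < f by rewrite sqrtr_gt0.
have a2 : a * a = 2 * p by rewrite -expr2 sqr_sqrtr // ltW.
have c2 : c * c = 2 * (p - s) * (p + s) / p by rewrite -expr2 sqr_sqrtr // ltW.
have f2 : f * f = 2 * (p - s) * (p + 2 * s) / (p + s) by rewrite -expr2 sqr_sqrtr // ltW.
have b2 : (2 * s / a) * (2 * s / a) = 2 * s ^+ 2 / p.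
  have -> : (2 * s / a) * (2 * s / a) = 4 * s ^+ 2 / (a * a) by field; rewrite gt_eqF.
  by rewrite a2; field; rewrite gt_eqF.
have e2 : (2 * s * (p - s) / (p * c)) * (2 * s * (p - s) / (p * c))
    = 2 * s ^+ 2 * (p - s) / (p * (p + s)).
  have -> : (2 * s * (p - s) / (p * c)) * (2 * s * (p - s) / (p * c))
    = 4 * s ^+ 2 * (p - s) ^+ 2 / (p ^+ 2 * (c * c)) by field; rewrite !gt_eqF.
  rewrite c2; field; rewrite !gt_eqF //.
exists a, (2 * s / a), c, (2 * s * (p - s) / (p * c)), f; split => //; split => //.
- by field; rewrite gt_eqF.
- by rewrite b2 c2; field; rewrite !gt_eqF.
- rewrite b2; have -> : c * (2 * s * (p - s) / (p * c)) = 2 * s * (p - s) / p.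
    by field; rewrite !gt_eqF.
  by field; rewrite !gt_eqF.
- by rewrite b2 e2 f2; field; rewrite !gt_eqF.
Qed.

Context (tau : R).
Context (tau01 : 0 <= tau < 1).

Definition bvar : R := 3 / 4 + tau ^+ 2 / 4.
Definition bcov : R := - (1 / 4) - tau ^+ 2 / 108.
(* On the span of (1,1,1), resp. on its orthogonal complement, the covariances of
   [u] and [v] are scalars U and V; regressing [u + v] on [u + tau v] there gives
   the slope (U + tau V) / (U + tau^2 V). *)
Definition kone : R := (27 + 25 * tau) / (27 + 25 * tau ^+ 2).
Definition kperp : R := (27 + 7 * tau) / (27 + 7 * tau ^+ 2).
(** On an eigenspace the residual variance is [U V (1 - tau)^2 / (U + tau^2 V)], with [U = 1/4],
    [V = 25/108] on the line of (1,1,1) and [U = 1], [V = 7/27] on its complement. A diagonal entry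
    averages the line once and the plane twice; an off-diagonal entry is a third of their
    difference, and the quotient is [rcor]. *)
Definition rvar : R := (1 - tau) ^+ 2 *
  (25 / (4 * (27 + 25 * tau ^+ 2)) + 2 * (7 / (27 + 7 * tau ^+ 2))) / 3.
Definition rcor : R := - ((27 + 175 * tau ^+ 2) / (729 + 525 * tau ^+ 2)).

Definition Bk (k : 'I_3) (w : triple) : R := uu R k w + tau * vv R k w.
Definition Mk (k : 'I_3) (w : triple) : R := uu R k w + vv R k w.
(** The subtracted part applies to the vector of the [Bk] the symmetric matrix with eigenvalue
    [kone] on (1,1,1) and [kperp] on its complement. *)
Definition Rk (k : 'I_3) (w : triple) : R :=
  Mk k w - kperp * Bk k w - (kone - kperp) / 3 * \sum_l Bk l w.

Lemma sum3 (F : 'I_3 -> R) : \sum_k F k = F alt_a + F alt_b + F alt_c.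
Proof.
rewrite !big_ord_recl big_ord0 addr0 addrA.
by congr (F _ + F _ + F _); exact: val_inj.
Qed.

Lemma ord3P (j : 'I_3) : [\/ j = alt_a, j = alt_b | j = alt_c].
Proof.
by case: j => [[|[|[|j]]] hj]; [apply: Or31|apply: Or32|apply: Or33|by []];
  apply: val_inj.
Qed.

Let dl (k l : 'I_3) : R := (l == k)%:R.
Let x25 : 27 + 25 * tau ^+ 2 != 0.
Proof.
have h : 0 < 27 + 25 * tau ^+ 2 by have := sqr_ge0 tau; lra.
exact: (lt0r_neq0 h).
Qed.
Let x7 : 27 + 7 * tau ^+ 2 != 0.
Proof.
have h : 0 < 27 + 7 * tau ^+ 2 by have := sqr_ge0 tau; lra.
exact: (lt0r_neq0 h).
Qed.
Let x700 : 729 + 525 * tau ^+ 2 != 0.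
Proof.
have h : 0 < 729 + 525 * tau ^+ 2 by have := sqr_ge0 tau; lra.
exact: (lt0r_neq0 h).
Qed.

Lemma Bk_lc k w : Bk k w = lc (dl k) (fun l => tau * dl k l) w.
Proof.
rewrite /Bk /lc sum3 /dl; case: (ord3P k) => -> /=; ring.
Qed.

Lemma Rk_lc k w : Rk k w = lc (fun l => (1 - kperp) * dl k l - (kone - kperp) / 3)
  (fun l => (1 - kperp * tau) * dl k l - (kone - kperp) / 3 * tau) w.
Proof.
rewrite /Rk /Mk /Bk /lc !sum3 /dl; case: (ord3P k) => -> /=; ring.
Qed.

Lemma mean_Bk k : mean (Bk k) = 0.
Proof. by rewrite (eq_mean (Bk_lc k)) mean_lc0. Qed.

Lemma mean_Rk k : mean (Rk k) = 0.
Proof. by rewrite (eq_mean (Rk_lc k)) mean_lc0. Qed.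

Lemma mean_BB k l : mean (fun w => Bk k w * Bk l w) = if k == l then bvar else bcov.
Proof.
transitivity (mean (fun w => lc (dl k) (fun l => tau * dl k l) w *
   lc (dl l) (fun i => tau * dl l i) w)).
  by apply: eq_mean => w; rewrite !Bk_lc.
rewrite mean_lc !sum3 /cx /dl /bvar /bcov.
by case: (ord3P k) => ->; case: (ord3P l) => -> /=; field.
Qed.

Lemma mean_BR k l : mean (fun w => Bk k w * Rk l w) = 0.
Proof.
transitivity (mean (fun w => lc (dl k) (fun l => tau * dl k l) w *
   lc (fun i => (1 - kperp) * dl l i - (kone - kperp) / 3)
  (fun i => (1 - kperp * tau) * dl l i - (kone - kperp) / 3 * tau) w)).
  by apply: eq_mean => w; rewrite Bk_lc Rk_lc.
rewrite mean_lc !sum3 /cx /dl /kone /kperp.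
by case: (ord3P k) => ->; case: (ord3P l) => -> /=; field; rewrite x25 x7.
Qed.

Lemma mean_RR k l : mean (fun w => Rk k w * Rk l w) = if k == l then rvar else rvar * rcor.
Proof.
transitivity (mean (fun w => lc (fun i => (1 - kperp) * dl k i - (kone - kperp) / 3)
  (fun i => (1 - kperp * tau) * dl k i - (kone - kperp) / 3 * tau) w *
   lc (fun i => (1 - kperp) * dl l i - (kone - kperp) / 3)
  (fun i => (1 - kperp * tau) * dl l i - (kone - kperp) / 3 * tau) w)).
  by apply: eq_mean => w; rewrite !Rk_lc.
rewrite mean_lc !sum3 /cx /dl /kone /kperp /rvar /rcor.
by case: (ord3P k) => ->; case: (ord3P l) => -> /=; field; rewrite ?x25 ?x7 ?x700.
Qed.

Lemma rvar_gt0 : 0 < rvar.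
Proof.
case/andP: tau01 => t0 t1; rewrite /rvar divr_gt0 // mulr_gt0 //.
  by rewrite exprn_gt0 // subr_gt0.
have q := sqr_ge0 tau.
have d1 : 0 < 25 / (4 * (27 + 25 * tau ^+ 2)) by apply: divr_gt0; lra.
have d2 : 0 < 7 / (27 + 7 * tau ^+ 2) by apply: divr_gt0; lra.
lra.
Qed.

Lemma rcor_bounds : -1 < rcor < 1.
Proof.
have q := sqr_ge0 tau; have d0 : 0 < 729 + 525 * tau ^+ 2 by lra.
have n0 : 0 <= 27 + 175 * tau ^+ 2 by lra.
have h0 := divr_ge0 n0 (ltW d0).
have h1 : (27 + 175 * tau ^+ 2) / (729 + 525 * tau ^+ 2) < 1.
  by rewrite ltr_pdivrMr // mul1r; lra.
by rewrite /rcor; move: h0 h1; move: (_ / _) => x h0 h1; apply/andP; split; lra.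
Qed.

Lemma Mk_lincomb k m (w : {ffun 'I_m -> triple}) :
  tot (Mk k) w = lincomb Bk (fun l => kperp * dl k l + (kone - kperp) / 3) (Rk k) w.
Proof.
rewrite /lincomb /tot.
under [X in _ = _ + X]eq_bigr => l _ do rewrite mulr_sumr.
rewrite exchange_big -big_split /=; apply: eq_bigr => j _.
rewrite /Rk !sum3 /dl; case: (ord3P k) => -> /=; ring.
Qed.

(** The walks are generated so that all ten second moments of three [Bk] and two [Rk] agree up to
    symmetry with those of [mean_BB], [mean_BR] and [mean_RR], the angle being [acos rcor]. The
    second limit says that the denominator is eventually nonzero. *)
Lemma joint_limit (i j : 'I_3) (c : R) (Ev Bad : forall m, {ffun 'I_m -> triple} -> bool) :
  i != j -> 0 < c ->
  (fun m => mean (R := R) (fun w : {ffun 'I_m -> triple} => (Bad m w)%:R) / nrm R m) @ \oo --> (0 : R) ->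
  (forall eta, 0 < eta < c -> \forall m \near \oo, forall w : {ffun 'I_m -> triple}, ~~ Bad m w ->
     (inwin Bk (c - eta) w ==> Ev m w) && (Ev m w ==> inwin Bk (c + eta) w)) ->
  (fun m => mean (fun w : {ffun 'I_m -> triple} =>
                    Num.sg (tot (Mk i) w) * Num.sg (tot (Mk j) w) * (Ev m w)%:R) /
            mean (R := R) (fun w : {ffun 'I_m -> triple} => (Ev m w)%:R))
   @ \oo --> 1 - 2 * acos rcor / pi /\
  (fun m => mean (R := R) (fun w : {ffun 'I_m -> triple} => (Ev m w)%:R) /
            mean (R := R) (fun w : {ffun 'I_m -> triple} => (Ev m w)%:R)) @ \oo --> (1 : R).
Proof.
move=> ij c0 hBad hEv.
have /andP[r1 r2] := rcor_bounds.
have rle : -1 <= rcor <= 1 by rewrite !ltW.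
have thp : 0 < acos rcor < pi by rewrite acos_gt0 ?acos_ltpi // ?(ltW r1) ?(ltW r2) ?r1 ?r2.
have cth : cos (acos rcor) = rcor by rewrite acosK // in_itv.
have sth := cos2Dsin2' (acos rcor).
have q := sqr_ge0 tau.
have [a [b [cc [e [f [a0 cc0 f0 [h1 h2 h3 h4 h5]]]]]]] :=
  @cholesky3 bvar bcov ltac:(rewrite /bvar /bcov; lra) ltac:(rewrite /bvar /bcov; lra).
have v0 : 0 < 2 * rvar by rewrite mulr_gt0 // rvar_gt0.
pose g := Num.sqrt (2 * rvar).
have g0 : 0 < g by rewrite sqrtr_gt0.
have g2 : g * g = 2 * rvar by rewrite -expr2 sqr_sqrtr // ltW.
pose Z := coords (Bk (inord 0)) (Bk (inord 1)) (Bk (inord 2)) (Rk i) (Rk j).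
pose E := gens a b cc b e f g (acos rcor).
have i0 : inord 0 = alt_a :> 'I_3 by apply: val_inj; rewrite /= inordK.
have i1 : inord 1 = alt_b :> 'I_3 by apply: val_inj; rewrite /= inordK.
have i2 : inord 2 = alt_c :> 'I_3 by apply: val_inj; rewrite /= inordK.
pose C := \sum_i \sum_t `|Z i t|.
have ZC n t : `|Z n t| <= C.
  rewrite /C (bigD1 n) //= (bigD1 t) //= -addrA lerDl addr_ge0 //; first exact: sumr_ge0.
  by apply: sumr_ge0 => ? _; exact: sumr_ge0.
have Z0 n : mean (Z n) = 0.
  rewrite /Z /coords; case: n => [[|[|[|[|n]]]] hn] /=; rewrite ?mean_Bk ?mean_Rk //.
have mRB k l : mean (fun w => Rk k w * Bk l w) = 0.
  by rewrite -(mean_BR l k); apply: eq_mean => w; rewrite mulrC.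
rewrite cth in sth.
have k1 : g * (g * rcor) = 2 * (rvar * rcor) by rewrite mulrA g2 mulrA.
have k2 : g * rcor * (g * rcor) + g * sin (acos rcor) * (g * sin (acos rcor)) = 2 * rvar.
  by rewrite -g2 -[RHS]mulr1 -sth; ring.
have ZE n n' : mean (fun t => Z n t * Z n' t) = (\sum_l E l n * E l n') / 2.
  rewrite !big_ord_recl big_ord0 /Z /coords /E /gens i0 i1 i2.
  clear hBad hEv ZC C Z0 sth thp rle r1 r2 q a0 cc0 f0 v0 g0 c0 tau01.
  case: n => [[|[|[|[|[|n]]]]] hn] //; case: n' => [[|[|[|[|[|n']]]]] hn'] // /=;
    rewrite ?mean_BB ?mean_BR ?mean_RR ?mRB /= ?eqxx ?(negPf ij) ?[j == i]eq_sym ?(negPf ij) ?cth;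
    rewrite ?(mulr0, mul0r, addr0, add0r); lra.
pose t0 : triple := [ffun=> ranking0].
have hN := N_cvg t0 a0 cc0 f0 g0 thp ZC Z0 ZE
  (fun l => kperp * dl i l + (kone - kperp) / 3) (fun l => kperp * dl j l + (kone - kperp) / 3) c0.
have hD t := D_cvg t0 a0 cc0 f0 ZC Z0 ZE (t := t).
have K0 := kap_gt0 a0 cc0 f0.
split.
  apply: (sandwich_ratio K0 c0 hD _ _ hBad hEv).
    apply: eq_cvg_seq hN => m; congr (_ / _); apply: eq_mean => w.
    by rewrite -!Mk_lincomb.
  by move=> m w; rewrite normrM mulr_ile1 // sg_norm.
have one m (F : {ffun 'I_m -> triple} -> R) : mean (fun w => 1 * F w) = mean F.
  by apply: eq_mean => w; rewrite mul1r.
have n1 (m : nat) (w : {ffun 'I_m -> triple}) : `|1 : R| <= 1 by rewrite normr1.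
have hD1 : (fun m => mean (fun w : {ffun 'I_m -> triple} => 1 * (inwin Bk c w)%:R) / nrm R m)
    @ \oo --> 8 / (a * cc * f) * c ^+ 3 * 1.
  by rewrite mulr1; apply: eq_cvg_seq (hD c c0) => m; rewrite one.
by apply: eq_cvg_seq (sandwich_ratio K0 c0 hD hD1 n1 hBad hEv) => m; rewrite one.
Qed.

End Chol.

(** * The noise operator *)

Section Noise3.
Context (R : realType).

Definition uB (z : cube 3) : R := (\sum_j pm1 R (z j)) / 2.
Definition vB (z : cube 3) : R := - (\prod_j pm1 R (z j)) / 2.
Definition mB (z : cube 3) : R := uB z + vB z.

Lemma maj_sg (z : cube 3) : Num.sg (\sum_j pm1 R (z j)) = mB z.
Proof.
rewrite /mB /uB /vB !big_ord_recl !big_ord0 mulr1 addr0.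
by case: (z _); case: (z _); case: (z _); rewrite /pm1;
  first [by rewrite gtr0_sg; lra | by rewrite ltr0_sg; lra].
Qed.

Lemma mB_sq z : mB z * mB z = 1.
Proof.
rewrite /mB /uB /vB !big_ord_recl !big_ord0 mulr1 addr0.
by case: (z _); case: (z _); case: (z _); rewrite /pm1; field.
Qed.

Lemma uB_sq z : uB z ^+ 2 = 9 / 4 \/ uB z ^+ 2 = 1 / 4.
Proof.
rewrite /uB !big_ord_recl !big_ord0 addr0.
case: (z _); case: (z _); case: (z _); rewrite /pm1;
  by [left; field | right; field].
Qed.

Definition big (z : cube 3) : bool := uB z ^+ 2 == 9 / 4.

Lemma bB_sq tau z : (uB z + tau * vB z) ^+ 2 =
  if big z then ((3 - tau) / 2) ^+ 2 else ((1 + tau) / 2) ^+ 2.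
Proof.
rewrite /big /vB /uB !big_ord_recl !big_ord0 mulr1 addr0.
by case: (z _); case: (z _); case: (z _); rewrite /pm1; case: eqP => h;
  try (by field); exfalso; lra.
Qed.

Context (rho : R).
Context (rho01 : 0 < rho < 1).

Lemma noise_law x : law (@noise R 3 rho x).
Proof.
case/andP: rho01 => r0 r1; split=> [y|].
  by apply: prodr_ge0 => i _; case: ifP => _; lra.
rewrite /noise -(bigA_distr_bigA (fun (i : 'I_3) (b : bool) => if b == x i then 1 - (1 - rho) / 2 else (1 - rho) / 2)).
by rewrite big1 // => i _; rewrite big_bool; case: (x i) => /=; field.
Qed.

Lemma noise_prod (x : cube 3) (g : 'I_3 -> bool -> R) :
  \sum_y noise rho x y * \prod_j g j (y j) =
  \prod_j \sum_b (if b == x j then 1 - (1 - rho) / 2 else (1 - rho) / 2) * g j b.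
Proof.
rewrite bigA_distr_bigA; apply: eq_bigr => y _.
by rewrite /noise -big_split.
Qed.

Lemma noise_pm1 (x : cube 3) j : \sum_y noise rho x y * pm1 R (y j) = rho * pm1 R (x j).
Proof.
pose g (i : 'I_3) (b : bool) : R := if i == j then pm1 R b else 1.
have e (y : cube 3) : \prod_i g i (y i) = pm1 R (y j).
  by rewrite (bigD1 j) //= big1 ?mulr1 /g ?eqxx // => i /negPf ->.
under eq_bigr => y _ do rewrite -e.
rewrite noise_prod (bigD1 j) //= [X in _ * X]big1 ?mulr1.
  by rewrite big_bool /g eqxx /pm1; case: (x j) => /=; field.
by move=> i /negPf ij; rewrite big_bool /g ij; case: (x i) => /=; field.
Qed.

Lemma noise_prod_pm1 (x : cube 3) : \sum_y noise rho x y * \prod_j pm1 R (y j) = rho ^+ 3 * \prod_j pm1 R (x j).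
Proof.
rewrite (noise_prod x (fun _ b => pm1 R b)).
rewrite (eq_bigr (fun j => rho * pm1 R (x j))).
  by rewrite big_split /= prodr_const card_ord.
by move=> j _; rewrite big_bool /pm1; case: (x j) => /=; field.
Qed.

(** Noise multiplies a product of d votes by [rho ^+ d], and the majority has a part of degree 1 and
    a part of degree 3. *)
Lemma noise_mB x : \sum_y noise rho x y * mB y = rho * (uB x + rho ^+ 2 * vB x).
Proof.
transitivity (1 / 2 * (\sum_j \sum_y noise rho x y * pm1 R (y j)) - 1 / 2 * \sum_y noise rho x y * \prod_j pm1 R (y j)).
  rewrite exchange_big /= !mulr_sumr -sumrB; apply: eq_bigr => y _.
  by rewrite -mulr_sumr /mB /uB /vB; field.
rewrite noise_prod_pm1 (eq_bigr _ (fun j _ => noise_pm1 x j)) -mulr_sumr /uB /vB.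
by field.
Qed.

Definition ctr (x y : cube 3) : R := mB y - rho * (uB x + rho ^+ 2 * vB x).

Lemma noise_ctr x : \sum_y noise rho x y * ctr x y = 0.
Proof.
have [_ h1] := noise_law x.
rewrite /ctr; under eq_bigr => y _ do rewrite mulrBr.
by rewrite sumrB noise_mB -mulr_suml h1 mul1r subrr.
Qed.

(* The noised majority of a block has variance [sg1^2 / 2] if the three votes
   agree (the block is [big]) and [sg2^2 / 2] otherwise. *)
Definition sg1 : R := Num.sqrt (2 * (1 - (rho * ((3 - rho ^+ 2) / 2)) ^+ 2)).
Definition sg2 : R := Num.sqrt (2 * (1 - (rho * ((1 + rho ^+ 2) / 2)) ^+ 2)).

Lemma q_bounds : 0 < (rho * ((3 - rho ^+ 2) / 2)) ^+ 2 < 1 /\ 0 < (rho * ((1 + rho ^+ 2) / 2)) ^+ 2 < 1.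
Proof.
case/andP: rho01 => r0 r1.
have r2 : rho ^+ 2 < 1 by rewrite expr_lt1 // ltW.
have r20 : 0 < rho ^+ 2 by rewrite exprn_gt0.
have a1 : 0 < rho * ((3 - rho ^+ 2) / 2) by rewrite mulr_gt0 //; lra.
have a2 : 0 < rho * ((1 + rho ^+ 2) / 2) by rewrite mulr_gt0 //; lra.
have b1 : rho * ((3 - rho ^+ 2) / 2) < 1.
  have : 0 < (1 - rho) ^+ 2 * (2 + rho) by rewrite mulr_gt0 ?exprn_gt0 //; lra.
  have -> : (1 - rho) ^+ 2 * (2 + rho) = 2 * (1 - rho * ((3 - rho ^+ 2) / 2)) by field.
  lra.
have b2 : rho * ((1 + rho ^+ 2) / 2) < 1.
  apply: (@lt_trans _ _ (rho * 1)); last by rewrite mulr1.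
  by rewrite ltr_pM2l //; lra.
split; apply/andP; split; rewrite ?exprn_gt0 // expr_lt1 // ltW //.
Qed.

Lemma sg1_sq : sg1 * sg1 = 2 * (1 - (rho * ((3 - rho ^+ 2) / 2)) ^+ 2) /\ 0 < sg1.
Proof.
have [/andP[_ h] _] := q_bounds.
have h2 : 0 < 2 * (1 - (rho * ((3 - rho ^+ 2) / 2)) ^+ 2) by lra.
by split; [rewrite -expr2 sqr_sqrtr // ltW|rewrite sqrtr_gt0].
Qed.

Lemma sg2_sq : sg2 * sg2 = 2 * (1 - (rho * ((1 + rho ^+ 2) / 2)) ^+ 2) /\ 0 < sg2.
Proof.
have [_ /andP[_ h]] := q_bounds.
have h2 : 0 < 2 * (1 - (rho * ((1 + rho ^+ 2) / 2)) ^+ 2) by lra.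
by split; [rewrite -expr2 sqr_sqrtr // ltW|rewrite sqrtr_gt0].
Qed.

Definition sgx (x : cube 3) : R := if big x then sg1 else sg2.

Lemma noise_ctr2 x : \sum_y noise rho x y * (ctr x y * ctr x y) = sgx x * sgx x / 2.
Proof.
have [_ h1] := noise_law x.
set q := rho * (uB x + rho ^+ 2 * vB x).
transitivity (1 - q ^+ 2).
  transitivity (\sum_y (noise rho x y - 2 * q * (noise rho x y * mB y) + q ^+ 2 * noise rho x y)).
    apply: eq_bigr => y _; rewrite /ctr -/q.
    have -> : noise rho x y * ((mB y - q) * (mB y - q)) =
      noise rho x y * (mB y * mB y) - 2 * q * (noise rho x y * mB y) + q ^+ 2 * noise rho x y by ring.
    by rewrite mB_sq mulr1.
  rewrite big_split sumrB /= -!mulr_sumr h1 noise_mB -/q; ring.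
rewrite /q exprMn bB_sq /sgx; case: ifP => _.
  by have [-> _] := sg1_sq; field.
by have [-> _] := sg2_sq; field.
Qed.

Lemma mB_norm z : `|mB z| = 1.
Proof.
have h := mB_sq z; apply/eqP; rewrite -(@eqrXn2 _ 2) // expr1n -normrX expr2 h normr1 //.
Qed.

Lemma ctr_norm x y : `|ctr x y| <= 2.
Proof.
have [/andP[_ q1] /andP[_ q2]] := q_bounds.
apply: (le_trans (ler_normB _ _)); rewrite mB_norm.
suff : `|rho * (uB x + rho ^+ 2 * vB x)| <= 1 by lra.
rewrite -(@ler_pXn2r _ 2) ?nnegrE // expr1n -normrX ger0_norm ?sqr_ge0 //.
by rewrite exprMn bB_sq; case: ifP => _; rewrite -exprMn ltW.
Qed.

(** Two of the eight vote patterns are unanimous, so a uniform block is [big] with probability 1/4;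
    the square is the corresponding average of those of [sg1] and [sg2]. *)
Definition sgm : R := Num.sqrt ((sg1 * sg1 + 3 * (sg2 * sg2)) / 4).

Lemma sgm_sq : 4 * (sgm * sgm) = sg1 * sg1 + 3 * (sg2 * sg2) /\ 0 < sgm.
Proof.
have [_ h1] := sg1_sq; have [_ h2] := sg2_sq.
have h3 : 0 < (sg1 * sg1 + 3 * (sg2 * sg2)) / 4 by rewrite divr_gt0 // addr_gt0 // !mulr_gt0.
split; last by rewrite sqrtr_gt0.
by rewrite -expr2 sqr_sqrtr ?(ltW h3) //; field.
Qed.

End Noise3.

Lemma subn_quarter m k r : (m = 4 * k + r -> m - k = 3 * k + r)%N.
Proof. lia. Qed.

Lemma split_quarter k r : (4 * k + r = r + (k + 3 * k))%N.
Proof. lia. Qed.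

Lemma triple_add k : (3 * k = k + (k + k))%N.
Proof. lia. Qed.

Lemma subn_chain m n k : (k <= n -> n <= m -> m - n + (n - k) = m - k)%N.
Proof. lia. Qed.

(** * Replacing the noise by a walk of constant variance *)

Section Uwalk.
Context (R : realType) (V : zmodType).

Lemma uwalkC (T T' : finType) m n (X : T -> V) (Y : T' -> V) (phi : V -> R) z :
  uwalk m X (uwalk n Y phi) z = uwalk n Y (uwalk m X phi) z.
Proof.
elim: n z => [//|n IH] z.
transitivity (uconv Y (uwalk m X (uwalk n Y phi)) z).
  by rewrite /uconv -walk_conv; apply: eq_walk => y.
by apply: eq_conv => y; exact: IH.
Qed.

Lemma uwalkD (T : finType) m n (X : T -> V) (phi : V -> R) z :
  uwalk (m + n) X phi z = uwalk m X (uwalk n X phi) z.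
Proof.
elim: m z => [//|m IH] z.
by rewrite addSn; apply: eq_conv => y; exact: IH.
Qed.

Lemma eq_uwalk (T : finType) m (X : T -> V) (phi psi : V -> R) z : phi =1 psi ->
  uwalk m X phi z = uwalk m X psi z.
Proof. by move=> h; apply: eq_walk. Qed.

Lemma uwalk_close (T : finType) (t0 : T) m (X : T -> V) (phi psi : V -> R) e z :
  (forall x, `|phi x - psi x| <= e) -> `|uwalk m X phi z - uwalk m X psi z| <= e.
Proof.
move=> h; rewrite /uwalk -walkB; apply: walk_norm => // n _; exact: unif_law.
Qed.

Lemma uwalk_swap (T T' : finType) (t0 : T) (t0' : T') m (X : T -> V) (Y : T' -> V) (phi : V -> R) e z :
  (forall x, `|uconv X phi x - uconv Y phi x| <= e) ->
  `|uwalk m X phi z - uwalk m Y phi z| <= m%:R * e.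
Proof.
move=> h; have -> : m%:R * e = \sum_(n < m) e by rewrite sumr_const card_ord mulr_natl.
by apply: (@lindeberg _ _ _ _ m _ _ _ _ _ (fun=> e)) => [n _|n _|n x _];
  [exact: unif_law|exact: unif_law|exact: h].
Qed.

(** Centring alone removes the linear term and leaves a second-order cost. This is affordable only
    for the few steps whose variances stay unmatched. *)
Lemma one_step d (l : 'I_d -> V -> R) phi K (T : finType) (p : T -> R) X N z :
  smooth_at l phi K -> 0 <= K -> law p -> 0 <= N <= 1 -> (forall t i, `|l i (X t)| <= N) ->
  (forall i, \sum_t p t * l i (X t) = 0) ->
  `|conv p X phi z - phi z| <= 2 * K * N ^+ 2.
Proof.
move=> hphi K0 [p0 p1] /[dup] N01 /andP[N0 N1] hX m1.
have [_ [a [Q h]]] := hphi z.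
have L0 : \sum_t p t * lin l a (X t) = 0.
  transitivity (\sum_i a i * (\sum_t p t * l i (X t))).
    rewrite /lin; under eq_bigr => t _ do rewrite mulr_sumr.
    rewrite exchange_big; apply: eq_bigr => i _; rewrite mulr_sumr.
    by apply: eq_bigr => t _; rewrite mulrCA.
  by rewrite big1 // => i _; rewrite m1 mulr0.
have -> : conv p X phi z - phi z = \sum_t p t * (phi (z + X t) - phi z - lin l a (X t)).
  transitivity (conv p X phi z - (\sum_t p t) * phi z - \sum_t p t * lin l a (X t)).
    by rewrite p1 L0 mul1r subr0.
  rewrite /conv mulr_suml -!sumrB.
  by apply: eq_bigr => t _; ring.
apply: (le_trans (ler_norm_sum _ _ _)).
have -> : 2 * K * N ^+ 2 = \sum_t p t * (2 * K * N ^+ 2) by rewrite -mulr_suml p1 mul1r.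
apply: ler_sum => t _.
rewrite normrM ger0_norm // ler_wpM2l //.
have [_ hq hr] := h (X t) N N01 (hX t).
have -> : phi (z + X t) - phi z - lin l a (X t) =
  (phi (z + X t) - phi z - lin l a (X t) - quad l Q (X t)) + quad l Q (X t) by ring.
apply: (le_trans (ler_normD _ _)).
have N32 : K * N ^+ 3 <= K * N ^+ 2.
  by rewrite ler_wpM2l // exprS ler_piMl // exprn_ge0.
have -> : 2 * K * N ^+ 2 = K * N ^+ 2 + K * N ^+ 2 by ring.
by apply: lerD => //; exact: le_trans N32.
Qed.

End Uwalk.

Section Compare.
Context (R : realType) (rho : R).
Context (rho01 : 0 < rho < 1).

Definition l1 (i : 'I_1) (z : R^o) : R := z.

Let bb := (bool * bool)%type.
Let tt : bb := (true, true).

Definition nbig (x : nat -> cube 3) (m : nat) : nat := \sum_(n < m) big R (x n).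

Lemma nbig_le x m : (nbig x m <= m)%N.
Proof.
rewrite /nbig -[leqRHS]card_ord -sum1_card; apply: leq_sum => i _; exact: leq_b1.
Qed.

Context (w K : R) (phi : R^o -> R).
Context (w8 : 8 <= w) (K0 : 0 <= K) (hphi : smooth_at l1 phi K).

(** Four steps, each of size at most [2 / w], will be grouped together. *)
Let N : R := 8 / w.
Let st (s : R) (t : bb) : R^o := xi R t *: (s / w : R^o).
Let w0 : 0 < w. Proof. by have := w8; lra. Qed.
Let N01 : 0 <= N <= 1.
Proof.
by apply/andP; split; [apply: divr_ge0 => //; exact: ltW|rewrite /N ler_pdivrMr // mul1r].
Qed.

Let sg_le2 : [/\ 0 < sg1 rho <= 2, 0 < sg2 rho <= 2 & 0 < sgm rho <= 2].
Proof.
have [e1 p1] := sg1_sq rho01; have [e2 p2] := sg2_sq rho01; have [e3 p3] := sgm_sq rho01.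
have [/andP[q1 _] /andP[q2 _]] := q_bounds rho01.
have H (s : R) : 0 < s -> s * s <= 4 -> s <= 2.
  move=> s0 h; rewrite -(@ler_pXn2r _ 2) ?nnegrE ?(ltW s0) // expr2.
  by apply: (le_trans h); rewrite expr2; lra.
by split; apply/andP; split => //; apply: H => //; lra.
Qed.

Let st_norm2 s t : 0 < s <= 2 -> `|st s t| <= 2 / w.
Proof.
move=> /andP[s0 s2]; rewrite /st /GRing.scale /= normrM normrM normfV (gtr0_norm w0) (gtr0_norm s0) mulrA.
rewrite ler_pM2r ?invr_gt0 //; apply: (@le_trans _ _ (1 * 2)); last lra.
by apply: ler_pM => //; [exact: ltW|exact: xi_norm].
Qed.

Let st_norm s t : 0 < s <= 2 -> `|st s t| <= N.
Proof.
move=> s2; apply: (le_trans (st_norm2 t s2)).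
by rewrite /N ler_pM2r ?invr_gt0 //; lra.
Qed.

Let st_mean s : mean (fun t => l1 ord0 (st s t)) = 0.
Proof. exact: mean_xi. Qed.

Let st_mean2 s : mean (fun t => l1 ord0 (st s t) * l1 ord0 (st s t)) = s * s / 2 / w ^+ 2.
Proof.
rewrite (mean_xi2 (s / w) (s / w)); field; by rewrite gt_eqF.
Qed.

Lemma compare_sym x m z :
  `|walk m (fun n => noise rho (x n)) (fun n y => ctr rho (x n) y / w : R^o) phi z
    - walk m (fun=> unif R (T := bb)) (fun n => st (sgx rho (x n))) phi z|
  <= m%:R * (2 * K * N ^+ 3).
Proof.
have -> : m%:R * (2 * K * N ^+ 3) = \sum_(n < m) 2 * K * N ^+ 3.
  by rewrite sumr_const card_ord mulr_natl.
have [b1 b2 _] := sg_le2.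
have sx n : 0 < sgx rho (x n) <= 2 by rewrite /sgx; case: ifP.
apply: (@lindeberg _ _ _ _ m _ _ _ _ _ (fun=> 2 * K * N ^+ 3)) => [n _|n _|n z' _].
- exact: noise_law.
- exact: (unif_law R tt).
apply: (smooth_match (l := l1) _ hphi).
- exact: noise_law.
- exact: (unif_law R tt).
- exact: N01.
- move=> y i; rewrite /l1 normrM normfV (gtr0_norm w0) /N ler_pM2r ?invr_gt0 //.
  by apply: (le_trans (ctr_norm rho01 _ _)); lra.
- by move=> t i; rewrite /l1; apply: st_norm.
- move=> i; rewrite /l1; transitivity (0 : R); last by symmetry; exact: (st_mean (sgx rho (x n))).
  transitivity ((\sum_y noise rho (x n) y * ctr rho (x n) y) / w).
    by rewrite mulr_suml; apply: eq_bigr => y _; rewrite mulrA.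
  by rewrite (noise_ctr rho01) mul0r.
- move=> i j; rewrite /l1.
  transitivity (sgx rho (x n) * sgx rho (x n) / 2 / w ^+ 2).
    rewrite -(noise_ctr2 rho01) mulr_suml; apply: eq_bigr => y _.
    by field; rewrite gt_eqF.
  by symmetry; exact: (st_mean2 (sgx rho (x n))).
Qed.

(** Increments commute, so only the number of [big] blocks matters, not their positions. *)
Lemma walk_split x m z :
  walk m (fun=> unif R (T := bb)) (fun n => st (sgx rho (x n))) phi z =
  uwalk (nbig x m) (st (sg1 rho)) (uwalk (m - nbig x m) (st (sg2 rho)) phi) z.
Proof.
elim: m z => [|m IH] z; first by rewrite /nbig big_ord0.
rewrite [LHS]/= (eq_conv _ _ _ IH) /nbig big_ord_recr /= -/(nbig x m) /sgx.
case: (big R (x m)).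
  rewrite addn1 subSS; exact: erefl.
rewrite addn0 subSn ?nbig_le // /uwalk -walk_conv; exact: eq_walk.
Qed.

Let eps2 (s s' : R) z : 0 < s <= 2 -> 0 < s' <= 2 ->
  `|uconv (st s) phi z - uconv (st s') phi z| <= 4 * K * N ^+ 2.
Proof.
move=> s2 s2'.
have O (r : R) : 0 < r <= 2 -> `|uconv (st r) phi z - phi z| <= 2 * K * N ^+ 2.
  move=> r2; apply: (one_step (l := l1) _ hphi K0 _ N01).
  - exact: (unif_law R tt).
  - by move=> t i; apply: st_norm.
  - by move=> i; exact: st_mean.
have -> : uconv (st s) phi z - uconv (st s') phi z =
  (uconv (st s) phi z - phi z) - (uconv (st s') phi z - phi z) by ring.
apply: (le_trans (ler_normB _ _)).
have -> : 4 * K * N ^+ 2 = 2 * K * N ^+ 2 + 2 * K * N ^+ 2 by ring.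
by apply: lerD; exact: O.
Qed.

Let X1 := st (sg1 rho).
Let X2 := st (sg2 rho).
Let X0 := st (sgm rho).

Let e2 : R := 4 * K * N ^+ 2.

Let rebalance (k j r : nat) z :
  `|uwalk (k + j) X1 (uwalk r X2 phi) z - uwalk k X1 (uwalk (r + j) X2 phi) z| <= j%:R * e2.
Proof.
have [b1 b2 _] := sg_le2.
have -> : uwalk (k + j) X1 (uwalk r X2 phi) z = uwalk k X1 (uwalk r X2 (uwalk j X1 phi)) z.
  by rewrite uwalkD; apply: eq_uwalk => y; exact: uwalkC.
have -> : uwalk k X1 (uwalk (r + j) X2 phi) z = uwalk k X1 (uwalk r X2 (uwalk j X2 phi)) z.
  by apply: eq_uwalk => y; exact: uwalkD.
apply: (uwalk_close tt) => y; apply: (uwalk_close tt) => y'.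
by apply: (uwalk_swap tt tt) => y''; exact: eps2.
Qed.

Let T4 := (bb * bb * bb * bb)%type.
(** One step of scale [sg1] with three of scale [sg2] has the variance of four steps of scale [sgm],
    so a whole group is exchanged at third-order cost. *)
Let blk (s s' : R) (t : T4) : R^o := st s t.1.1.1 + st s' t.1.1.2 + st s' t.1.2 + st s' t.2.

Let blk_walk s s' k z (f : R^o -> R) : uwalk k (blk s s') f z = uwalk k (st s) (uwalk (3 * k) (st s') f) z.
Proof.
rewrite (uwalk_pair k (fun t : bb * bb * bb => st s t.1.1 + st s' t.1.2 + st s' t.2) (st s')).
rewrite (uwalk_pair k (fun t : bb * bb => st s t.1 + st s' t.2) (st s')).
rewrite (uwalk_pair k (st s) (st s')).
apply: eq_uwalk => y; rewrite triple_add.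
by rewrite uwalkD; apply: eq_uwalk => y'; rewrite uwalkD.
Qed.

Let blk_moments s s' : 0 < s <= 2 -> 0 < s' <= 2 ->
  [/\ forall t, `|blk s s' t| <= N,
      mean (blk s s' : T4 -> R) = 0 &
      mean (fun t => (blk s s' t * blk s s' t : R)) = (s * s + 3 * (s' * s')) / 2 / w ^+ 2].
Proof.
move=> b b'; split.
- move=> t; have h1 := st_norm2 t.1.1.1 b; have h2 := st_norm2 t.1.1.2 b'.
  have h3 := st_norm2 t.1.2 b'; have h4 := st_norm2 t.2 b'.
  rewrite /blk; have -> : N = 2 / w + 2 / w + 2 / w + 2 / w by rewrite /N; ring.
  by do 3 (apply: (le_trans (ler_normD _ _)); apply: lerD => //).
- rewrite /blk (meanD (fun t : T4 => (st s t.1.1.1 + st s' t.1.1.2 + st s' t.1.2 : R)) (fun t => st s' t.2)).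
  rewrite (mean_fst tt (fun t : bb * bb * bb => (st s t.1.1 + st s' t.1.2 + st s' t.2 : R))).
  rewrite (mean_snd (tt, tt, tt) (st s' : bb -> R)) (st_mean s') addr0.
  rewrite (meanD (fun t : bb * bb * bb => (st s t.1.1 + st s' t.1.2 : R)) (fun t => st s' t.2)).
  rewrite (mean_fst tt (fun t : bb * bb => (st s t.1 + st s' t.2 : R))).
  rewrite (mean_snd (tt, tt) (st s' : bb -> R)) (st_mean s') addr0.
  rewrite (meanD (fun t : bb * bb => (st s t.1 : R)) (fun t => st s' t.2)).
  rewrite (mean_fst tt (st s : bb -> R)).
  by rewrite (mean_snd tt (st s' : bb -> R)) (st_mean s') (st_mean s) addr0.
- have z1 : mean (st s : bb -> R) = 0 := st_mean s.
  have z1' : mean (st s' : bb -> R) = 0 := st_mean s'.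
  have z2 : mean (fun t : bb * bb => (st s t.1 + st s' t.2 : R)) = 0.
    rewrite (meanD (fun t : bb * bb => (st s t.1 : R)) (fun t => st s' t.2)).
    by rewrite (mean_fst tt (st s : bb -> R)) (mean_snd tt (st s' : bb -> R)) z1 z1' addr0.
  have z3 : mean (fun t : bb * bb * bb => (st s t.1.1 + st s' t.1.2 + st s' t.2 : R)) = 0.
    rewrite (meanD (fun t : bb * bb * bb => (st s t.1.1 + st s' t.1.2 : R)) (fun t => st s' t.2)).
    rewrite (mean_fst tt (fun t : bb * bb => (st s t.1 + st s' t.2 : R))) z2.
    by rewrite (mean_snd (tt, tt) (st s' : bb -> R)) z1' addr0.
  rewrite (mean_pair2 (tt, tt, tt) tt (f := fun t : bb * bb * bb => (st s t.1.1 + st s' t.1.2 + st s' t.2 : R))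
    (f' := fun t : bb * bb * bb => (st s t.1.1 + st s' t.1.2 + st s' t.2 : R)) (st s') (st s') z3 z3).
  rewrite (mean_pair2 (tt, tt) tt (f := fun t : bb * bb => (st s t.1 + st s' t.2 : R))
    (f' := fun t : bb * bb => (st s t.1 + st s' t.2 : R)) (st s') (st s') z2 z2).
  rewrite (mean_pair2 tt tt (f := st s) (f' := st s) (st s') (st s') z1 z1).
  rewrite (st_mean2 s) (st_mean2 s'); field; by rewrite gt_eqF.
Qed.

Let blk_eps z : `|uconv (blk (sg1 rho) (sg2 rho)) phi z
   - uconv (blk (sgm rho) (sgm rho)) phi z| <= 2 * K * N ^+ 3.
Proof.
have [b1 b2 b3] := sg_le2.
have [n1 z1 v1] := blk_moments b1 b2; have [n2 z2 v2] := blk_moments b3 b3.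
apply: (smooth_match (l := l1) _ hphi).
- exact: (unif_law R (tt, tt, tt, tt)).
- exact: (unif_law R (tt, tt, tt, tt)).
- exact: N01.
- by move=> t i; exact: n1.
- by move=> t i; exact: n2.
- by move=> i; transitivity (0 : R); [exact: z1|symmetry; exact: z2].
- move=> i j; transitivity ((sgm rho * sgm rho + 3 * (sgm rho * sgm rho)) / 2 / w ^+ 2);
    last by symmetry; exact: v2.
  rewrite (_ : sgm rho * sgm rho + 3 * (sgm rho * sgm rho) = 4 * (sgm rho * sgm rho)); last by ring.
  have [-> _] := sgm_sq rho01; exact: v1.
Qed.

Let blocks m z : `|uwalk (m %/ 4) X1 (uwalk (m - m %/ 4) X2 phi) z - uwalk m X0 phi z|
   <= (m %/ 4)%:R * (2 * K * N ^+ 3) + (m %% 4)%:R * e2.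
Proof.
have [b1 b2 b3] := sg_le2.
set k := (m %/ 4)%N; set r := (m %% 4)%N.
have em : m = (4 * k + r)%N by rewrite {1}(divn_eq m 4) mulnC.
clearbody k r.
have e1 := subn_quarter em.
have E1 : uwalk k X1 (uwalk (m - k) X2 phi) z =
   uwalk r X2 (uwalk k (blk (sg1 rho) (sg2 rho)) phi) z.
  rewrite e1 [RHS]uwalkC blk_walk; apply: eq_uwalk => y; exact: uwalkD.
have E2 : uwalk m X0 phi z = uwalk r X0 (uwalk k (blk (sgm rho) (sgm rho)) phi) z.
  rewrite em split_quarter.
  rewrite uwalkD; apply: eq_uwalk => y; rewrite blk_walk; exact: uwalkD.
rewrite E1 E2.
set F := uwalk k (blk (sg1 rho) (sg2 rho)) phi.
set F' := uwalk k (blk (sgm rho) (sgm rho)) phi.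
have -> : uwalk r X2 F z - uwalk r X0 F' z =
  (uwalk r X0 F z - uwalk r X0 F' z) + (uwalk r X2 F z - uwalk r X0 F z) by ring.
apply: (le_trans (ler_normD _ _)); apply: lerD.
  apply: (uwalk_close tt) => y.
  by apply: (uwalk_swap (tt, tt, tt, tt) (tt, tt, tt, tt)) => y'; exact: blk_eps.
have -> : uwalk r X2 F z - uwalk r X0 F z =
  uwalk k (blk (sg1 rho) (sg2 rho)) (uwalk r X2 phi) z - uwalk k (blk (sg1 rho) (sg2 rho)) (uwalk r X0 phi) z.
  by congr (_ - _); exact: uwalkC.
apply: (uwalk_close (tt, tt, tt, tt)) => y.
by apply: (uwalk_swap tt tt) => y'; exact: eps2.
Qed.

(** The noised blocks become lattice steps of equal variance; enough of these change scale to make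
    the proportion of [big] ones 1/4; finally groups of four are exchanged. Only the middle stage
    and the remainder modulo 4 are of second order. *)
Lemma noise_walk_compare x m z :
  `|walk m (fun n => noise rho (x n)) (fun n y => ctr rho (x n) y / w : R^o) phi z
    - lat m (fun k => phi (z + k * (sgm rho / w)))|
  <= m%:R * (4 * K * (8 / w) ^+ 3)
     + (`|4 * (nbig x m)%:R - m%:R| + 4) * (4 * K * (8 / w) ^+ 2).
Proof.
have -> : lat m (fun k => phi (z + k * (sgm rho / w))) = uwalk m X0 phi z.
  by rewrite /X0 /st walk_lat.
have h1 := compare_sym x m z; rewrite walk_split -/X1 -/X2 in h1.
have h2 := blocks m z.
set n1 := nbig x m in h1 *; set k := (m %/ 4)%N in h2.
have n1m : (n1 <= m)%N by exact: nbig_le.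
have km : (k <= m)%N by exact: leq_div.
have e20 : 0 <= e2.
  by rewrite /e2 mulr_ge0 ?exprn_ge0 //; [rewrite mulr_ge0|case/andP: N01].
have e30 : 0 <= 2 * K * N ^+ 3.
  by rewrite mulr_ge0 ?exprn_ge0 //; [rewrite mulr_ge0|case/andP: N01].
have r4 : (m %% 4 < 4)%N by rewrite ltn_mod.
have em : m = (4 * k + m %% 4)%N by rewrite {1}(divn_eq m 4) mulnC.
have kR : 4 * k%:R + (m %% 4)%:R = m%:R :> R by rewrite {2}em natrD natrM.
have rR : 0 <= ((m %% 4)%:R : R) <= 3 by rewrite ler0n /= ler_nat -ltnS.
move: em kR rR h2; set r := (m %% 4)%N => em kR rR h2; clearbody k r n1.
(* As [k] is the integer part of [m / 4], the number of steps to convert is at most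
   [|4 * n1 - m| + 1]. *)
have h3 : `|uwalk n1 X1 (uwalk (m - n1) X2 phi) z - uwalk k X1 (uwalk (m - k) X2 phi) z|
    <= (`|4 * n1%:R - m%:R| + 1) * e2.
  have T (j : nat) u v : `|uwalk u X1 (uwalk (m - u) X2 phi) z - uwalk v X1 (uwalk (m - v) X2 phi) z|
      <= j%:R * e2 -> (j%:R <= `|4 * n1%:R - m%:R| + 1 :> R) -> `|uwalk u X1 (uwalk (m - u) X2 phi) z - uwalk v X1 (uwalk (m - v) X2 phi) z|
      <= (`|4 * n1%:R - m%:R| + 1) * e2.
    by move=> a b; apply: (le_trans a); rewrite ler_wpM2r.
  case: (leqP k n1) => kn.
    apply: (T (n1 - k)%N).
      have := rebalance k (n1 - k) (m - n1) z.
      by rewrite subnKC // subn_chain.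
    rewrite natrB //; have := ler_norm (4 * n1%:R - m%:R : R); have := normr_ge0 (4 * n1%:R - m%:R : R).
    have : 0 <= n1%:R - k%:R :> R by rewrite subr_ge0 ler_nat.
    case/andP: rR; move: (`| _ |) => A; lra.
  rewrite distrC; have := rebalance n1 (k - n1) (m - k) z.
  rewrite subnKC ?(ltnW kn) // subn_chain ?(ltnW kn) //.
  move/le_trans; apply; rewrite ler_wpM2r // natrB ?(ltnW kn) //.
  have := ler_norm (- (4 * n1%:R - m%:R) : R); rewrite normrN; have := normr_ge0 (4 * n1%:R - m%:R : R).
  have : 0 <= k%:R - n1%:R :> R by rewrite subr_ge0 ler_nat ltnW.
  case/andP: rR; move: (`| _ |) => A; lra.
have -> : 4 * K * (8 / w) ^+ 3 = 2 * (2 * K * N ^+ 3) by rewrite /N; ring.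
rewrite -/N -/e2.
set A := walk _ _ _ _ _; set D := uwalk m X0 phi z.
set B1 := uwalk n1 X1 _ z in h1 h3; set C1 := uwalk k X1 _ z in h2 h3.
have -> : A - D = (A - B1) + (B1 - C1) + (C1 - D) by ring.
apply: (le_trans (ler_normD _ _)).
apply: (le_trans (lerD (ler_normD _ _) (lexx _))).
apply: (le_trans (lerD (lerD h1 h3) h2)).
have q1 : k%:R * (2 * K * N ^+ 3) <= m%:R * (2 * K * N ^+ 3).
  by rewrite ler_wpM2r // ler_nat.
have q2 : r%:R * e2 <= 3 * e2 by case/andP: rR => _ h; rewrite ler_wpM2r.
lra.
Qed.

End Compare.

(** * From the level of the noise operator to a window *)

Section Threshold.
Context (R : realType).

Definition sgp (y : R) : R := if 0 <= y then 1 else -1.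

Lemma lat_half m (g : R -> R) : lat m g = lat m (fun k => (g k + g (- k)) / 2).
Proof. by rewrite latZr latD lat_opp; field. Qed.

(** Pairing [k] with [- k]: when [|k * l| > b'], the signs of [b + k * l] and [b - k * l] are not
    both positive and their mean is at most 0. What remains is a window probability. *)
Lemma lat_sgp_le m l b b' : b <= b' -> 0 <= b' ->
  lat m (fun k => sgp (b + k * l)) <= win m 0 l b'.
Proof.
move=> bb b0; rewrite lat_half; apply: lat_mono => k; rewrite add0r mulrC [l * k]mulrC.
rewrite mulNr /sgp; case: (leP `|k * l| b') => h /=.
  by case: ifP => _; case: ifP => _; lra.
case: (leP 0 (b + k * l)) => h1; case: (leP 0 (b - k * l)) => h2; try lra.
have : `|k * l| <= b' by rewrite ler_norml; lra.
lra.
Qed.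

Lemma lat_sgp_neg m l b c : 0 <= c -> b < - c ->
  lat m (fun k => sgp (b + k * l)) <= - win m 0 l c.
Proof.
move=> c0 bc; rewrite lat_half /win -[leRHS]mulN1r -latZ; apply: lat_mono => k.
rewrite add0r mulrC [l * k]mulrC mulNr /sgp; case: (leP `|k * l| c) => h /=.
  have := h; rewrite ler_norml => /andP[h1 h2].
  case: (leP 0 (b + k * l)) => h3; first lra.
  case: (leP 0 (b - k * l)) => h4; lra.
case: (leP 0 (b + k * l)) => h3; case: (leP 0 (b - k * l)) => h4; lra.
Qed.

Lemma sg_le_ssg (eta x : R) : 0 < eta -> Num.sg x <= ssg eta (x + eta).
Proof.
move=> e0; have := ssg_norm eta (x + eta); rewrite ler_norml => /andP[s1 _].
case: (ltgtP x 0) => x0.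
- by rewrite ltr0_sg //; lra.
- have h := sg_ssg (x + eta) e0.
  rewrite gtr0_sg //; move: h; rewrite gtr0_sg; last lra.
  case: (leP `|x + eta| eta) => [hh|_]; first by have := ler_norm (x + eta); lra.
  by rewrite mulr0 normr_le0 subr_eq0 => /eqP <-.
- have e : (2 * eta)^-1 * eta = 1 / 2 by field; rewrite gt_eqF.
  by rewrite x0 sgr0 add0r /ssg e step1; lra.
Qed.

Lemma ssg_le_sgp (eta x : R) : 0 < eta -> ssg eta (x + eta) <= sgp (x + 2 * eta).
Proof.
move=> e0; have := ssg_norm eta (x + eta); rewrite ler_norml => /andP[_ s1].
rewrite /sgp; case: (leP 0 (x + 2 * eta)) => // h.
rewrite /ssg step0; first lra.
suff : (2 * eta)^-1 * (x + eta) <= - (1 / 2) by lra.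
by rewrite mulrC ler_pdivrMr; lra.
Qed.

Lemma ssgN (eta x : R) : 0 < eta -> - sgp (- x + 2 * eta) <= ssg eta (x - eta) <= Num.sg x.
Proof.
move=> e0; have := ssg_norm eta (x - eta); rewrite ler_norml => /andP[s1 s2].
apply/andP; split.
  rewrite /sgp; case: (leP 0 (- x + 2 * eta)) => h //; rewrite opprK /ssg step1; first lra.
  suff : 1 / 2 <= (2 * eta)^-1 * (x - eta) by lra.
  by rewrite [leRHS]mulrC ler_pdivlMr; lra.
case: (ltgtP x 0) => x0.
- rewrite ltr0_sg // /ssg step0; first lra.
  suff : (2 * eta)^-1 * (x - eta) <= - (1 / 2) by lra.
  by rewrite mulrC ler_pdivrMr; lra.
- by rewrite gtr0_sg.
- rewrite x0 sgr0 add0r /ssg step0; first lra.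
  suff : (2 * eta)^-1 * - eta <= - (1 / 2) by lra.
  by rewrite mulrC ler_pdivrMr; lra.
Qed.

Lemma smooth_ssg_shift eta d : smooth (@l1 R) (fun z : R^o => ssg eta (z + d)).
Proof.
have -> : (fun z : R^o => ssg eta (z + d)) =
  (fun z : R^o => 2 * step ((2 * eta)^-1 * l1 ord0 z + ((2 * eta)^-1 * d + 1 / 2)) + (-1)).
  by apply/funext => z; rewrite /ssg /l1 mulrDr addrA.
apply: smoothD; last exact: smooth_cst.
by apply: smoothZ; apply: smooth_step.
Qed.

Context (rho : R).
Context (rho01 : 0 < rho < 1).

Definition sumB (x : nat -> cube 3) (m : nat) : R :=
  \sum_(n < m) (uB R (x n) + rho ^+ 2 * vB R (x n)).

Definition Tval (x : nat -> cube 3) (m : nat) : R :=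
  walk m (fun n => noise rho (x n)) (fun _ y => mB R y : R^o) (fun z : R^o => Num.sg (z : R)) 0.

(** The sign is scale free, and centring the noised majorities moves their conditional mean
    [rho * sumB] into the starting point. *)
Lemma Tval_scaled x m w : 0 < w ->
  Tval x m = walk m (fun n => noise rho (x n)) (fun n y => ctr rho (x n) y / w : R^o)
    (fun z : R^o => Num.sg (z : R)) (rho * sumB x m / w).
Proof.
move=> w0; rewrite /Tval !walk_ffun; apply: eq_bigr => y _; congr (_ * _).
rewrite add0r -(sgZ_inv _ w0); congr (Num.sg _).
rewrite -mulr_suml -mulrDl; congr (_ / _).
by rewrite /sumB mulr_sumr -big_split; apply: eq_bigr => n _; rewrite /ctr /= addrC subrK.
Qed.

(* On these exceptional inputs the proportion of big blocks is too far from 1/4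
   for the noised sum to be compared with a walk of constant variance. *)
Definition badx (x : nat -> cube 3) (m : nat) : bool :=
  m%:R / lnn R m ^+ 4 < `|4 * (nbig R x m)%:R - m%:R|.

(** Must be [o(1 / log m)], because the noise operator is compared with [1 / log m]. With
    [m / (log m)^4] unmatched steps at [(log m)^2 / m] each, the second-order part is of order
    [(log m)^-2], whence the exponent 4. *)
Definition errT (K : R) (m : nat) : R := m%:R * (4 * K * (8 / wid R m) ^+ 3)
   + (m%:R / lnn R m ^+ 4 + 4) * (4 * K * (8 / wid R m) ^+ 2).

Lemma errT_cvg K : (fun m => lnn R m * errT K m) @ \oo --> (0 : R).
Proof.
have h1 := cvg_seqZ (c := 4 * K * 8 ^+ 3) (@lnn_pow_sqrt R 4).
have h2 := cvg_seqZ (c := 4 * K * 8 ^+ 2) (@lnn_inv0 R).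
have h3 := cvg_seqZ (c := 16 * K * 8 ^+ 2) (cvg_seqM (@lnn_pow_sqrt R 3) (@cvg_inv_sqrt R)).
have := cvg_seqD h1 (cvg_seqD h2 h3); rewrite !mulr0 !addr0; apply: cvg_near; near=> m.
have s0 : 0 < Num.sqrt m%:R :> R by near: m; exact: sqrt_pos_near.
have m0 : 0 < m%:R :> R by rewrite -sqrtr_gt0.
have l1 : 1 <= lnn R m by near: m; exact: lnn_gt0_near.
have l0 : 0 < lnn R m by lra.
have e : m%:R = Num.sqrt m%:R ^+ 2 :> R by rewrite sqr_sqrtr // ltW.
rewrite /errT /wid; set s := Num.sqrt m%:R in s0 e *; rewrite e.
by field; rewrite !gt_eqF.
Unshelve. all: end_near. Qed.

Lemma walk_mono (V : zmodType) (T : finType) m (p : nat -> T -> R) X (phi psi : V -> R) z :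
  (forall n, law (p n)) -> (forall x, phi x <= psi x) ->
  walk m p X phi z <= walk m p X psi z.
Proof.
by move=> hp h; elim: m z => [//|m IH] z /=; apply: conv_mono.
Qed.

(** The sign is squeezed between smooth signs shifted by [eta] either way, to which the comparison
    of walks applies; these are in turn squeezed by sharp signs shifted by [2 * eta]. *)
Lemma Tval_bounds eta : 0 < eta -> exists2 K, 0 <= K & forall x m, 8 <= wid R m -> ~~ badx x m ->
  let b := rho * sumB x m / wid R m in let l := sgm rho / wid R m in
  - lat m (fun k => sgp (2 * eta - b + k * l)) - errT K m <= Tval x m
  <= lat m (fun k => sgp (b + 2 * eta + k * l)) + errT K m.
Proof.
move=> e0; have [K1 K10 s1] := smooth_ssg_shift eta eta.
have [K2 K20 s2] := smooth_ssg_shift eta (- eta).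
exists (K1 + K2); first by rewrite addr_ge0.
move=> x m w8 nb; cbv zeta; set b := rho * sumB x m / wid R m; set l := sgm rho / wid R m.
have w0 : 0 < wid R m by lra.
have hl n : law (noise rho (x n)) by exact: noise_law.
have errK K : 0 <= K -> K <= K1 + K2 -> m%:R * (4 * K * (8 / wid R m) ^+ 3)
     + (`|4 * (nbig R x m)%:R - m%:R| + 4) * (4 * K * (8 / wid R m) ^+ 2) <= errT (K1 + K2) m.
  move=> K0 KK; have u0 : 0 <= 8 / wid R m by rewrite divr_ge0 // ltW.
  apply: lerD.
    by rewrite ler_wpM2l // ler_wpM2r ?exprn_ge0 // ler_wpM2l.
  apply: ler_pM.
  - by rewrite addr_ge0.
  - by rewrite mulr_ge0 ?exprn_ge0 // mulr_ge0.
  - by rewrite lerD2r leNgt.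
  - by rewrite ler_wpM2r ?exprn_ge0 // ler_wpM2l.
rewrite (Tval_scaled x m w0) -/b; apply/andP; split.
  have c2 := noise_walk_compare rho01 w8 K20 s2 x m b.
  have {}c2 := le_trans c2 (errK K2 K20 ltac:(lra)).
  move: c2; rewrite ler_norml => /andP[c2 _].
  apply: (@le_trans _ _ (lat m (fun k => ssg eta (b + k * l - eta)) - errT (K1 + K2) m)).
    rewrite lerD2r -mulN1r -latZ lat_half [leRHS]lat_half; apply: lat_mono => k.
    rewrite ler_pM2r ?invr_gt0 //.
    have /andP[a1 _] := ssgN (b + k * l) e0; have /andP[a2 _] := ssgN (b + - k * l) e0.
    have -> : 2 * eta - b + k * l = - (b + - k * l) + 2 * eta by ring.
    have -> : 2 * eta - b + - k * l = - (b + k * l) + 2 * eta by ring.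
    lra.
  apply: (@le_trans _ _ (walk m (fun n => noise rho (x n)) (fun n y => ctr rho (x n) y / wid R m : R^o)
    (fun z : R^o => ssg eta (z - eta)) b)).
    by move: c2; rewrite /l; lra.
  by apply: walk_mono => // z; have /andP[] := ssgN z e0.
have c1 := noise_walk_compare rho01 w8 K10 s1 x m b.
have {}c1 := le_trans c1 (errK K1 K10 ltac:(lra)).
move: c1; rewrite ler_norml => /andP[_ c1].
apply: (@le_trans _ _ (walk m (fun n => noise rho (x n)) (fun n y => ctr rho (x n) y / wid R m : R^o)
    (fun z : R^o => ssg eta (z + eta)) b)).
  by apply: walk_mono => // z; exact: sg_le_ssg.
apply: (@le_trans _ _ (lat m (fun k => ssg eta (b + k * l + eta)) + errT (K1 + K2) m)).
  by move: c1; rewrite /l; lra.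
rewrite lerD2r; apply: lat_mono => k; rewrite [b + 2 * eta + _]addrAC.
exact: ssg_le_sgp.
Qed.

Lemma win_cvg (s b c0 : R) : 0 < s -> 0 < b -> (fun m => Num.sqrt m%:R * p0 R m) @ \oo --> c0 ->
  (fun m => lnn R m * win m 0 (s / wid R m) b) @ \oo --> 2 * c0 / s * b.
Proof.
move=> s0 b0 hc.
have up := cvg_seqM hc (cvg_seqD (cvg_seq_cst (c := 2 * b / s)) (@wid_inv0 R)).
have lo := cvg_seqM hc (cvg_seqM (cvg_seqD (cvg_seq_cst (c := 1))
   (cvg_seqZ (c := - (b / s) ^+ 2) (@wid_sq R)))
   (cvg_seqD (cvg_seq_cst (c := 2 * b / s)) (cvg_seqZ (c := -1) (@wid_inv0 R)))).
have sq : (fun m => (b / s) ^+ 2 * (wid R m ^+ 2 / m%:R)) @ \oo --> (b / s) ^+ 2 * 0.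
  exact: cvg_seqZ (@wid_sq R).
rewrite mulr0 in sq.
have e1 : c0 * (2 * b / s + 0) = 2 * c0 / s * b by rewrite addr0; ring.
have e2 : c0 * ((1 + - (b / s) ^+ 2 * 0) * (2 * b / s + -1 * 0)) = 2 * c0 / s * b by ring.
rewrite e1 in up; rewrite e2 in lo.
have sq1 : \forall m \near \oo, (b / s) ^+ 2 * (wid R m ^+ 2 / m%:R) <= 1.
  move/cvgrPdist_le: sq => /(_ 1 ltr01); apply: filterS => m'.
  by rewrite sub0r normrN; apply: le_trans; exact: ler_norm.
apply/cvg_lesim; split.
  move/cvg_lesim: up => [up _]; apply: (lesim_trans _ up); apply: lesim_near; near=> m.
  have w0 : 0 < wid R m by near: m; exact: wid_gt0_near.
  have m0 : (0 < m)%N by near: m; exact: nbhs_infty_gt.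
  have l1 : 1 <= lnn R m by near: m; exact: lnn_gt0_near.
  have l0 : 0 < lnn R m by lra.
  have sw : 0 < s / wid R m by rewrite divr_gt0.
  have h := ler_wpM2l (ltW l0) (win_le 0 m0 sw (ltW b0)).
  apply: (le_trans h); rewrite le_eqVlt; apply/orP; left; apply/eqP.
  have sq0 : 0 < Num.sqrt m%:R :> R by rewrite sqrtr_gt0 ltr0n.
  by rewrite /wid; field; rewrite !gt_eqF.
move/cvg_lesim: lo => [_ lo]; apply: (lesim_trans lo); apply: lesim_near; near=> m.
have w0 : 0 < wid R m by near: m; exact: wid_gt0_near.
have m0 : (0 < m)%N by near: m; exact: nbhs_infty_gt.
have mR : 0 < m%:R :> R by rewrite ltr0n.
have l1 : 1 <= lnn R m by near: m; exact: lnn_gt0_near.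
have l0 : 0 < lnn R m by lra.
have sw : 0 < s / wid R m by rewrite divr_gt0.
have sq0 : 0 < Num.sqrt m%:R :> R by rewrite sqrtr_gt0 ltr0n.
have Dm : (b * wid R m / s) ^+ 2 <= m%:R.
  have h : (b / s) ^+ 2 * (wid R m ^+ 2 / m%:R) <= 1 by near: m; exact: sq1.
  rewrite mulrA ler_pdivrMr // mul1r in h; apply: le_trans h.
  by rewrite le_eqVlt; apply/orP; left; apply/eqP; ring.
have cD : `|0 : R| + b <= s / wid R m * (b * wid R m / s).
  by rewrite normr0 add0r le_eqVlt; apply/orP; left; apply/eqP; field; rewrite !gt_eqF.
have h := ler_wpM2l (ltW l0) (win_ge m0 sw (ltW b0) cD Dm).
apply: le_trans h; rewrite le_eqVlt; apply/orP; left; apply/eqP.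
by rewrite /wid; field; rewrite !gt_eqF.
Unshelve. all: end_near. Qed.

Lemma cvg_lt_near (u : nat -> R) (l c : R) : u @ \oo --> l -> l < c ->
  \forall m \near \oo, u m <= c.
Proof.
move=> /cvg_lesim[h _] lc; have d0 : 0 < c - l by rewrite subr_gt0.
by apply: filterS (h _ d0) => m; lra.
Qed.

Lemma cvg_gt_near (u : nat -> R) (l c : R) : u @ \oo --> l -> c < l ->
  \forall m \near \oo, c < u m.
Proof.
move=> /cvg_lesim[_ h] lc; have d0 : 0 < (l - c) / 2 by rewrite divr_gt0 // subr_gt0.
by apply: filterS (h _ d0) => m; lra.
Qed.

Lemma wid_big (A : R) : \forall m \near \oo, A <= wid R m.
Proof.
have A0 : 0 < (1 + `|A|)^-1 by rewrite invr_gt0; have := normr_ge0 A; lra.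
apply: filterS2 (wid_inv_near A0) (@wid_gt0_near R) => m h w0.
rewrite lef_pV2 ?posrE // -?invr_gt0 // in h.
have := ler_norm A; lra.
Qed.

(** For [b = rho * sumB / wid], the noise operator is close to [k0 * b / log m] with
    [k0 = 2 * c0 / sgm]. Equating its absolute value with [1 / log m] gives [c = 1 / (k0 * rho)]. *)
Lemma threshold : exists2 c, 0 < c & forall eta, 0 < eta < c -> \forall m \near \oo,
  forall x, ~~ badx x m ->
   (`|sumB x m| <= (c - eta) * wid R m -> `|Tval x m| <= (lnn R m)^-1) /\
   (`|Tval x m| <= (lnn R m)^-1 -> `|sumB x m| <= (c + eta) * wid R m).
Proof.
have [c0 [c00 hc _]] := p0_sqrt_cvg R.
have [_ s0] := sgm_sq rho01; case/andP: (rho01) => r0 r1.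
pose k0 := 2 * c0 / sgm rho.
have k00 : 0 < k0 by rewrite divr_gt0 // mulr_gt0.
exists (1 / k0 / rho).
  by apply: divr_gt0 => //; apply: divr_gt0.
move=> eta /andP[e0 ec].
have rc : rho * (1 / k0 / rho) = 1 / k0 by rewrite mulrCA divff ?mulr1 // gt_eqF.
have re : 0 < rho * eta by rewrite mulr_gt0.
have re1 : rho * eta < 1 / k0 by rewrite -rc ltr_pM2l.
have e4 : 0 < rho * eta / 4 by rewrite divr_gt0.
have [K K0 hK] := Tval_bounds e4.
(* The smoothing width [rho * eta / 4] shifts [b] by [rho * eta / 2]. These half-widths leave room
   on both sides of [1 / k0], so the limits are strictly below and strictly above 1. *)
have b1p : 0 < 1 / k0 - rho * eta / 2 by lra.
have b2p : 0 < 1 / k0 + rho * eta / 4 by rewrite addr_gt0 // divr_gt0.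
have W1 := cvg_seqD (win_cvg s0 b1p hc) (errT_cvg K).
have W2 := cvg_seqD (win_cvg s0 b2p hc) (cvg_seqZ (c := -1) (errT_cvg K)).
have kk : k0 * (1 / k0) = 1 by rewrite mulrC divfK // gt_eqF.
have kr : 0 < k0 * (rho * eta) by rewrite mulr_gt0.
have W1' := cvg_lt_near W1 (c := 1) ltac:(rewrite -/k0; lra).
have W2' := cvg_gt_near W2 (c := 1) ltac:(rewrite -/k0; lra).
near=> m.
have l1 : 1 <= lnn R m by near: m; exact: lnn_gt0_near.
have l0 : 0 < lnn R m by lra.
have w8 : 8 <= wid R m by near: m; exact: wid_big.
have w0 : 0 < wid R m by lra.
have w1 : lnn R m * win m 0 (sgm rho / wid R m) (1 / k0 - rho * eta / 2) + lnn R m * errT K m <= 1.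
  by near: m; exact: W1'.
have w2 : 1 < lnn R m * win m 0 (sgm rho / wid R m) (1 / k0 + rho * eta / 4) + -1 * (lnn R m * errT K m).
  by near: m; exact: W2'.
have w1b : win m 0 (sgm rho / wid R m) (1 / k0 - rho * eta / 2) + errT K m <= (lnn R m)^-1.
  by rewrite -(ler_pM2l l0) mulfV ?gt_eqF // mulrDr.
have w2b : (lnn R m)^-1 < win m 0 (sgm rho / wid R m) (1 / k0 + rho * eta / 4) - errT K m.
  by rewrite -(ltr_pM2l l0) mulfV ?gt_eqF // mulrBr; move: w2; rewrite mulN1r.
move=> x nb; have := hK x m w8 nb; cbv zeta.
set b := rho * sumB x m / wid R m; set l := sgm rho / wid R m; move=> /andP[t1 t2].
have bE t : (`|sumB x m| <= t * wid R m)%R = (`|b| <= rho * t).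
  rewrite /b normrM normfV (gtr0_norm w0) normrM (gtr0_norm r0) ler_pdivrMr //.
  by rewrite -[rho * t * _]mulrA ler_pM2l.
rewrite !bE mulrBr mulrDr rc; split.
  rewrite ler_norml => /andP[b1 b2].
  have h1 := @lat_sgp_le m l (b + 2 * (rho * eta / 4)) (1 / k0 - rho * eta / 2) ltac:(lra) (ltW b1p).
  have h2 := @lat_sgp_le m l (2 * (rho * eta / 4) - b) (1 / k0 - rho * eta / 2) ltac:(lra) (ltW b1p).
  rewrite ler_norml; apply/andP; split; lra.
move=> ht; rewrite leNgt; apply/negP => hb.
have : 1 / k0 + rho * eta < b \/ b < - (1 / k0 + rho * eta).
  case: (leP 0 b) => bs; first by left; rewrite ger0_norm in hb.
  by right; rewrite ltr0_norm // in hb; lra.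
move: ht; rewrite ler_norml => /andP[ht1 ht2]; case=> hb'.
  have := @lat_sgp_neg m l (2 * (rho * eta / 4) - b) (1 / k0 + rho * eta / 4) (ltW b2p) ltac:(lra).
  lra.
have := @lat_sgp_neg m l (b + 2 * (rho * eta / 4)) (1 / k0 + rho * eta / 4) (ltW b2p) ltac:(lra).
lra.
Unshelve. all: end_near. Qed.

End Threshold.

(** * From profiles to blocks *)

Section Blocks.

Lemma div3_lt m (i : 'I_(3 * m)) : (i %/ 3 < m)%N.
Proof. by have h := ltn_ord i; rewrite ltn_divLR // [(m * 3)%N]mulnC. Qed.

Lemma mod3_lt (i : nat) : (i %% 3 < 3)%N.
Proof. by rewrite ltn_mod. Qed.

Lemma cmb_lt m (a : 'I_m) (b : 'I_3) : (3 * a + b < 3 * m)%N.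
Proof. by have := ltn_ord a; have := ltn_ord b; case: a b => a ha [b hb] /=; lia. Qed.

Definition cmb m (a : 'I_m) (b : 'I_3) : 'I_(3 * m) := Ordinal (cmb_lt a b).
Definition hi m (i : 'I_(3 * m)) : 'I_m := Ordinal (div3_lt i).
Definition lo m (i : 'I_(3 * m)) : 'I_3 := Ordinal (mod3_lt i).

Lemma cmbK m (i : 'I_(3 * m)) : cmb (hi i) (lo i) = i.
Proof. by apply: val_inj; rewrite /= mulnC -divn_eq. Qed.

Lemma hi_cmb m (a : 'I_m) b : hi (cmb a b) = a.
Proof. by apply: val_inj; rewrite /= mulnC divnMDl // divn_small ?addn0. Qed.

Lemma lo_cmb m (a : 'I_m) b : lo (cmb a b) = b.
Proof. by apply: val_inj; rewrite /= mulnC modnMDl modn_small. Qed.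

Definition glue (T : Type) m (w : {ffun 'I_m -> {ffun 'I_3 -> T}}) : {ffun 'I_(3 * m) -> T} :=
  [ffun i => w (hi i) (lo i)].

Definition blocks_of (T : Type) m (x : {ffun 'I_(3 * m) -> T}) : {ffun 'I_m -> {ffun 'I_3 -> T}} :=
  [ffun a => [ffun b => x (cmb a b)]].

Lemma glueK (T : Type) m : cancel (@glue T m) (@blocks_of T m).
Proof. by move=> w; apply/ffunP => a; apply/ffunP => b; rewrite !ffunE hi_cmb lo_cmb. Qed.

Lemma blocksK (T : Type) m : cancel (@blocks_of T m) (@glue T m).
Proof. by move=> w; apply/ffunP => i; rewrite !ffunE cmbK. Qed.

Lemma big_blocks (R : Type) (idx : R) (op : Monoid.com_law idx) m (F : 'I_(3 * m) -> R) :
  \big[op/idx]_i F i = \big[op/idx]_(a < m) \big[op/idx]_(b < 3) F (cmb a b).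
Proof.
rewrite pair_big /= (reindex (fun p : 'I_m * 'I_3 => cmb p.1 p.2)) //=.
exists (fun i => (hi i, lo i)) => [[a b] _|i _] /=; last exact: cmbK.
by rewrite hi_cmb lo_cmb.
Qed.

Lemma sum_block (R : zmodType) m (F : 'I_(3 * m) -> R) (a : 'I_m) :
  \sum_(j < 3 * m | (j %/ 3 == a)%N) F j = \sum_(b < 3) F (cmb a b).
Proof.
rewrite (reindex_onto (cmb a) (@lo m)) /=; last first.
  move=> i /eqP e; rewrite -[RHS]cmbK; congr (cmb _ _); apply: val_inj.
  by rewrite /= e.
apply: eq_bigl => b; rewrite lo_cmb eqxx andbT.
by rewrite mulnC divnMDl // divn_small ?addn0 ?eqxx.
Qed.

Context (R : realType).

Lemma mean_glue (T : finType) m (F : {ffun 'I_(3 * m) -> T} -> R) :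
  mean F = mean (fun w : {ffun 'I_m -> {ffun 'I_3 -> T}} => F (glue w)).
Proof.
rewrite /mean (reindex (@glue T m)); last first.
  by apply: onW_bij; exists (@blocks_of T m); [exact: glueK|exact: blocksK].
apply: eq_bigr => w _; congr (_ * _); rewrite /unif; congr (_%:R^-1).
apply: esym; apply: bij_eq_card; exists (@blocks_of T m); [exact: glueK|exact: blocksK].
Qed.

Lemma pairwise_blocks m (x : cube (3 * m)) :
  pairwise_cmp R x = Num.sg (\sum_a mB R (blocks_of x a)).
Proof.
rewrite /pairwise_cmp; congr (Num.sg _); apply: eq_bigr => a _.
rewrite sum_block -maj_sg; congr (Num.sg _); apply: eq_bigr => b _.
by rewrite !ffunE.
Qed.

Definition blk_seq m (x : cube (3 * m)) (n : nat) : cube 3 :=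
  if insub n is Some i then blocks_of x i else [ffun=> true].

Lemma blk_seqE m (x : cube (3 * m)) (i : 'I_m) : blk_seq x i = blocks_of x i.
Proof. by rewrite /blk_seq valK. Qed.

Lemma noise_op_Tval m rho (x : cube (3 * m)) :
  noise_op rho (@pairwise_cmp R m) x = Tval rho (blk_seq x) m.
Proof.
rewrite /Tval walk_ffun /noise_op (reindex (@glue bool m)); last first.
  by apply: onW_bij; exists (@blocks_of bool m); [exact: glueK|exact: blocksK].
apply: eq_bigr => y _; rewrite pairwise_blocks glueK add0r; congr (_ * _).
rewrite /noise big_blocks; apply: eq_bigr => a _; rewrite blk_seqE.
by apply: eq_bigr => b _; rewrite !ffunE hi_cmb lo_cmb.
Qed.

Definition prf m (k : 'I_3) (w : profile (3 * m)) : cube (3 * m) := prefs k (ordS k) w.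

Lemma prf_block m k (w : {ffun 'I_m -> triple}) a :
  uB R (blocks_of (prf k (glue w)) a) = uu R k (w a) /\
  vB R (blocks_of (prf k (glue w)) a) = vv R k (w a).
Proof.
split; rewrite /uB /uu /vB /vv; [congr (_ / 2)|congr (- _ / 2)]; apply: eq_bigr => b _;
  by rewrite /xs !ffunE hi_cmb lo_cmb.
Qed.

Lemma pairwise_prf m k (w : {ffun 'I_m -> triple}) :
  pairwise_cmp R (prf k (glue w)) = Num.sg (tot (Mk R k) w).
Proof.
rewrite pairwise_blocks /tot; congr (Num.sg _); apply: eq_bigr => a _.
by rewrite /mB /Mk; have [-> ->] := prf_block k w a.
Qed.

Lemma xabE m (w : profile (3 * m)) : xab w = prf alt_a w.
Proof. by rewrite /xab /prf; congr prefs; exact: val_inj. Qed.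

Lemma xbcE m (w : profile (3 * m)) : xbc w = prf alt_b w.
Proof. by rewrite /xbc /prf; congr prefs; exact: val_inj. Qed.

Lemma xcaE m (w : profile (3 * m)) : xca w = prf alt_c w.
Proof. by rewrite /xca /prf; congr prefs; exact: val_inj. Qed.

(** A sum of an odd number of signs is odd. *)
Lemma tot_Mk_neq0 m k (w : {ffun 'I_m -> triple}) : odd m -> tot (Mk R k) w != 0.
Proof.
move=> om; pose b (a : 'I_m) : bool := Mk R k (w a) == 1.
have e a : Mk R k (w a) = 2 * (b a)%:R - 1.
  have h : Mk R k (w a) * Mk R k (w a) = 1.
    have := mB_sq R (blocks_of (prf k (glue w)) a).
    by rewrite /mB /Mk; have [-> ->] := prf_block k w a.
  rewrite /b; case: eqP => [->|/eqP n]; first by rewrite mulr1; ring.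
  have : (Mk R k (w a) - 1) * (Mk R k (w a) + 1) = 0 by rewrite mulrDr mulrBl h; ring.
  move/eqP; rewrite mulf_eq0 subr_eq0 (negPf n) /= => /eqP h'.
  rewrite mulr0; lra.
rewrite /tot (eq_bigr _ (fun a _ => e a)) sumrB -mulr_sumr -natr_sum sumr_const card_ord.
rewrite subr_eq0 -natrM eqr_nat; apply/eqP => h.
by move: om; rewrite -h mul2n odd_double.
Qed.

Lemma cpr_mean n (A B : {set profile n}) :
  cpr R A B = mean (fun w => (w \in A)%:R * (w \in B)%:R) / mean (fun w => (w \in B)%:R).
Proof.
have H (C : {set profile n}) : pr R C = mean (fun w => (w \in C)%:R).
  rewrite /pr /mean /unif -mulr_sumr mulrC; congr (_ * _).
  by rewrite -sum1_card natr_sum big_mkcond; apply: eq_bigr => w _; case: ifP.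
rewrite /cpr !H; congr (_ / _); apply: eq_mean => w.
by rewrite finset.in_setI -natrM mulnb.
Qed.

Lemma cycle_ind m (w : {ffun 'I_m -> triple}) : odd m ->
  (glue w \in ev_cycle R m)%:R =
  (1 + Num.sg (tot (Mk R alt_a) w) * Num.sg (tot (Mk R alt_b) w)
     + Num.sg (tot (Mk R alt_b) w) * Num.sg (tot (Mk R alt_c) w)
     + Num.sg (tot (Mk R alt_c) w) * Num.sg (tot (Mk R alt_a) w)) / 4 :> R.
Proof.
move=> om; rewrite inE xabE xbcE xcaE !pairwise_prf.
have n k := tot_Mk_neq0 k w om.
have sg12 (x : R) : x != 0 -> Num.sg x = 1 \/ Num.sg x = -1.
  by case: (ltgtP x 0) => // h _; [right; rewrite ltr0_sg|left; rewrite gtr0_sg].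
have e1 : ((1 : R) == -1) = false by apply/negP => /eqP; lra.
have e2 : ((-1 : R) == 1) = false by apply/negP => /eqP; lra.
by case: (sg12 _ (n alt_a)) => ->; case: (sg12 _ (n alt_b)) => ->; case: (sg12 _ (n alt_c)) => ->;
  rewrite ?eqxx ?e1 ?e2 /=; field.
Qed.

Definition evw (Ev : forall m, {set profile (3 * m)}) m (w : {ffun 'I_m -> triple}) : bool :=
  glue w \in Ev m.

Definition ratio (S : forall m, {ffun 'I_m -> triple} -> R) (Ev : forall m, {set profile (3 * m)}) m : R :=
  mean (fun w : {ffun 'I_m -> triple} => S m w * (evw Ev w)%:R) /
  mean (R := R) (fun w : {ffun 'I_m -> triple} => (evw Ev w)%:R).

Definition sgpair (k l : 'I_3) m (w : {ffun 'I_m -> triple}) : R :=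
  Num.sg (tot (Mk R k) w) * Num.sg (tot (Mk R l) w).

(** The constant term of the indicator is kept as a quotient, which is 0 rather than 1 when the
    event is empty. *)
Lemma cpr_ratio (Ev : forall m, {set profile (3 * m)}) m : odd m ->
  cpr R (ev_cycle R m) (Ev m) =
  (mean (R := R) (fun w : {ffun 'I_m -> triple} => (evw Ev w)%:R) /
    mean (R := R) (fun w : {ffun 'I_m -> triple} => (evw Ev w)%:R)
   + ratio (sgpair alt_a alt_b) Ev m + ratio (sgpair alt_b alt_c) Ev m
   + ratio (sgpair alt_c alt_a) Ev m) / 4.
Proof.
move=> om; rewrite cpr_mean !mean_glue.
have -> : mean (fun w : {ffun 'I_m -> triple} => (glue w \in ev_cycle R m)%:R * (glue w \in Ev m)%:R)
  = (mean (R := R) (fun w : {ffun 'I_m -> triple} => (evw Ev w)%:R)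
     + mean (fun w : {ffun 'I_m -> triple} => sgpair alt_a alt_b w * (evw Ev w)%:R)
     + mean (fun w : {ffun 'I_m -> triple} => sgpair alt_b alt_c w * (evw Ev w)%:R)
     + mean (fun w : {ffun 'I_m -> triple} => sgpair alt_c alt_a w * (evw Ev w)%:R)) * 4^-1 :> R.
  rewrite -!meanD -meanZr; apply: eq_mean => w; rewrite -/(evw Ev w) cycle_ind // /sgpair.
  by field.
by rewrite /ratio -!mulrDl mulrAC.
Qed.

End Blocks.

(** * The two conditioning events *)

Section Events.
Context (R : realType).

Definition lim_val (tau : R) : R := 1 - 3 * acos (rcor tau) / (2 * pi).

Lemma cvg_odd (u v : nat -> R) (l : R) : (forall m, odd m -> v m = u m) -> u @ \oo --> l ->
  (fun k : nat => v k.*2.+1) @ \oo --> l.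
Proof.
move=> uv /cvgrPdist_le h; apply/cvgrPdist_le => e e0.
have [N _ hN] := h e e0; exists N => // k /= Nk.
rewrite uv /= ?odd_double //; apply: hN => /=.
by apply: (leq_trans Nk); rewrite -addnn -addSn; exact: leq_addl.
Qed.

(** All three pairs of comparisons share the correlation [rcor], so the limit is
    [(1 + 3 * (1 - 2 * acos rcor / pi)) / 4]. *)
Lemma cycle_limit (tau c : R) (Ev : forall m, {set profile (3 * m)})
    (Bad : forall m, {ffun 'I_m -> triple} -> bool) :
  0 <= tau < 1 -> 0 < c ->
  (fun m => mean (R := R) (fun w : {ffun 'I_m -> triple} => (Bad m w)%:R) / nrm R m) @ \oo --> (0 : R) ->
  (forall eta, 0 < eta < c -> \forall m \near \oo, forall w : {ffun 'I_m -> triple}, ~~ Bad m w ->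
     (inwin (Bk tau) (c - eta) w ==> evw Ev w) && (evw Ev w ==> inwin (Bk tau) (c + eta) w)) ->
  (fun k : nat => cpr R (ev_cycle R k.*2.+1) (Ev k.*2.+1)) @ \oo --> lim_val tau.
Proof.
move=> t01 c0 hBad hEv.
have J k l kl := joint_limit t01 (i := k) (j := l) kl c0 hBad hEv.
have [j1 j0] := J alt_a alt_b isT; have [j2 _] := J alt_b alt_c isT; have [j3 _] := J alt_c alt_a isT.
have := cvg_seqZ (c := 1 / 4) (cvg_seqD (cvg_seqD (cvg_seqD j0 j1) j2) j3).
have -> : 1 / 4 * (1 + (1 - 2 * acos (rcor tau) / pi) + (1 - 2 * acos (rcor tau) / pi)
    + (1 - 2 * acos (rcor tau) / pi)) = lim_val tau.
  have p0 : (pi : R) != 0 by apply: lt0r_neq0; exact: pi_gt0.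
  rewrite /lim_val; move: p0; move: (acos _) (pi : R) => x y y0.
  by field; exact: y0.
move=> H; apply: (cvg_odd (v := fun m => cpr R (ev_cycle R m) (Ev m)) _ H) => m om.
rewrite (cpr_ratio _ _ om) div1r mulrC.
by congr (_ * (_ + _ + _ + _)).
Qed.

(** Equals 3 on a unanimous block and -1 otherwise, that is four times the indicator of [big] minus
    1, written in [u] so that [mean_uu] gives its mean. *)
Let G (k : 'I_3) (t : triple) : R := 2 * uu R k t ^+ 2 - 3 / 2.

Lemma mean_G k : mean (G k) = 0.
Proof.
transitivity (mean (fun t => 2 * (uu R k t * uu R k t) + - (3 / 2))).
  by apply: eq_mean => t; rewrite /G expr2.
by rewrite meanD meanZ mean_uu (mean_cst ([ffun=> ranking0] : triple)) /cx eqxx; field.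
Qed.

Lemma uu_uB k t : uu R k t = uB R [ffun b => (t b k < t b (ordS k))%N].
Proof. by rewrite /uu /uB; congr (_ / 2); apply: eq_bigr => b _; rewrite /xs ffunE. Qed.

Lemma G_norm k t : `|G k t| <= 3.
Proof.
rewrite /G uu_uB; have [->|->] := uB_sq R [ffun b => (t b k < t b (ordS k))%N];
  rewrite ler_norml; apply/andP; split; lra.
Qed.

Lemma mean_tot_sq (T : finType) (t0 : T) (g : T -> R) m : mean g = 0 ->
  mean (fun w : {ffun 'I_m -> T} => (\sum_j g (w j)) ^+ 2) = m%:R * mean (fun t => g t ^+ 2).
Proof.
move=> g0; rewrite -(@mean_walk R R^o T m (g : T -> R^o) (fun z : R^o => (z : R) ^+ 2)).
suff H z : uwalk m (g : T -> R^o) (fun z : R^o => (z : R) ^+ 2) z = (z : R) ^+ 2 + m%:R * mean (fun t => g t ^+ 2).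
  by rewrite H expr0n add0r.
elim: m z => [|m IH] z; first by rewrite mul0r addr0.
rewrite /uwalk /= -/(uwalk m _ _) (eq_conv _ _ _ IH).
transitivity (mean (fun t => (z : R) ^+ 2 + 2 * z * g t + (g t ^+ 2 + m%:R * mean (fun t => g t ^+ 2)))).
  by apply: eq_bigr => t _; congr (_ * _); rewrite sqrrD mulr_natl -mulrA mulr_natl; ring.
by rewrite !meanD (meanZ (2 * z) g) g0 !(mean_cst t0) -natr1; ring.
Qed.

Let X k m (w : {ffun 'I_m -> triple}) := blk_seq (prf k (glue w)).

Lemma nbig_tot k m (w : {ffun 'I_m -> triple}) :
  4 * (nbig R (X k w) m)%:R - m%:R = tot (G k) w.
Proof.
rewrite /nbig natr_sum /tot mulr_sumr.
have -> : m%:R = \sum_(j < m) 1 :> R by rewrite sumr_const card_ord.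
rewrite -sumrB; apply: eq_bigr => a _; rewrite /X blk_seqE /big /G.
have [<- _] := prf_block R k w a.
by case: eqP => [->|h] /=; [field|have [e|->] := uB_sq R (blocks_of (prf k (glue w)) a); [case: h|field]].
Qed.

Definition badw m (w : {ffun 'I_m -> triple}) : bool := [exists k, badx R (X k w) m].

(** Chebyshev: for each pair the squared deviation has mean at most [9 * m], against the squared
    tolerance [(m / (log m)^4)^2]. Three pairs give [27 * (log m)^8 / m]. *)
Lemma badw_small : (fun m => mean (R := R) (fun w : {ffun 'I_m -> triple} => (badw w)%:R) / nrm R m) @ \oo --> (0 : R).
Proof.
have h := cvg_seqZ (c := 27) (@nrm_cvg0 R 8); rewrite mulr0 in h.
apply: squeeze0 h; near=> m.
have m0 : 0 < m%:R :> R by rewrite ltr0n; near: m; exact: nbhs_infty_gt.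
have s0 : 0 < Num.sqrt m%:R :> R by rewrite sqrtr_gt0.
have l1 : 1 <= lnn R m by near: m; exact: lnn_gt0_near.
have l0 : 0 < lnn R m by lra.
have n0 : 0 < nrm R m by near: m; exact: nrm_gt0_near.
have t0 : triple := [ffun=> ranking0].
apply/andP; split.
  apply: divr_ge0 (ltW n0); rewrite -(mean_cst ([ffun=> t0] : {ffun 'I_m -> triple}) 0).
  by apply: mean_mono => w; rewrite ler0n.
rewrite mulrA ler_pM2r ?invr_gt0 //.
pose A := m%:R / lnn R m ^+ 4; have A0 : 0 < A by rewrite divr_gt0 // exprn_gt0.
have pt (w : {ffun 'I_m -> triple}) : (badw w)%:R <= \sum_k (tot (G k) w) ^+ 2 / A ^+ 2.
  have pos k : 0 <= tot (G k) w ^+ 2 / A ^+ 2 by apply: divr_ge0; exact: sqr_ge0.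
  rewrite /badw; case: existsP => [[k hk]|_]; last by apply: sumr_ge0.
  rewrite (bigD1 k) //=; apply: (@le_trans _ _ (tot (G k) w ^+ 2 / A ^+ 2)); last first.
    by rewrite lerDl; apply: sumr_ge0.
  move: hk; rewrite /badx nbig_tot -/A => hk.
  rewrite ler_pdivlMr ?exprn_gt0 // mul1r -[leRHS](ger0_norm (sqr_ge0 _)) normrX.
  by apply: lerXn2r; rewrite ?nnegrE ?(ltW A0) ?(ltW hk).
apply: (le_trans (mean_mono pt)); rewrite mean_sum.
have each k : mean (fun w : {ffun 'I_m -> triple} => tot (G k) w ^+ 2 / A ^+ 2) <= 9 * (lnn R m ^+ 8 / m%:R).
  rewrite meanZr /tot (mean_tot_sq t0 m (mean_G k)).
  have g9 : mean (fun t => G k t ^+ 2) <= 9.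
    rewrite -[leRHS](mean_cst t0); apply: mean_mono => t.
    rewrite -(ger0_norm (sqr_ge0 (G k t))) normrX.
    by apply: (@le_trans _ _ (3 ^+ 2)); [rewrite lerXn2r ?nnegrE // G_norm|lra].
  rewrite ler_pdivrMr ?exprn_gt0 //; apply: (@le_trans _ _ (m%:R * 9)); first by rewrite ler_pM2l.
  by rewrite /A le_eqVlt; apply/orP; left; apply/eqP; field; rewrite !gt_eqF.
apply: (@le_trans _ _ (27 * (lnn R m ^+ 8 / m%:R))).
  by rewrite sum3; have := each alt_a; have := each alt_b; have := each alt_c; lra.
rewrite ler_pM2l // ler_pM2l ?exprn_gt0 // lef_pV2 ?posrE //.
have m1 : 1 <= m%:R :> R by rewrite ler1n -(ltr0n R).
rewrite -[leRHS]sqr_sqrtr ?(ltW m0) // expr2 ler_peMl // ?(ltW s0) //.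
by rewrite -[leLHS]sqrtr1 ler_sqrt.
Unshelve. all: end_near. Qed.

Lemma ord3_forall (P : 'I_3 -> bool) : [&& P alt_a, P alt_b & P alt_c] = [forall k, P k].
Proof.
apply/and3P/forallP => [[a b c] k|h]; last by split.
by case: (ord3P k) => ->.
Qed.

Lemma ev_F_limit rho : 0 < rho < 1 ->
  (fun k : nat => prob_F rho k.*2.+1) @ \oo --> lim_val (rho ^+ 2).
Proof.
move=> rho01; case/andP: (rho01) => r0 r1.
have t01 : 0 <= rho ^+ 2 < 1 by rewrite sqr_ge0 expr_lt1 // ltW.
have [c c0 hc] := threshold rho01.
apply: (cycle_limit (Ev := fun m => ev_F m rho (Num.sqrt m%:R / ln m%:R)) t01 c0 badw_small).
move=> eta he; have := hc eta he; apply: filterS2 (@sqrt_pos_near R) => m s0 hm w nb.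
have nbk k : ~~ badx R (X k w) m by apply: contra nb => h; apply/existsP; exists k.
have sB k : sumB rho (X k w) m = tot (Bk (rho ^+ 2) k) w.
  rewrite /sumB /tot; apply: eq_bigr => a _; rewrite /X blk_seqE /Bk.
  by have [-> ->] := prf_block R k w a.
have evE : evw (fun m => ev_F m rho (Num.sqrt m%:R / ln m%:R)) w =
    [forall k, `|Tval rho (X k w) m| <= (lnn R m)^-1].
  rewrite /evw inE !ge_max xabE xbcE xcaE !noise_op_Tval -ord3_forall.
  by rewrite (_ : Num.sqrt m%:R / ln m%:R / Num.sqrt m%:R = (lnn R m)^-1) // mulrAC divff ?mul1r // gt_eqF.
rewrite evE; apply/andP; split; apply/implyP => /forallP h; apply/forallP => k.
  by have [h1 _] := hm _ (nbk k); apply: h1; rewrite sB.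
by have [_ h2] := hm _ (nbk k); rewrite -sB; apply: h2.
Qed.

Lemma ev_E_limit : (fun k : nat => prob_E R k.*2.+1) @ \oo --> lim_val 0.
Proof.
(* The sum of the [n = 3m] votes is twice the total of [u], and [sqrt n] is [sqrt 3 * sqrt m]. The
   extra [ln 3] in the logarithm is absorbed by [eta]. *)
pose c : R := Num.sqrt 3 / 2.
have c0 : 0 < c by rewrite divr_gt0 // sqrtr_gt0.
pose nobad m (w : {ffun 'I_m -> triple}) := false.
have hb : (fun m => mean (R := R) (fun w : {ffun 'I_m -> triple} => (nobad m w)%:R) / nrm R m) @ \oo --> (0 : R).
  apply: eq_cvg_seq (cvg_seq_cst (c := 0)) => m.
  rewrite (mean_cst ([ffun=> [ffun=> ranking0]] : {ffun 'I_m -> triple})) mul0r //.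
apply: (cycle_limit (Ev := fun m => @ev_E R (3 * m) (Num.sqrt (3 * m)%:R / ln (3 * m)%:R)) _ c0 hb).
  by rewrite lexx ltr01.
move=> eta /andP[e0 ec].
have q := cvg_seqD (cvg_seq_cst (c := 1)) (cvg_seqZ (c := ln 3) (@lnn_inv0 R)).
rewrite mulr0 addr0 in q.
have l3 : 0 <= ln 3 :> R by rewrite ln_ge0 //; lra.
have ev := cvg_lt_near (cvg_seqZ (c := c - eta) q) (c := c) ltac:(lra).
apply: filterS3 (@sqrt_pos_near R) (@lnn_gt0_near R) ev => m s0 l1 hm w _.
have m0 : 0 < m%:R :> R by rewrite -sqrtr_gt0.
have l0 : 0 < lnn R m by lra.
have w0 : 0 < wid R m by rewrite divr_gt0.
have ln3m : ln (3 * m)%:R = ln 3 + lnn R m by rewrite natrM lnM ?posrE.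
have d0 : 0 < ln 3 + lnn R m by lra.
have evE : evw (fun m => @ev_E R (3 * m) (Num.sqrt (3 * m)%:R / ln (3 * m)%:R)) w =
    [forall k, `|tot (Bk 0 k) w| <= c * Num.sqrt m%:R / (ln 3 + lnn R m)].
  rewrite /evw inE xabE xbcE xcaE -ord3_forall.
  have e k : (`|\sum_(i < 3 * m) pm1 R (prf k (glue w) i)| <= Num.sqrt (3 * m)%:R / ln (3 * m)%:R)%R
     = (`|tot (Bk 0 k) w| <= c * Num.sqrt m%:R / (ln 3 + lnn R m)).
    have -> : \sum_(i < 3 * m) pm1 R (prf k (glue w) i) = 2 * tot (Bk 0 k) w.
      rewrite big_blocks /tot mulr_sumr; apply: eq_bigr => a _.
      rewrite /Bk mul0r addr0; have [<- _] := prf_block R k w a.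
      rewrite /uB mulrC divfK //; apply: eq_bigr => b _; by rewrite !ffunE.
    rewrite normrM ger0_norm // ln3m natrM sqrtrM // -[in RHS](ler_pM2l (ltr0n R 2)).
    by congr (_ <= _); rewrite /c; field; rewrite gt_eqF.
  by rewrite !e.
have up : c * Num.sqrt m%:R / (ln 3 + lnn R m) <= (c + eta) * wid R m.
  rewrite /wid mulrA; apply: (@le_trans _ _ (c * Num.sqrt m%:R / lnn R m)).
    rewrite ler_pM2l ?mulr_gt0 // lef_pV2 ?posrE //; lra.
  by rewrite ler_pM2r ?invr_gt0 // ler_pM2r // lerDl ltW.
have lo : (c - eta) * wid R m <= c * Num.sqrt m%:R / (ln 3 + lnn R m).
  rewrite ler_pdivlMr //.
  have := ler_wpM2r (ltW s0) hm; apply: le_trans.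
  by rewrite /wid le_eqVlt; apply/orP; left; apply/eqP; field; rewrite gt_eqF.
rewrite evE; apply/andP; split; apply/implyP => /forallP h; apply/forallP => k.
  exact: le_trans (h k) lo.
exact: le_trans (h k) up.
Qed.

End Events.

(** * Numerical bounds *)

Section Numerics.
Context (R : realType).
Implicit Types x y b t r : R.

Lemma derive_ge0_le (f df : R -> R) x : (forall x, is_derive x 1 f (df x)) ->
  (forall x, 0 <= x -> 0 <= df x) -> 0 <= x -> f 0 <= f x.
Proof.
move=> hf hd x0.
have [//|c] := MVT_segment x0 (fun y _ => hf y).
  by apply: derivable_within_continuous => y _; apply: ex_derive.
rewrite in_itv /= subr0 => /andP[c0 _] h.
by rewrite -subr_ge0 h mulr_ge0 // hd.
Qed.

(** Integrating [1 - cos x >= 0] gives this bound, and two further integrations give the next two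
    lemmas. *)
Lemma sin_le_id x : 0 <= x -> sin x <= x.
Proof.
move=> x0; rewrite -subr_ge0.
have -> : 0 = 0 - sin 0 :> R by rewrite sin0 subr0.
apply: (@derive_ge0_le (fun x => x - sin x) (fun x => 1 - cos x)) => // y.
Qed.

Lemma cos_ge_quad x : 0 <= x -> 1 - x ^+ 2 / 2 <= cos x.
Proof.
move=> x0; rewrite -subr_ge0.
have -> : 0 = cos 0 - (1 - 0 ^+ 2 / 2) :> R by rewrite cos0; ring.
apply: (@derive_ge0_le (fun x => cos x - (1 - x ^+ 2 / 2)) (fun x => x - sin x)) => // y.
  by apply: is_derive_eq; rewrite /GRing.scale /=; field.
by move=> y0; rewrite subr_ge0 sin_le_id.
Qed.

Lemma sin_ge_cubic x : 0 <= x -> x - x ^+ 3 / 6 <= sin x.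
Proof.
move=> x0; rewrite -subr_ge0.
have -> : 0 = sin 0 - (0 - 0 ^+ 3 / 6) :> R by rewrite sin0; ring.
apply: (@derive_ge0_le (fun x => sin x - (x - x ^+ 3 / 6)) (fun x => cos x - (1 - x ^+ 2 / 2))) => // y.
  by apply: is_derive_eq; rewrite /GRing.scale /=; field.
by move=> y0; rewrite subr_ge0 cos_ge_quad.
Qed.

(** The triple angle formula at [pi / 6] yields the cosine and sine exactly; the polynomial bounds
    then exclude values of [pi] outside the interval. *)
Lemma pi_bounds : 306 / 100 <= (pi : R) <= 317 / 100.
Proof.
have p0 := pi_gt0 R; have p4 := pihalf_lt2 R; have p2 := pihalf_ge1 R.
have c3 : cos (pi / 2) = 4 * cos (pi / 6) ^+ 3 - 3 * cos (pi / 6) :> R.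
  have -> : pi / 2 = pi / 6 + pi / 6 *+ 2 :> R by move: (pi : R) => p; field.
  rewrite cosD cos_mulr2n sin_mulr2n.
  have := cos2Dsin2 (pi / 6 : R); move: (cos _) (sin _) => c s h.
  transitivity (2 * c ^+ 3 - c - 2 * c * s ^+ 2); first by ring.
  by rewrite [s ^+ 2](_ : _ = 1 - c ^+ 2); [ring|rewrite -h; ring].
have c0 : 0 < cos (pi / 6 : R) by apply: cos_gt0_pihalf; apply/andP; split; lra.
have c2 : cos (pi / 6) ^+ 2 = 3 / 4 :> R.
  move: c3; rewrite cos_pihalf => c3.
  have /eqP : cos (pi / 6) * (4 * cos (pi / 6) ^+ 2 - 3) = 0 :> R by rewrite c3; ring.
  by rewrite mulf_eq0 gt_eqF //= subr_eq0 => /eqP <-; field.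
have s0 : 0 < sin (pi / 6 : R) by apply: sin_gt0_pi; apply/andP; split; lra.
have s1 : sin (pi / 6) = 1 / 2 :> R.
  have := cos2Dsin2 (pi / 6 : R); rewrite c2 => h.
  move: s0 h; clear; move: (sin _) => s s0 h.
  by apply/le_anti/andP; split; nra.
(* Too small a [pi] makes [cos (pi / 6)] at least 86/99, whose square exceeds 3/4; too large a one
   gives [132 / 250 < pi / 6], where the cubic bound already makes the sine exceed 1/2. *)
apply/andP; split; rewrite leNgt; apply/negP => h.
  have cl : 86 / 99 <= cos (pi / 6 : R).
    apply: le_trans (@cos_ge_quad (pi / 6) ltac:(lra)).
    have : (pi / 6) ^+ 2 <= (51 / 100) ^+ 2 :> R by rewrite ler_sqr ?nnegrE; lra.
    lra.
  have : (86 / 99) ^+ 2 <= cos (pi / 6) ^+ 2 :> R by rewrite ler_sqr ?nnegrE; lra.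
  rewrite c2; lra.
have := @sin_ge_cubic (132 / 250) ltac:(lra).
have : sin (132 / 250) < sin (pi / 6 : R) by rewrite ltr_sin ?in_itv /=; try apply/andP; try split; lra.
rewrite s1; lra.
Qed.

(** Compares cosines, using [cos (pi / 2 + b) = - sin b] and the cubic lower bound for the sine. *)
Lemma acos_ub r b : -1 <= r <= 1 -> 0 <= b <= 1 -> - r <= b - b ^+ 3 / 6 ->
  acos r <= pi / 2 + b.
Proof.
move=> r1 /andP[b0 b1] h; have p2 := pihalf_ge1 R; have p0 := pi_gt0 R.
rewrite leNgt; apply/negP => lt.
have : cos (acos r) < cos (pi / 2 + b).
  rewrite ltr_cos // in_itv /= ?acos_ge0 ?acos_lepi //.
  by apply/andP; split; lra.
rewrite acosK ?in_itv // addrC cosDpihalf.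
have := sin_ge_cubic b0; lra.
Qed.

Lemma acos_lb r b : -1 <= r <= 1 -> 0 <= b <= 1 -> b <= - r -> pi / 2 + b <= acos r.
Proof.
move=> r1 /andP[b0 b1] h; have p2 := pihalf_ge1 R; have p0 := pi_gt0 R.
rewrite leNgt; apply/negP => lt.
have : cos (pi / 2 + b) < cos (acos r).
  rewrite ltr_cos // in_itv /= ?acos_ge0 ?acos_lepi //.
  by apply/andP; split; lra.
rewrite acosK ?in_itv // addrC cosDpihalf.
have := sin_le_id b0; lra.
Qed.

End Numerics.

Section LimitValue.
Context (R : realType).

Lemma rcor_range (tau : R) : 0 <= tau < 1 -> 1 / 27 <= - rcor tau <= 162 / 1000.
Proof.
move=> /andP[t0 t1]; rewrite /rcor opprK.
have q0 := sqr_ge0 tau.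
have q1 : tau ^+ 2 <= 1 by rewrite expr_le1 // ltW.
move: (tau ^+ 2) q0 q1 => q q0 q1.
have d : 0 < 729 + 525 * q by lra.
by rewrite ler_pdivlMr // ler_pdivrMr //; apply/andP; split; lra.
Qed.

Lemma rcor0 : rcor (0 : R) = - (1 / 27).
Proof. by rewrite /rcor expr0n !mulr0 !addr0; congr (- _); field. Qed.

Lemma lim_val_eq (tau : R) : lim_val tau = 1 - 3 / (2 * pi) * acos (rcor tau).
Proof. by rewrite /lim_val mulrAC. Qed.

Lemma lim_val_bounds (tau : R) : 0 <= tau < 1 -> 17 / 100 <= lim_val tau <= lim_val 0.
Proof.
move=> t01; have /andP[y1 y2] := rcor_range t01.
have /andP[r1 r2] := rcor_bounds tau.
have r12 : -1 <= rcor tau <= 1 by rewrite (ltW r1) (ltW r2).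
have s12 : -1 <= rcor (0 : R) <= 1 by rewrite rcor0; apply/andP; split; lra.
have /andP[p1 p2] := pi_bounds R; have p0 := pi_gt0 R.
have d0 : 0 < 2 * pi :> R by rewrite mulr_gt0.
apply/andP; split.
  (* This angle satisfies [b - b^3 / 6 >= 0.162], and the resulting bound 0.83 needs only
     [pi >= 3.06]. *)
  have ub := @acos_ub R (rcor tau) (163 / 1000) r12 ltac:(apply/andP; split; lra) ltac:(lra).
  have : 3 * acos (rcor tau) / (2 * pi) <= 83 / 100 by rewrite ler_pdivrMr //; lra.
  rewrite /lim_val; lra.
rewrite /lim_val lerD2l lerN2 ler_pM2r ?invr_gt0 // ler_pM2l // leNgt; apply/negP => lt.
have : cos (acos (rcor 0)) < cos (acos (rcor tau)).
  by rewrite ltr_cos // in_itv /= acos_ge0 ?acos_lepi.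
by rewrite !acosK ?in_itv // rcor0; lra.
Qed.

Lemma lim_val0 : `|lim_val 0 - 232 / 1000| <= 5 / 10000 :> R.
Proof.
have s12 : -1 <= rcor (0 : R) <= 1 by rewrite rcor0; apply/andP; split; lra.
have /andP[p1 p2] := pi_bounds R; have p0 := pi_gt0 R.
have d0 : 0 < 2 * pi :> R by rewrite mulr_gt0.
(* The angle 23/620 slightly exceeds 1/27, enough to offset its cubic correction; with the lower
   angle 1/27, the bounds on [pi] place the value between 0.2315 and 0.2325. *)
have ub := @acos_ub R (rcor 0) (23 / 620) s12 ltac:(apply/andP; split; lra)
  ltac:(rewrite rcor0; lra).
have lb := @acos_lb R (rcor 0) (1 / 27) s12 ltac:(apply/andP; split; lra)
  ltac:(rewrite rcor0; lra).
have u : 3 * acos (rcor 0) / (2 * pi) <= 1537 / 2000 :> R by rewrite ler_pdivrMr //; lra.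
have l : 307 / 400 <= 3 * acos (rcor 0) / (2 * pi) :> R by rewrite ler_pdivlMr //; lra.
have -> : 5 / 10000 = 1 / 2000 :> R by field.
by rewrite /lim_val ler_norml; apply/andP; split; lra.
Qed.

Lemma lim_val_cvg0 : lim_val (rho ^+ 2) @[rho --> (0 : R)^'+] --> (lim_val 0 : R).
Proof.
have q : (rho ^+ 2 : R) @[rho --> (0 : R)^'+] --> (0 : R).
  have := @exprn_continuous R 2 0; rewrite /continuous_at expr0n.
  exact: cvg_at_right_filter.
have r : rcor (rho ^+ 2 : R) @[rho --> (0 : R)^'+] --> (rcor 0 : R).
  have q2 : ((rho ^+ 2) ^+ 2 : R) @[rho --> (0 : R)^'+] --> (0 ^+ 2 : R).
    rewrite [X in _ --> X]expr2; under eq_fun do rewrite expr2.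
    exact: (cvgM q q).
  have lin a b : (a + b * (rho ^+ 2) ^+ 2 : R) @[rho --> (0 : R)^'+] --> (a + b * 0 ^+ 2 : R).
    by apply: cvgD; [exact: cvg_cst|apply: cvgM q2; exact: cvg_cst].
  apply: cvgN; apply: cvgM (lin _ _) _; apply: cvgV (lin _ _).
  by rewrite expr0n mulr0 addr0; apply: lt0r_neq0; lra.
have c : {for rcor 0, continuous (@acos R)}.
  by apply: continuous_acos; rewrite rcor0; apply/andP; split; lra.
under eq_fun do rewrite lim_val_eq.
rewrite (lim_val_eq 0); apply: cvgB; first exact: cvg_cst.
apply: cvgM; first exact: cvg_cst.
exact: cvg_comp r c.
Qed.

End LimitValue.

Theorem theorem1p6 (R : realType) :
  [/\ (fun k : nat => prob_E R k.*2.+1) @ \oo --> alpha_star R,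
      `|alpha_star R - 232 / 1000| <= 5 / 10000 &
      exists alpha : R -> R,
        (forall rho : R, 0 < rho < 1 ->
           17 / 100 <= alpha rho <= alpha_star R /\
           (fun k : nat => prob_F rho k.*2.+1) @ \oo --> alpha rho) /\
        alpha rho @[rho --> (0 : R)^'+] --> alpha_star R].
Proof.
have -> : alpha_star R = lim_val 0 by exact/cvg_lim/ev_E_limit.
split; [exact: ev_E_limit|exact: lim_val0|].
exists (fun rho => lim_val (rho ^+ 2)); split; last exact: lim_val_cvg0.
move=> rho rho01; split; last exact: ev_F_limit.
case/andP: rho01 => r0 r1.
by apply: lim_val_bounds; rewrite sqr_ge0 expr_lt1 // ltW.
Qed.
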